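(* There are no new identities in degree 9 for the partially alternating ternary sum: every multilinear polynomial identity of degree 9 satisfied by the partially alternating ternary sum (over $\mathbb{Q}$) is a consequence of the four identities $P\equiv 0$, $Q\equiv 0$, $R\equiv 0$ and $S\equiv 0$, where (writing $(xyz)$ for $(x,y,z)$) $$P(a,b,c)=(abc)+(acb),\qquad Q(a,b,c,d,e)=(a(bcd)e)+(a(cbd)e),$$ $$R(a,b,c,d,e,f,g)=\frac1{12}\sum_{\sigma\in S_6}\epsilon(\sigma)\,((a(b^\sigma c^\sigma d^\sigma)e^\sigma)f^\sigma g^\sigma)-\frac1{12}\sum_{\sigma\in S_6}\epsilon(\sigma)\,((ab^\sigma c^\sigma)(d^\sigma e^\sigma f^\sigma)g^\sigma),$$ with $S_6$ acting on $\{b,c,d,e,f,g\}$, and $$S(a,b,c,d,e,f,g)=\frac14\sum_{\sigma\in S_5}\epsilon(\sigma)(((ab^\sigma c^\sigma)d^\sigma g)e^\sigma f^\sigma)-\frac16\sum_{\sigma\in S_5}\epsilon(\sigma)((a(b^\sigma c^\sigma d^\sigma)e^\sigma)f^\sigma g)+\frac14\sum_{\sigma\in S_5}\epsilon(\sigma)((a(b^\sigma c^\sigma g)d^\sigma)e^\sigma f^\sigma)$$ $$\qquad+\frac1{12}\sum_{\sigma\in S_5}\epsilon(\sigma)((ab^\sigma c^\sigma)(d^\sigma e^\sigma f^\sigma)g)-\frac16\sum_{\sigma\in S_5}\epsilon(\sigma)(a((b^\sigma c^\sigma d^\sigma)e^\sigma g)f^\sigma)-\frac1{12}\sum_{\sigma\in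 S_5}\epsilon(\sigma)(a(b^\sigma c^\sigma d^\sigma)(e^\sigma f^\sigma g)),$$ with $S_5$ acting on $\{b,c,d,e,f\}$.
   Context: The base field is $\mathbb{Q}$. An (associative) dialgebra is a vector space $A$ with two bilinear products $\dashv,\vdash$ satisfying $(a\dashv b)\dashv c=a\dashv(b\dashv c)$, $(a\vdash b)\vdash c=a\vdash(b\vdash c)$, $(a\vdash b)\dashv c=a\vdash(b\dashv c)$, $(a\dashv b)\vdash c=(a\vdash b)\vdash c$, $a\dashv(b\dashv c)=a\dashv(b\vdash c)$. The partially alternating ternary sum (PATS) is the trilinear operation on a dialgebra $$[a,b,c]=a\dashv b\dashv c-a\dashv c\dashv b-b\vdash a\dashv c+c\vdash a\dashv b+b\vdash c\vdash a-c\vdash b\vdash a .$$ A ternary algebra is a vector space with a trilinear product $(\cdot,\cdot,\cdot)$. A (ternary) polynomial of degree $n$ is a linear combination of monomials of degree $n$ in the free (nonassociative) ternary algebra on a set of variables; it is multilinear if each of $n$ variables occurs exactly once in each monomial. A polynomial identity $f\equiv 0$ is satisfied by the PATS if $f$ vanishes for all values of the variables in every dialgebra when $(\cdot,\cdot,\cdot)$ is interpreted as the PATS. An identity is a consequence of a set of identities if it holds in every ternary algebra over $\mathbb{Q}$ satisfying all the identities of that set; an identity is new if it is not a consequence of identities of lower degree. Here $\epsilon(\sigma)$ is the sign of $\sigma$ and $x^\sigma$ is the image of the variable $x$ under $\sigma$. *)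

(* Defs.v *)
From HB Require Import structures.
From mathcomp Require Import all_boot all_order all_algebra all_fingroup.
From mathcomp Require Import finmap monalg.

Set Implicit Arguments.
Unset Strict Implicit.
Unset Printing Implicit Defensive.

Import GRing.Theory.
Local Open Scope ring_scope.

Section Algebras.
Variable A : lmodType rat.

Definition is_bilinear (op : A -> A -> A) : Prop :=
  (forall b, linear (fun a => op a b)) /\ (forall a, linear (op a)).

Definition is_trilinear (mu : A -> A -> A -> A) : Prop :=
  [/\ forall b c, linear (fun a => mu a b c),
      forall a c, linear (fun b => mu a b c)
    & forall a b, linear (mu a b)].

(* [l a b] is a -| b and [r a b] is a |- b. *)
Record is_dialgebra (l r : A -> A -> A) : Prop := IsDialgebra {
  dialg_bilinl : is_bilinear l;
  dialg_bilinr : is_bilinear r;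
  dialg_assocl : forall a b c, l (l a b) c = l a (l b c);
  dialg_assocr : forall a b c, r (r a b) c = r a (r b c);
  dialg_inner : forall a b c, l (r a b) c = r a (l b c);
  dialg_barl : forall a b c, r (l a b) c = r (r a b) c;
  dialg_barr : forall a b c, l a (l b c) = l a (r b c)
}.

(* The unparenthesized triple products in the usual formula are bracketed to
   the left; by the associativity axioms and [dialg_inner] the bracketing is
   irrelevant in a dialgebra. *)
Definition pats (l r : A -> A -> A) (a b c : A) : A :=
  l (l a b) c - l (l a c) b - l (r b a) c + l (r c a) b
  + r (r b c) a - r (r c b) a.

End Algebras.

(* Monomials of the free nonassociative ternary algebra on the countable set
   of variables {x_i : i in nat}. *)
Inductive tmonomial : Type :=
| TVar of nat
| TMul of tmonomial & tmonomial & tmonomial.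

Fixpoint tmonomial_encode (m : tmonomial) : GenTree.tree nat :=
  match m with
  | TVar i => GenTree.Leaf i
  | TMul m1 m2 m3 => GenTree.Node 0
      [:: tmonomial_encode m1; tmonomial_encode m2; tmonomial_encode m3]
  end.

Fixpoint tmonomial_decode (t : GenTree.tree nat) : tmonomial :=
  match t with
  | GenTree.Leaf i => TVar i
  | GenTree.Node _ [:: t1; t2; t3] =>
      TMul (tmonomial_decode t1) (tmonomial_decode t2) (tmonomial_decode t3)
  | _ => TVar 0
  end.

Lemma tmonomial_encodeK : cancel tmonomial_encode tmonomial_decode.
Proof. by elim=> //= m1 -> m2 -> m3 ->. Qed.

HB.instance Definition _ :=
  Countable.copy tmonomial (can_type tmonomial_encodeK).

(* The underlying vector space of the free ternary algebra. *)
Notation tpoly := {malg rat[tmonomial]}.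

Fixpoint leaves (m : tmonomial) : seq nat :=
  match m with
  | TVar i => [:: i]
  | TMul m1 m2 m3 => leaves m1 ++ leaves m2 ++ leaves m3
  end.

Definition tdegree (m : tmonomial) : nat := size (leaves m).

Definition of_degree (n : nat) (f : tpoly) : Prop :=
  forall m, m \in msupp f -> tdegree m = n.

Definition multilinear (n : nat) (f : tpoly) : Prop :=
  exists xs : seq nat, [/\ uniq xs, size xs = n &
    forall m, m \in msupp f -> perm_eq (leaves m) xs].

Section Evaluation.
Variables (A : lmodType rat) (mu : A -> A -> A -> A).

Fixpoint meval (v : nat -> A) (m : tmonomial) : A :=
  match m with
  | TVar i => v i
  | TMul m1 m2 m3 => mu (meval v m1) (meval v m2) (meval v m3)
  end.

Definition teval (v : nat -> A) (f : tpoly) : A :=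
  \sum_(m <- msupp f) f@_m *: meval v m.

Definition satisfies (f : tpoly) : Prop := forall v : nat -> A, teval v f = 0.

End Evaluation.

Definition pats_identity (f : tpoly) : Prop :=
  forall (D : lmodType rat) (l r : D -> D -> D),
    is_dialgebra l r -> satisfies (pats l r) f.

Definition consequence (I : tpoly -> Prop) (f : tpoly) : Prop :=
  forall (A : lmodType rat) (mu : A -> A -> A -> A),
    is_trilinear mu -> (forall g, I g -> satisfies mu g) -> satisfies mu f.

Definition lower_pats_identity (n : nat) (g : tpoly) : Prop :=
  exists2 k, (k < n)%N & of_degree k g /\ pats_identity g.

Definition new_pats_identity (n : nat) (f : tpoly) : Prop :=
  [/\ of_degree n f, pats_identity f & ~ consequence (lower_pats_identity n) f].

Section Identities.

Local Notation "''(' x , y , z ')'" := (TMul x y z) (at level 0).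
Local Notation a := (TVar 0).
Local Notation b := (TVar 1).
Local Notation c := (TVar 2).
Local Notation d := (TVar 3).
Local Notation e := (TVar 4).
Local Notation g := (TVar 6).

Definition identP : tpoly := << '(a, b, c) >> + << '(a, c, b) >>.

Definition identQ : tpoly :=
  << '(a, '(b, c, d), e) >> + << '(a, '(c, b, d), e) >>.

(* 'S_n.+1 permutes the variables x_1, ..., x_n.+1, that is b, c, d, ...:
   [pvar s i] is the image under s of x_i.+1, for i <= n. *)
Definition pvar (n : nat) (s : 'S_n.+1) (i : nat) : tmonomial :=
  TVar (s (inord i)).+1.

Definition alt_sum (n : nat) (F : 'S_n.+1 -> tmonomial) : tpoly :=
  \sum_(s : 'S_n.+1) (-1) ^+ s *: << F s >>.

Local Notation "s .b" := (pvar s 0) (at level 2, format "s .b").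
Local Notation "s .c" := (pvar s 1) (at level 2, format "s .c").
Local Notation "s .d" := (pvar s 2) (at level 2, format "s .d").
Local Notation "s .e" := (pvar s 3) (at level 2, format "s .e").
Local Notation "s .f" := (pvar s 4) (at level 2, format "s .f").
Local Notation "s .g" := (pvar s 5) (at level 2, format "s .g").

Definition identR : tpoly :=
    12%:R^-1 *: alt_sum (fun s : 'S_6 =>
      '('(a, '(s.b, s.c, s.d), s.e), s.f, s.g))
  - 12%:R^-1 *: alt_sum (fun s : 'S_6 =>
      '('(a, s.b, s.c), '(s.d, s.e, s.f), s.g)).

Definition identS : tpoly :=
    4%:R^-1 *: alt_sum (fun s : 'S_5 =>
      '('('(a, s.b, s.c), s.d, g), s.e, s.f))
  - 6%:R^-1 *: alt_sum (fun s : 'S_5 =>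
      '('(a, '(s.b, s.c, s.d), s.e), s.f, g))
  + 4%:R^-1 *: alt_sum (fun s : 'S_5 =>
      '('(a, '(s.b, s.c, g), s.d), s.e, s.f))
  + 12%:R^-1 *: alt_sum (fun s : 'S_5 =>
      '('(a, s.b, s.c), '(s.d, s.e, s.f), g))
  - 6%:R^-1 *: alt_sum (fun s : 'S_5 =>
      '(a, '('(s.b, s.c, s.d), s.e, g), s.f))
  - 12%:R^-1 *: alt_sum (fun s : 'S_5 =>
      '(a, '(s.b, s.c, s.d), '(s.e, s.f, g))).

End Identities.

Definition PQRS (h : tpoly) : Prop := [\/ h = identP, h = identQ, h = identR | h = identS].

(* Main.v *)
From Stdlib Require Import BinInt FMapPositive Btauto.
Require Import Defs.
From HB Require Import structures.
From mathcomp Require Import all_boot all_order all_algebra all_fingroup.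
From mathcomp Require Import finmap monalg.
From mathcomp Require Import zify ssrZ.

(* Grouping the monomials of an identity by their centre, the leftmost variable,
   reduces the PATS to the alternating ternary sum (ATS).  A dialgebra on the square
   of an associative algebra isolates the monomials with a given centre; conversely,
   the split null extension of an algebra that satisfies P, Q, R and S is alternating
   and satisfies R modulo an ideal, because R with another centre is a combination of
   R and S.  After a twist by the sign of the order of the leaves, the ATS becomes
   symmetric in its arguments.  By Maschke's theorem, the twisted multilinear
   polynomials of degree 9 that vanish in all associative algebras are spanned by
   projections k_m of the monomials m, and modulo the consequences of R, k_m is
   invariant under the exchange of sibling leaves of m.  These leaves form blocks of
   sizes (3, 2, 2, 2) or (3, 3, 2, 1), up to refinement, and the second case reduces
   to the first.  So it suffices to treat the polynomials that are symmetric in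
   classes of 3, 2, 2 and 2 variables.  They have 866 coefficients, and the equations
   from 754 words together with 112 consequences of R have full rank modulo 31. *)

Set Implicit Arguments.
Unset Strict Implicit.
Unset Printing Implicit Defensive.

Import GRing.Theory Num.Theory.
Local Open Scope ring_scope.

(** * Signs of words *)

(** There are 9! * 55 multilinear monomials of degree 9, too many for direct elimination, so
    symmetry has to be extracted first. The twist is what provides it: monomials become unordered
    trees, and a polynomial that is symmetric in classes of variables sees only the colours of the
    leaves. The block sizes are forced by arithmetic: four products have nine leaves as factors, at
    most three each, which leaves (3, 3, 3, 0), (3, 3, 2, 1) and (3, 2, 2, 2). The invariance of k_m
    comes from the projection itself. If m' is m with two sibling leaves exchanged, then m' - m is a
    consequence, hence vanishes in associative algebras, hence is fixed by the projection. So k_m' -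
    k_m is the consequence m' - m, and equivariance expresses k_m' as a relabelling of k_m. The
    coloured classes are divided into two kinds. On the first kind the chosen consequences of R form
    an invertible matrix and can clear any values; after that, the word equations form an invertible
    system on the second kind. Two triangular eliminations over a small field thus replace one large
    rank computation over the rationals. *)

Fixpoint odd_inv (w : seq nat) : bool :=
  if w is x :: w' then odd (count (gtn x) w') (+) odd_inv w' else false.

Definition cross (u v : seq nat) : bool := odd (\sum_(x <- u) count (gtn x) v).

Definition sgn (w : seq nat) : rat := if uniq w then (-1) ^+ odd_inv w else 0.

Lemma addb_xorb x y : x (+) y = xorb x y.
Proof. by case: x; case: y. Qed.

Lemma odd_inv_cat u v : odd_inv (u ++ v) = odd_inv u (+) odd_inv v (+) cross u v.
Proof.
elim: u => [|x u IHu] /=; first by rewrite /cross big_nil addbF.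
rewrite IHu count_cat oddD /cross big_cons oddD.
by rewrite !addb_xorb; btauto.
Qed.

Lemma cross_perm u u' v v' : perm_eq u u' -> perm_eq v v' -> cross u v = cross u' v'.
Proof.
move=> pu pv; congr odd; rewrite (perm_big _ pu) /=.
by apply: eq_bigr => x _; apply/seq.permP.
Qed.

Lemma cross_catr s t r : cross s (t ++ r) = cross s t (+) cross s r.
Proof.
by rewrite /cross -oddD -big_split; congr odd; apply: eq_bigr => ? _; rewrite count_cat.
Qed.

(** Two distinct letters form an inversion in exactly one of their two orders, so the two counts add
    up to the number of pairs. *)
Lemma cross_sym u v : uniq (u ++ v) ->
  cross u v (+) cross v u = odd (size u) && odd (size v).
Proof.
move=> uv; rewrite /cross -oddD -oddM; congr odd.
elim: u uv => [|x u IHu] /=; first by rewrite big_nil add0n mul0n big1_seq.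
case/andP=> xuv uv; rewrite big_cons mulSn -IHu //.
have -> : (\sum_(y <- v) count (gtn y) (x :: u) =
  count (ltn x) v + \sum_(y <- v) count (gtn y) u)%N.
  by rewrite /= big_split /= -sum1_count [in RHS]big_mkcond.
rewrite addnACA; congr addn.
move: xuv; rewrite mem_cat => /norP[_].
elim: v {IHu uv} => //= y v IHv; rewrite inE => /norP[xy xv].
by rewrite addnACA IHv //; move: xy; case: (ltngtP x y).
Qed.

(** Only the inversions between the two exchanged blocks change. *)
Lemma sgn_swap a b c d :
  sgn (a ++ c ++ b ++ d) = (-1) ^+ (odd (size b) && odd (size c)) * sgn (a ++ b ++ c ++ d).
Proof.
have pp : perm_eq (c ++ b ++ d) (b ++ c ++ d) by rewrite perm_catCA.
have pq : perm_eq (a ++ c ++ b ++ d) (a ++ b ++ c ++ d) by rewrite perm_cat2l.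
rewrite /sgn (perm_uniq pq); case: ifP => [U|_]; last by rewrite mulr0.
rewrite -signr_addb; congr (_ ^+ nat_of_bool _).
rewrite !odd_inv_cat (cross_perm (perm_refl a) pp) -(@cross_sym b c); last first.
  by move: U; rewrite [a ++ _]catA [(a ++ b) ++ _]catA -[(a ++ b) ++ c]catA => /subseq_uniq; apply; rewrite -catA; exact: subseq_trans (prefix_subseq _ d) (suffix_subseq a _).
rewrite !cross_catr.
by rewrite !addb_xorb; btauto.
Qed.

Lemma sgn_swap_odd a b c d : odd (size b) -> odd (size c) ->
  sgn (a ++ c ++ b ++ d) = - sgn (a ++ b ++ c ++ d).
Proof. by move=> ob oc; rewrite sgn_swap ob oc mulN1r. Qed.

(** Adjacent transpositions generate all permutations. The induction carries a settled prefix [a]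
    and moves the next letter of [s] to the front of the rest of [s']. *)
Lemma perm_eq_swap_ind (T : eqType) (V : Type) (f : seq T -> V) :
  (forall a x y b, f (a ++ y :: x :: b) = f (a ++ x :: y :: b)) ->
  forall s s', perm_eq s s' -> f s = f s'.
Proof.
move=> fC s s' ps; rewrite -[s]cat0s -[s']cat0s; move: [::] => a.
elim: s s' ps a => [|x s IHs] s' ps a.
  by move: ps; rewrite perm_sym => /perm_nilP ->.
have /path.splitPr xs' : x \in s' by rewrite -(perm_mem ps) mem_head.
case: xs' ps => u v ps.
have -> : f (a ++ u ++ x :: v) = f (a ++ x :: u ++ v).
  elim/last_ind: u v {ps} => [|u y IHu] v //=.
  by rewrite cat_rcons catA fC -catA IHu cat_rcons.
rewrite -!cat_rcons; apply: IHs.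
by move: ps; rewrite -[x :: v]cat1s perm_sym perm_catCA /= perm_cons perm_sym.
Qed.

(* An odd block behaves like a single letter. *)
Lemma sgn_flatten (q : nat -> seq nat) (p p' : seq nat) :
  (forall i, odd (size (q i))) -> perm_eq p p' ->
  sgn (flatten [seq q i | i <- p]) * sgn p = sgn (flatten [seq q i | i <- p']) * sgn p'.
Proof.
move=> oq; apply: (perm_eq_swap_ind (f := fun p => sgn (flatten [seq q i | i <- p]) * sgn p)).
move=> a x y b /=; rewrite !map_cat !flatten_cat /= sgn_swap_odd //.
by rewrite (@sgn_swap_odd a [:: x] [:: y] b isT isT) mulrNN.
Qed.

Lemma sgnM_self w : uniq w -> sgn w * sgn w = 1.
Proof. by move=> u; rewrite /sgn u -signr_addb addbb. Qed.

Lemma sgn_uniq0 w : ~~ uniq w -> sgn w = 0.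
Proof. by rewrite /sgn => /negbTE ->. Qed.

(** Inversions between different blocks depend only on the sets of letters, so they cancel in the
    product of the two signs. *)
Lemma sgn_block (u v w u' v' w' : seq nat) : uniq (u ++ v ++ w) ->
  perm_eq u' u -> perm_eq v' v -> perm_eq w' w ->
  sgn (u' ++ v' ++ w') * sgn (u ++ v ++ w) =
  (sgn u' * sgn u) * (sgn v' * sgn v) * (sgn w' * sgn w).
Proof.
move=> U pu pv pw.
have pp : perm_eq (u' ++ v' ++ w') (u ++ v ++ w) by rewrite !perm_cat.
have := U; rewrite !cat_uniq => /and3P[Uu _ /and3P[Uv _ Uw]].
rewrite /sgn (perm_uniq pp) U (perm_uniq pu) Uu (perm_uniq pv) Uv (perm_uniq pw) Uw.
rewrite -!signr_addb; congr (_ ^+ nat_of_bool _).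
rewrite !odd_inv_cat (cross_perm pv pw) (cross_perm pu (perm_cat pv pw)).
move: (odd_inv u) (odd_inv u') (odd_inv v) (odd_inv v') (odd_inv w) (odd_inv w').
by move: (cross _ _) (cross _ _) => [] [] [] [] [] [] [] [].
Qed.

(** This form of the parity matches, factor by factor, the double product in the Vandermonde
    determinant. *)
Lemma odd_inv_sum w : odd_inv w =
  odd (\sum_(i < size w) \sum_(j < size w | (i < j)%N) (nth 0%N w j < nth 0%N w i)%N).
Proof.
elim: w => [|x w IHw] /=; first by rewrite big_ord0.
rewrite big_ord_recl oddD IHw /=; congr (odd _ (+) odd _).
  rewrite big_mkcond big_ord_recl /= add0n -sum1_count (big_nth 0%N) big_mkord big_mkcond.
  by apply: eq_bigr => i _; rewrite /=; case: ifP.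
apply: eq_bigr => i _; rewrite [RHS]big_mkcond big_ord_recl /= add0n [LHS]big_mkcond.
by apply: eq_bigr => j _; rewrite /= ltnS.
Qed.

Definition word_of_perm n (s : 'S_n) : seq nat := [seq val (s i) | i <- enum 'I_n].

Lemma size_word_of_perm n (s : 'S_n) : size (word_of_perm s) = n.
Proof. by rewrite size_map size_enum_ord. Qed.

Lemma nth_word_of_perm n (s : 'S_n) (i : 'I_n) : nth 0%N (word_of_perm s) i = s i.
Proof.
by rewrite (nth_map i) ?size_enum_ord ?ltn_ord // nth_ord_enum.
Qed.

Lemma uniq_word_of_perm n (s : 'S_n) : uniq (word_of_perm s).
Proof.
rewrite map_inj_uniq ?enum_uniq // => i j /val_inj; exact: perm_inj.
Qed.

(* Comparing the signs of the two sides of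
   [det (Vandermonde (s i)) = (-1) ^ s * det (Vandermonde i)]. *)
Lemma sgn_word_of_perm n (s : 'S_n) : sgn (word_of_perm s) = (-1) ^+ s.
Proof.
rewrite /sgn uniq_word_of_perm.
pose V (t : 'S_n) := \det (Vandermonde n (\row_j (t j)%:R : 'rV[rat]_n)).
have Vs : V s = (-1) ^+ s * V 1%g.
  rewrite /V mulrC -odd_permV -det_perm -det_mulmx -col_permE; congr (\det _).
  by apply/matrixP => i j; rewrite !mxE perm1.
have sV (t : 'S_n) : Num.sg (V t) = (-1) ^+ odd_inv (word_of_perm t).
  rewrite /V det_Vandermonde odd_inv_sum size_word_of_perm.
  rewrite (big_morph _ (@sgrM _) (@sgr1 _)).
  under eq_bigr => i _ do rewrite (big_morph _ (@sgrM _) (@sgr1 _)).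
  rewrite signr_odd -prodrXr; apply: eq_bigr => i _.
  rewrite -prodrXr; apply: eq_bigr => j ij.
  rewrite !mxE !nth_word_of_perm.
  have : (t j != t i :> nat) by rewrite (inj_eq val_inj) (inj_eq perm_inj) -(inj_eq val_inj) gtn_eqF.
  case: ltngtP => // tij _; first by rewrite expr1 ltr0_sg // subr_lt0 ltr_nat.
  by rewrite expr0 gtr0_sg // subr_gt0 ltr_nat.
have := congr1 Num.sg Vs; rewrite sgrM !sV => ->.
have -> : Num.sg ((-1) ^+ s : rat) = (-1) ^+ s by case: (odd_perm s); rewrite ?sgrN ?sgr1.
suff -> : odd_inv (word_of_perm (1%g : 'S_n)) = false by rewrite mulr1.
have -> : word_of_perm (1%g : 'S_n) = iota 0 n.
  rewrite -val_enum_ord; apply: eq_map => i; by rewrite perm1.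
elim: n 0%N {s V Vs sV} => //= n IHn m; rewrite IHn addbF.
have -> : count (gtn m) (iota m.+1 n) = 0%N; last by [].
by apply/eqP; rewrite -leqn0 leqNgt -has_count; apply/hasPn => x; rewrite mem_iota /= -leqNgt => /andP[/ltnW].
Qed.

(** * Trees *)

Lemma word_of_permP n w :
  reflect (exists s : 'S_n, w = word_of_perm s) (perm_eq w (iota 0 n)).
Proof.
apply: (iffP idP) => [pw | [s ->]]; last first.
  rewrite uniq_perm ?uniq_word_of_perm ?iota_uniq // => i.
  rewrite mem_iota /= add0n; apply/mapP/idP => [[j _ ->]|lin]; first exact: ltn_ord.
  by exists (s^-1%g (Ordinal lin)); rewrite ?mem_enum // permKV.
have sw : size w = n by rewrite (perm_size pw) size_iota.
have nw (i : 'I_n) : (nth 0%N w i < n)%N.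
  have : nth 0%N w i \in iota 0 n by rewrite -(perm_mem pw) mem_nth ?sw.
  by rewrite mem_iota.
have iw : injective (fun i => Ordinal (nw i)).
  move=> i j [/eqP]; rewrite nth_uniq ?sw //; first by move/eqP/val_inj.
  by rewrite (perm_uniq pw) iota_uniq.
exists (perm iw); apply: (@eq_from_nth _ 0%N) => [|i]; first by rewrite size_word_of_perm.
rewrite sw => lin; by rewrite (nth_word_of_perm _ (Ordinal lin)) permE.
Qed.

Lemma word_of_perm_inj n : injective (@word_of_perm n).
Proof.
move=> s t st; apply/permP => i; apply: val_inj.
by rewrite /= -!nth_word_of_perm st.
Qed.

Lemma perm_words n :
  perm_eq [seq word_of_perm s | s <- enum 'S_n] (permutations (iota 0 n)).
Proof.
apply: uniq_perm; rewrite ?permutations_uniq //.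
  by rewrite map_inj_uniq ?enum_uniq //; apply: word_of_perm_inj.
move=> w; rewrite mem_permutations; apply/mapP/word_of_permP => [[s _ ->] | [s ->]].
  by exists s.
by exists s; rewrite ?mem_enum.
Qed.

Lemma sum_words n (V : nmodType) (F : seq nat -> V) :
  \sum_(s : 'S_n) F (word_of_perm s) = \sum_(w <- permutations (iota 0 n)) F w.
Proof. by rewrite -(perm_big _ (perm_words n)) /= big_map big_enum. Qed.

Fixpoint subst (q : nat -> tmonomial) (m : tmonomial) : tmonomial :=
  match m with
  | TVar i => q i
  | TMul a b c => TMul (subst q a) (subst q b) (subst q c)
  end.

Definition relabel (g : nat -> nat) : tmonomial -> tmonomial := subst (fun i => TVar (g i)).

Lemma leaves_subst q m : leaves (subst q m) = flatten [seq leaves (q i) | i <- leaves m].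
Proof. by elim: m => [i|a IHa b IHb c IHc] /=; rewrite ?cats0 // IHa IHb IHc !map_cat !flatten_cat. Qed.

Lemma leaves_relabel g m : leaves (relabel g m) = map g (leaves m).
Proof. by rewrite leaves_subst; elim: (leaves m) => //= i s ->. Qed.

Lemma meval_subst (A : lmodType rat) (mu : A -> A -> A -> A) v q m :
  meval mu v (subst q m) = meval mu (fun i => meval mu v (q i)) m.
Proof. by elim: m => //= a -> b -> c ->. Qed.

Lemma meval_relabel (A : lmodType rat) (mu : A -> A -> A -> A) v g m :
  meval mu v (relabel g m) = meval mu (v \o g) m.
Proof. exact: meval_subst. Qed.

Lemma eq_meval (A : lmodType rat) (mu : A -> A -> A -> A) v v' m :
  {in leaves m, v =1 v'} -> meval mu v m = meval mu v' m.
Proof.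
elim: m => [i|a IHa b IHb c IHc] /= vv'; first by apply: vv'; rewrite mem_head.
by rewrite IHa ?IHb ?IHc // => i im; apply: vv'; rewrite !mem_cat im ?orbT.
Qed.

Lemma subst_relabel q g m : subst q (relabel g m) = subst (q \o g) m.
Proof. by elim: m => //= a -> b -> c ->. Qed.

Lemma relabel_comp g h m : relabel g (relabel h m) = relabel (g \o h) m.
Proof. exact: subst_relabel. Qed.

Lemma eq_subst q q' m : {in leaves m, q =1 q'} -> subst q m = subst q' m.
Proof.
elim: m => [i|a IHa b IHb c IHc] /= qq'; first by apply: qq'; rewrite mem_head.
by rewrite IHa ?IHb ?IHc // => i im; apply: qq'; rewrite !mem_cat im ?orbT.
Qed.

Lemma relabel_id g m : {in leaves m, g =1 id} -> relabel g m = m.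
Proof.
move=> gid; rewrite /relabel (@eq_subst _ TVar) => [|i /gid /= -> //].
by elim: m {gid} => //= a -> b -> c ->.
Qed.

Lemma size_leaves_gt0 m : (0 < size (leaves m))%N.
Proof. by elim: m => //= a IHa b _ c _; rewrite size_cat ltn_addr. Qed.

Lemma odd_leaves m : odd (size (leaves m)).
Proof. by elim: m => //= a oa b ob c oc; rewrite !size_cat !oddD oa ob oc. Qed.

(** * Bracketings and multilinear monomials of degree 9 *)

Fixpoint cuts (w : seq nat) : seq (seq nat * seq nat) :=
  ([::], w) :: if w is x :: w' then [seq (x :: p.1, p.2) | p <- cuts w'] else [::].

(** The number [n] is fuel; the length of [w] suffices, since each factor of a product has fewer
    leaves than the product. *)
Fixpoint bracketings (n : nat) (w : seq nat) : seq tmonomial :=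
  if n is n'.+1 then
    if w is [:: x] then [:: TVar x] else
    [seq TMul t.1 t.2.1 t.2.2 | t <-
       flatten [seq [seq (a, u) | a <- bracketings n' p.1, u <-
         flatten [seq [seq (b, c) | b <- bracketings n' r.1, c <- bracketings n' r.2] | r <- cuts p.2]] | p <- cuts w]]
  else [::].

Lemma mem_cuts w p : (p \in cuts w) = (p.1 ++ p.2 == w).
Proof.
elim: w p => [|x w IHw] [u v] /=; rewrite inE; first by case: u v => [|? ?] [].
case: u => [|y u] /=.
  rewrite xpair_eqE eqxx /= orbC; case: mapP => // [[p _ []]] //.
apply/mapP/eqP => [[p] | [-> uv]].
  by rewrite IHw => /eqP pw [-> -> ->]; rewrite pw.
by exists (u, v); rewrite // IHw /= uv.
Qed.

Lemma mem_bracketings n m : (size (leaves m) <= n)%N -> m \in bracketings n (leaves m).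
Proof.
elim: n m => [|n IHn] m; first by rewrite leqNgt size_leaves_gt0.
case: m => [i _|a b c]; first by rewrite /= inE.
have := (size_leaves_gt0 a, size_leaves_gt0 b, size_leaves_gt0 c).
move=> [[a0 b0] c0] /= sz.
have -> : forall (w : seq nat) S T, (1 < size w)%N -> (if w is [:: x] then S x else T) = T :> seq tmonomial.
  by case=> [|x [|]].
  apply/mapP; exists (a, (b, c)) => //; apply/flatten_mapP; exists (leaves a, leaves b ++ leaves c).
    by rewrite mem_cuts.
  apply/allpairsP; exists (a, (b, c)); split=> //=.
    by apply: IHn; move: sz; rewrite !size_cat; lia.
  apply/flatten_mapP; exists (leaves b, leaves c); first by rewrite mem_cuts.
  by apply/allpairsP; exists (b, c); split=> //=; apply: IHn; move: sz; rewrite !size_cat; lia.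
by rewrite !size_cat; lia.
Qed.

Definition shapes : seq tmonomial := bracketings 9 (iota 0 9).

Lemma shapes_leaves s : s \in shapes -> leaves s = iota 0 9.
Proof.
have /allP H : all (fun s => leaves s == iota 0 9) shapes by vm_compute.
by move/H/eqP.
Qed.

Lemma map_nth_iota (w : seq nat) : map (nth 0%N w) (iota 0 (size w)) = w.
Proof. by rewrite map_nth_iota0 ?take_size. Qed.

Lemma leaves_relabel_shape w s : size w = 9 -> s \in shapes ->
  leaves (relabel (nth 0%N w) s) = w.
Proof. by move=> sw /shapes_leaves sl; rewrite leaves_relabel sl -[X in iota _ X]sw map_nth_iota. Qed.

Lemma map_index_self (w : seq nat) : uniq w -> map (index^~ w) w = iota 0 (size w).
Proof.
move=> uw; apply: (@eq_from_nth _ 0%N); rewrite size_map ?size_iota // => i iw.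
by rewrite (nth_map 0%N) // index_uniq // nth_iota.
Qed.

Lemma size_perm_iota n w : perm_eq w (iota 0 n) -> size w = n.
Proof. by move/perm_size; rewrite size_iota. Qed.

Notation prelabel s := (relabel (nth 0%N (word_of_perm s))).

(** This list serves only as an index set for sums; computations run over [shapes] or over coloured
    classes instead. *)
Definition mtrees : seq tmonomial := [seq prelabel s t | s : 'S_9 <- enum 'S_9, t <- shapes].

Lemma leaves_shape (s : 'S_9) t : t \in shapes -> leaves (prelabel s t) = word_of_perm s.
Proof. by move=> tS; apply: leaves_relabel_shape; rewrite ?size_word_of_perm. Qed.

Lemma mem_mtrees m : (m \in mtrees) = perm_eq (leaves m) (iota 0 9).
Proof.
apply/allpairsP/idP => [[[s t] [_ tS ->]] | pm].
  by rewrite leaves_shape //; apply/word_of_permP; exists s.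
have sm := @size_perm_iota 9 _ pm.
have um : uniq (leaves m) by rewrite (perm_uniq pm) iota_uniq.
have [s ms] := word_of_permP _ _ pm.
exists (s, relabel (index^~ (leaves m)) m); split; first by rewrite mem_enum.
- have -> : shapes = bracketings 9 (leaves (relabel (index^~ (leaves m)) m)).
    by rewrite leaves_relabel map_index_self // sm.
  by apply: mem_bracketings; rewrite leaves_relabel size_map sm.
- by rewrite -ms relabel_comp relabel_id // => i im /=; rewrite nth_index.
Qed.

Lemma uniq_mtrees : uniq mtrees.
Proof.
apply: allpairs_uniq; [exact: enum_uniq | by vm_compute |].
move=> _ _ /allpairsP[[s t] [_ tS ->]] /allpairsP[[s' t'] [_ tS' ->]] /= ws.
have ss : s = s' by apply: word_of_perm_inj; rewrite -(leaves_shape s tS) ws leaves_shape.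
rewrite -ss in ws *; congr pair.
have gK u : u \in shapes -> relabel (index^~ (word_of_perm s)) (prelabel s u) = u.
  move=> uS; rewrite relabel_comp relabel_id // => i.
  by rewrite shapes_leaves // mem_iota /= => i9; rewrite index_uniq ?size_word_of_perm ?uniq_word_of_perm.
by have := congr1 (relabel (index^~ (word_of_perm s))) ws; rewrite (gK t tS) (gK t' tS').
Qed.

Lemma sum_mtrees (V : nmodType) (F : tmonomial -> V) :
  \sum_(m <- mtrees) F m = \sum_(s : 'S_9) \sum_(t <- shapes) F (prelabel s t).
Proof. by rewrite big_allpairs_dep big_enum. Qed.

Lemma leaves_prelabel n (s : 'S_n) m : perm_eq (leaves m) (iota 0 n) ->
  perm_eq (leaves (prelabel s m)) (iota 0 n).
Proof.
move=> pm; rewrite leaves_relabel (perm_trans (perm_map _ pm)) //.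
have := map_nth_iota (word_of_perm s); rewrite size_word_of_perm => ->.
by apply/word_of_permP; exists s.
Qed.

(** The factors are reversed because permutations compose from left to right. *)
Lemma prelabelM n (s t : 'S_n) m : perm_eq (leaves m) (iota 0 n) ->
  prelabel s (prelabel t m) = prelabel (t * s)%g m.
Proof.
move=> pm; rewrite relabel_comp; apply: eq_subst => i; rewrite (perm_mem pm) mem_iota /= => i9.
by rewrite -[i]/(val (Ordinal i9)) !nth_word_of_perm permM.
Qed.

Lemma prelabel1 n m : perm_eq (leaves m) (iota 0 n) -> prelabel (1%g : 'S_n) m = m.
Proof.
move=> pm; apply: relabel_id => i; rewrite (perm_mem pm) mem_iota /= => i9.
by rewrite -[i]/(val (Ordinal i9)) !nth_word_of_perm perm1.
Qed.

Lemma prelabel_mtrees (s : 'S_9) m : m \in mtrees -> prelabel s m \in mtrees.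
Proof. by rewrite !mem_mtrees; apply: leaves_prelabel. Qed.

Lemma sum_mtrees_relabel (V : nmodType) (s : 'S_9) (F : tmonomial -> V) :
  \sum_(m <- mtrees) F (prelabel s m) = \sum_(m <- mtrees) F m.
Proof.
rewrite -(big_map (relabel _) xpredT F) /=; apply: perm_big.
have sK (t : 'S_9) m : m \in mtrees -> prelabel t^-1%g (prelabel t m) = m.
  by rewrite mem_mtrees => pm; rewrite prelabelM // mulgV prelabel1.
apply: uniq_perm; rewrite ?uniq_mtrees //.
  rewrite map_inj_in_uniq ?uniq_mtrees // => m m' mM mM' mm'.
  by rewrite -(sK s m) // mm' sK.
move=> m; apply/mapP/idP => [[m' m'M ->] | mM]; first exact: prelabel_mtrees.
exists (prelabel s^-1%g m); first exact: prelabel_mtrees.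
by rewrite -{1}(invgK s) sK.
Qed.

(** * Planar embeddings of unordered trees *)

Definition orders a b c : seq tmonomial :=
  [:: TMul a b c; TMul a c b; TMul b a c; TMul b c a; TMul c a b; TMul c b a].

(* All ways of permuting the three factors at every node, with repetitions. *)
Fixpoint planar (m : tmonomial) : seq tmonomial :=
  match m with
  | TVar i => [:: TVar i]
  | TMul a b c => flatten [seq flatten [seq flatten [seq orders a' b' c'
      | c' <- planar c] | b' <- planar b] | a' <- planar a]
  end.

Lemma big_planar (V : nmodType) (F : tmonomial -> V) a b c :
  \sum_(x <- planar (TMul a b c)) F x =
  \sum_(a' <- planar a) \sum_(b' <- planar b) \sum_(c' <- planar c)
    \sum_(x <- orders a' b' c') F x.
Proof.
rewrite /= big_flatten big_map; apply: eq_bigr => a' _.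
rewrite big_flatten big_map; apply: eq_bigr => b' _.
by rewrite big_flatten big_map.
Qed.

Lemma planar_mulP a b c x :
  reflect (exists a' b' c', [/\ a' \in planar a, b' \in planar b, c' \in planar c & x \in orders a' b' c'])
          (x \in planar (TMul a b c)).
Proof.
apply: (iffP idP) => [/flatten_mapP[a' a'a] /flatten_mapP[b' b'b] /flatten_mapP[c' c'c xo] | ].
  by exists a', b', c'.
move=> [a' [b' [c' [a'a b'b c'c xo]]]].
by apply/flatten_mapP; exists a' => //; apply/flatten_mapP; exists b' => //; apply/flatten_mapP; exists c'.
Qed.

Lemma planar_relabel g m : planar (relabel g m) = map (relabel g) (planar m).
Proof.
elim: m => [i|a IHa b IHb c IHc] //=; rewrite IHa IHb IHc map_flatten -!map_comp.
congr flatten; apply: eq_map => a' /=; rewrite map_flatten -!map_comp.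
congr flatten; apply: eq_map => b' /=; rewrite map_flatten -!map_comp.
by congr flatten; apply: eq_map => c'.
Qed.

Lemma ordersP a b c x : x \in orders a b c ->
  [\/ x = TMul a b c, x = TMul a c b | x = TMul b a c] \/
  [\/ x = TMul b c a, x = TMul c a b | x = TMul c b a].
Proof.
rewrite !inE => /or4P[/eqP->|/eqP->|/eqP->|/or3P[]/eqP->];
  by [left; constructor | right; constructor].
Qed.

Lemma leaves_planar x m : x \in planar m -> perm_eq (leaves x) (leaves m).
Proof.
elim: m x => [i|a IHa b IHb c IHc] x; first by rewrite inE => /eqP ->.
move=> /planar_mulP[a' [b' [c' [/IHa pa /IHb pb /IHc pc xo]]]].
apply: (@perm_trans _ (leaves (TMul a' b' c'))); last by rewrite /= !perm_cat.
have [[->|->|->]|[->|->|->]] //= := ordersP xo.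
- by rewrite perm_cat2l perm_catC.
- by rewrite perm_catCA.
- by rewrite catA perm_catC.
- by rewrite perm_catC catA.
by rewrite perm_catC -catA perm_catCA.
Qed.

Lemma planar_refl m : m \in planar m.
Proof.
elim: m => [i|a IHa b IHb c IHc]; first by rewrite inE.
by apply/planar_mulP; exists a, b, c; rewrite mem_head.
Qed.

Fixpoint nodes m := if m is TMul a b c then (nodes a + nodes b + nodes c).+1 else 0%N.

Lemma size_leaves m : size (leaves m) = (nodes m).*2.+1.
Proof. by elim: m => //= a IHa b IHb c IHc; rewrite !size_cat IHa IHb IHc; lia. Qed.

Lemma size_planar m : size (planar m) = (6 ^ nodes m)%N.
Proof.
elim: m => //= a IHa b IHb c IHc; rewrite -sum1_size -/(planar (TMul a b c)).
rewrite (big_planar (fun=> 1%N)) /=.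
have cst (r : seq tmonomial) k : (\sum_(x <- r) k)%N = (size r * k)%N.
  by rewrite big_const_seq count_predT iter_addn_0 mulnC.
under eq_bigr => a' _ do under eq_bigr => b' _ do under eq_bigr => c' _ do rewrite sum1_size.
rewrite /= !cst IHa IHb IHc expnS !expnD; move: (6 ^ _)%N (6 ^ _)%N (6 ^ _)%N => x y z; lia.
Qed.

Definition cnt x m := count_mem x (planar m).

Lemma cntE x m : cnt x m = (\sum_(y <- planar m) (y == x))%N.
Proof. by rewrite /cnt -sum1_count big_mkcond. Qed.

Lemma tmul_eq a b c x y z : (TMul a b c == TMul x y z) = [&& a == x, b == y & c == z].
Proof. by apply/eqP/and3P => [[-> -> ->] | [/eqP-> /eqP-> /eqP->]]. Qed.

Lemma cnt_mul x y z a b c : cnt (TMul x y z) (TMul a b c) =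
  (cnt x a * (cnt y b * cnt z c) + cnt x a * (cnt z b * cnt y c) +
   cnt y a * (cnt x b * cnt z c) + cnt z a * (cnt x b * cnt y c) +
   cnt y a * (cnt z b * cnt x c) + cnt z a * (cnt y b * cnt x c))%N.
Proof.
have E u v w : (cnt u a * (cnt v b * cnt w c) = \sum_(a' <- planar a) \sum_(b' <- planar b)
    \sum_(c' <- planar c) ((a' == u) && ((b' == v) && (c' == w))))%N.
  rewrite !cntE big_distrl; apply: eq_bigr => a' _ /=.
  rewrite big_distrl big_distrr; apply: eq_bigr => b' _ /=.
  by rewrite !big_distrr; apply: eq_bigr => c' _ /=; do 3!case: (_ == _).
rewrite !E cntE (big_planar (fun t => (t == TMul x y z) : nat)).
rewrite -!big_split; apply: eq_bigr => a' _ /=; rewrite -!big_split; apply: eq_bigr => b' _ /=.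
rewrite -!big_split; apply: eq_bigr => c' _ /=.
rewrite !big_cons big_nil !tmul_eq.
do 3!case: (a' == _); do 3!case: (b' == _); by do 3!case: (c' == _).
Qed.

Lemma cnt_var x i : cnt x (TVar i) = (x == TVar i).
Proof. by rewrite /cnt /= addn0 eq_sym. Qed.

Lemma cnt_var_mul i a b c : cnt (TVar i) (TMul a b c) = 0%N.
Proof.
apply/count_memPn/negP => /planar_mulP[a' [b' [c' [_ _ _]]]].
by rewrite !inE => /or4P[/eqP|/eqP|/eqP|/or3P[]/eqP].
Qed.

(** The six-term formula [cnt_mul] is symmetric in the factors of either tree, which gives this
    lemma and [cnt_planarr] by induction. *)
Lemma cnt_planarl y x m : y \in planar x -> cnt y m = cnt x m.
Proof.
elim: x y m => [i|a IHa b IHb c IHc] y m; first by rewrite inE => /eqP ->.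
move=> /planar_mulP[a' [b' [c' [pa pb pc yo]]]].
case: m => [j|m1 m2 m3].
  by have [[->|->|->]|[->|->|->]] := ordersP yo; rewrite !cnt_var.
have [[->|->|->]|[->|->|->]] := ordersP yo;
  rewrite !cnt_mul !(IHa _ _ pa) !(IHb _ _ pb) !(IHc _ _ pc); lia.
Qed.

Lemma cnt_planarr y x m : y \in planar m -> cnt x y = cnt x m.
Proof.
elim: m x y => [i|a IHa b IHb c IHc] x y; first by rewrite inE => /eqP ->.
move=> /planar_mulP[a' [b' [c' [pa pb pc yo]]]].
case: x => [j|x1 x2 x3].
  by have [[->|->|->]|[->|->|->]] := ordersP yo; rewrite !cnt_var_mul.
have [[->|->|->]|[->|->|->]] := ordersP yo;
  rewrite !cnt_mul !(IHa _ _ pa) !(IHb _ _ pb) !(IHc _ _ pc); lia.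
Qed.

(** * Canonical representatives of unordered trees *)

Fixpoint tcmp (s t : tmonomial) : comparison :=
  match s, t with
  | TVar i, TVar j => Nat.compare i j
  | TVar _, TMul _ _ _ => Lt
  | TMul _ _ _, TVar _ => Gt
  | TMul a b c, TMul a' b' c' =>
      match tcmp a a' with
      | Eq => match tcmp b b' with Eq => tcmp c c' | o => o end
      | o => o
      end
  end.

Definition sort3 (a b c : tmonomial) : tmonomial :=
  let insert a b c :=
    match tcmp b c with
    | Gt => match tcmp a c with Gt => TMul c a b | _ => TMul a c b end
    | _ => TMul a b c
    end in
  match tcmp a b with Gt => insert b a c | _ => insert a b c end.

Fixpoint canon (m : tmonomial) : tmonomial :=
  match m with
  | TVar i => TVar i
  | TMul a b c => sort3 (canon a) (canon b) (canon c)
  end.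

Lemma tcmp_eq s t : tcmp s t = Eq -> s = t.
Proof.
elim: s t => [i|a IHa b IHb c IHc] [j|a' b' c'] //=; first by move/PeanoNat.Nat.compare_eq ->.
case ca: (tcmp a a') => //; case cb: (tcmp b b') => // cc.
by rewrite (IHa _ ca) (IHb _ cb) (IHc _ cc).
Qed.

Lemma tcmp_sym s t : tcmp t s = CompOpp (tcmp s t).
Proof.
elim: s t => [i|a IHa b IHb c IHc] [j|a' b' c'] //=; first exact: PeanoNat.Nat.compare_antisym.
by rewrite IHa; case: (tcmp a a') => //=; rewrite IHb; case: (tcmp b b') => //=; rewrite IHc.
Qed.

Lemma tcmp_trans s t u : tcmp s t = Lt -> tcmp t u = Lt -> tcmp s u = Lt.
Proof.
elim: s t u => [i|a IHa b IHb c IHc] [j|a' b' c'] [k|a'' b'' c''] //=.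
  by rewrite !PeanoNat.Nat.compare_lt_iff; lia.
case ca: (tcmp a a') => //; last by case ca': (tcmp a' a'') => // _; rewrite ?(IHa _ _ ca ca') // -(tcmp_eq ca') ca.
rewrite (tcmp_eq ca); case: (tcmp a' a'') => //.
case cb: (tcmp b b') => //; last by case cb': (tcmp b' b'') => // _; rewrite ?(IHb _ _ cb cb') // -(tcmp_eq cb') cb.
rewrite (tcmp_eq cb); case: (tcmp b' b'') => //; exact: IHc.
Qed.

Lemma sort3C12 a b c : sort3 b a c = sort3 a b c.
Proof. by rewrite /sort3 (tcmp_sym a b); case ab: (tcmp a b) => //=; rewrite (tcmp_eq ab). Qed.

Lemma sort3C23 a b c : sort3 a c b = sort3 a b c.
Proof.
have trG s t u : tcmp s t = Gt -> tcmp t u = Gt -> tcmp s u = Gt.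
  move=> st tu; rewrite tcmp_sym (@tcmp_trans u t s) //; by rewrite tcmp_sym ?st ?tu.
rewrite /sort3 (tcmp_sym b c).
case ab: (tcmp a b); case ac: (tcmp a c); case bc: (tcmp b c) => //=.
all: try by rewrite (tcmp_eq bc).
all: try by move: ac; rewrite (tcmp_eq ab) bc.
all: try by move: bc; rewrite tcmp_sym -(tcmp_eq ac) ab.
all: try by move: ac; rewrite (tcmp_trans ab bc).
all: try by move: ac; rewrite (trG _ _ _ ab bc).
by move: ab; rewrite (tcmp_eq bc) ac.
by move: ab; rewrite (tcmp_eq bc) ac.
Qed.

Lemma sort3_orders a b c : sort3 a b c \in orders a b c.
Proof. by rewrite /sort3; case: (tcmp a b); case: (tcmp b c); case: (tcmp a c); rewrite !inE eqxx ?orbT. Qed.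

Lemma canon_planar m : canon m \in planar m.
Proof.
elim: m => [i|a IHa b IHb c IHc] /=; first by rewrite inE.
by apply/planar_mulP; exists (canon a), (canon b), (canon c); rewrite sort3_orders.
Qed.

Lemma planar_canon x m : x \in planar m -> canon x = canon m.
Proof.
elim: m x => [i|a IHa b IHb c IHc] x; first by rewrite inE => /eqP ->.
move=> /planar_mulP[a' [b' [c' [/IHa /= <- /IHb <- /IHc <- xo]]]].
have [[->|->|->]|[->|->|->]] //= := ordersP xo.
- exact: sort3C23.
- exact: sort3C12.
- by rewrite sort3C23 sort3C12.
- by rewrite sort3C12 sort3C23.
- by rewrite sort3C12 sort3C23 sort3C12.
Qed.

(* The number of automorphisms of [canon x] when [x] and [m] are equivalent. *)
Lemma cnt_canon x m :
  cnt x m = if canon x == canon m then cnt (canon m) (canon m) else 0%N.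
Proof.
rewrite -(cnt_planarl m (canon_planar x)) -(cnt_planarr (canon x) (canon_planar m)).
case: eqP => [-> // | ne]; apply/count_memPn/negP => /planar_canon.
by rewrite (planar_canon (canon_planar x)) (planar_canon (canon_planar m)).
Qed.

Lemma cnt_canon_gt0 m : (0 < cnt m m)%N.
Proof. by rewrite -has_count has_pred1 planar_refl. Qed.

(** * Alternating ternary structures *)

Definition zr (c : Z) : rat := (int_of_Z c)%:~R.

Fixpoint choose (k : nat) (l : seq nat) : seq (seq nat * seq nat) :=
  match k, l with
  | 0%N, _ => [:: ([::], l)]
  | _, [::] => [::]
  | k'.+1, x :: l' => [seq (x :: p.1, p.2) | p <- choose k' l'] ++
                      [seq (p.1, x :: p.2) | p <- choose k l']
  end.

Definition tvars (l : seq nat) : tmonomial :=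
  if l is [:: i; j; k] then TMul (TVar i) (TVar j) (TVar k) else TVar (head 0%N l).

(* The sum over S_6 in R with equal terms collected and signs dropped: 12 * 60 = 6!. *)
Definition relR : seq (Z * tmonomial) :=
  [seq (Zpos xH, TMul (TMul (TVar 0) (tvars q.1) (tvars q.2)) (tvars (take 1 p.1)) (tvars (drop 1 p.1)))
     | p <- choose 2 (iota 1 6), q <- choose 3 p.2] ++
  [seq (Zneg xH, TMul (TMul (TVar 0) (tvars (take 1 p.1)) (tvars (drop 1 p.1))) (tvars q.1) (tvars q.2))
     | p <- choose 2 (iota 1 6), q <- choose 3 p.2].

Section Twisted.
Variables (U : lmodType rat) (mu : U -> U -> U -> U).

(* The blocks of a monomial have odd size, so the twist by the sign makes an
   alternating product symmetric. *)
Definition tw (v : nat -> U) (m : tmonomial) : U := sgn (leaves m) *: meval mu v m.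

Definition feval (F : tmonomial -> U) (L : seq (Z * tmonomial)) : U :=
  \sum_(x <- L) zr x.1 *: F x.2.

(* The prefix ats stands for the alternating ternary sum. *)
Record ats_mod (N : U -> Prop) : Prop := AtsMod {
  ats_tri : is_trilinear mu;
  ats_0 : N 0;
  ats_add : forall x y, N x -> N y -> N (x + y);
  ats_scale : forall c x, N x -> N (c *: x);
  ats_ideal : forall x y z, N x -> N (mu x y z);
  ats_swap12 : forall x y z, N (mu x y z + mu y x z);
  ats_swap23 : forall x y z, N (mu x y z + mu x z y);
  ats_R : forall v, N (feval (tw v) relR)
}.

Section Trilinear.
Hypothesis mu_tri : is_trilinear mu.

Lemma trilD1 x x' y z : mu (x + x') y z = mu x y z + mu x' y z.
Proof. by have [H _ _] := mu_tri; have := H y z 1 x x'; rewrite !scale1r. Qed.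

Lemma trilD2 x y y' z : mu x (y + y') z = mu x y z + mu x y' z.
Proof. by have [_ H _] := mu_tri; have := H x z 1 y y'; rewrite !scale1r. Qed.

Lemma trilD3 x y z z' : mu x y (z + z') = mu x y z + mu x y z'.
Proof. by have [_ _ H] := mu_tri; have := H x y 1 z z'; rewrite !scale1r. Qed.

Lemma tril01 y z : mu 0 y z = 0.
Proof. by apply: (addrI (mu 0 y z)); rewrite -trilD1 !addr0. Qed.

Lemma tril02 x z : mu x 0 z = 0.
Proof. by apply: (addrI (mu x 0 z)); rewrite -trilD2 !addr0. Qed.

Lemma tril03 x y : mu x y 0 = 0.
Proof. by apply: (addrI (mu x y 0)); rewrite -trilD3 !addr0. Qed.

Lemma trilZ1 c x y z : mu (c *: x) y z = c *: mu x y z.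
Proof. by have [H _ _] := mu_tri; have := H y z c x 0; rewrite !addr0 tril01 addr0. Qed.

Lemma trilZ2 c x y z : mu x (c *: y) z = c *: mu x y z.
Proof. by have [_ H _] := mu_tri; have := H x z c y 0; rewrite !addr0 tril02 addr0. Qed.

Lemma trilZ3 c x y z : mu x y (c *: z) = c *: mu x y z.
Proof. by have [_ _ H] := mu_tri; have := H x y c z 0; rewrite !addr0 tril03 addr0. Qed.

End Trilinear.

Section Modulo.
Variable N : U -> Prop.
Hypothesis ats : ats_mod N.
Let tri := ats_tri ats.

Let eqN x y := N (x - y).

Lemma ats_opp x : N x -> N (- x).
Proof. by move=> Nx; rewrite -scaleN1r; apply: ats_scale ats _ _ Nx. Qed.

Lemma ats_sum (I : eqType) (r : seq I) (F : I -> U) :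
  (forall i, i \in r -> N (F i)) -> N (\sum_(i <- r) F i).
Proof.
move=> NF; rewrite big_seq; elim/big_rec: _ => [|i x ir Nx]; first exact: ats_0 ats.
by apply: ats_add ats _ _ (NF i ir) Nx.
Qed.

Lemma ats_refl x : eqN x x. Proof. by rewrite /eqN subrr; apply: ats_0 ats. Qed.

Lemma ats_sym x y : eqN x y -> eqN y x.
Proof. by rewrite /eqN -[y - x]opprB; apply: ats_opp. Qed.

Lemma ats_trans y x z : eqN x y -> eqN y z -> eqN x z.
Proof. by move=> xy yz; have := ats_add ats xy yz; rewrite /eqN addrA subrK. Qed.

Lemma ats_eqZ c x y : eqN x y -> eqN (c *: x) (c *: y).
Proof. by rewrite /eqN -scalerBr; apply: ats_scale ats _ _. Qed.

Lemma ats_eq0 x y : eqN x y -> N y -> N x.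
Proof. by move=> xy Ny; have := ats_add ats xy Ny; rewrite subrK. Qed.

Lemma ats_N12 x y z : eqN (mu y x z) (- mu x y z).
Proof. by rewrite /eqN opprK; apply: ats_swap12 ats _ _ _. Qed.

Lemma ats_N23 x y z : eqN (mu x z y) (- mu x y z).
Proof. by rewrite /eqN opprK; apply: ats_swap23 ats _ _ _. Qed.

Lemma ats_ideal2 x y z : N y -> N (mu x y z).
Proof. by move=> Ny; apply: ats_eq0 (ats_N12 _ _ _) (ats_opp (ats_ideal ats _ _ Ny)). Qed.

Lemma ats_ideal3 x y z : N z -> N (mu x y z).
Proof. by move=> Nz; apply: ats_eq0 (ats_N23 _ _ _) (ats_opp (ats_ideal2 _ _ Nz)). Qed.

Lemma ats_congr x y z x' y' z' :
  eqN x x' -> eqN y y' -> eqN z z' -> eqN (mu x y z) (mu x' y' z').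
Proof.
have B1 a b c d : mu (a - b) c d = mu a c d - mu b c d.
  by rewrite (trilD1 tri) -scaleN1r (trilZ1 tri) scaleN1r.
have B2 a b c d : mu c (a - b) d = mu c a d - mu c b d.
  by rewrite (trilD2 tri) -scaleN1r (trilZ2 tri) scaleN1r.
have B3 a b c d : mu c d (a - b) = mu c d a - mu c d b.
  by rewrite (trilD3 tri) -scaleN1r (trilZ3 tri) scaleN1r.
move=> xx yy zz; apply: (@ats_trans (mu x' y z)).
  by rewrite /eqN -B1; apply: ats_ideal ats _ _ _ xx.
apply: (@ats_trans (mu x' y' z)); first by rewrite /eqN -B2; apply: ats_ideal2.
by rewrite /eqN -B3; apply: ats_ideal3.
Qed.

(** Exchanging two factors changes the sign of the product modulo [N], and also the sign of the leaf
    word, because both blocks of leaves are odd. *)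
Lemma tw_orders v a b c x : x \in orders a b c -> eqN (tw v x) (tw v (TMul a b c)).
Proof.
have s12 s t u : eqN (tw v (TMul t s u)) (tw v (TMul s t u)).
  rewrite /tw /= (@sgn_swap_odd [::]) ?odd_leaves // scaleNr -scalerN.
  by apply: ats_eqZ; rewrite /eqN -opprD; apply/ats_opp; rewrite addrC; apply: ats_swap12 ats _ _ _.
have s23 s t u : eqN (tw v (TMul s u t)) (tw v (TMul s t u)).
  have := @sgn_swap_odd (leaves s) _ _ [::] (odd_leaves t) (odd_leaves u).
  rewrite !cats0 /tw /= => ->; rewrite scaleNr -scalerN.
  by apply: ats_eqZ; rewrite /eqN -opprD; apply/ats_opp; rewrite addrC; apply: ats_swap23 ats _ _ _.
move=> xo; have [[->|->|->]|[->|->|->]] := ordersP xo.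
- exact: ats_refl.
- exact: s23.
- exact: s12.
- exact: ats_trans (s23 _ _ _) (s12 _ _ _).
- exact: ats_trans (s12 _ _ _) (s23 _ _ _).
- exact: ats_trans (s12 _ _ _) (ats_trans (s23 _ _ _) (s12 _ _ _)).
Qed.

(** By [sgn_block] the sign relating two leaf words is the product of the signs for the three
    factors, so the induction hypotheses multiply. *)
Lemma tw_planar v x m : x \in planar m -> eqN (tw v x) (tw v m).
Proof.
elim: m x => [i|a IHa b IHb c IHc] x; first by rewrite inE => /eqP ->; apply: ats_refl.
move=> /planar_mulP[a' [b' [c' [pa pb pc xo]]]].
apply: ats_trans (tw_orders v xo) _; rewrite /tw /=.
have [[la lb] lc] := (leaves_planar pa, leaves_planar pb, leaves_planar pc).
(* A repeated leaf makes both twisted values zero by the convention in [sgn]. *)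
have [u|nu] := boolP (uniq (leaves a ++ leaves b ++ leaves c)); last first.
  rewrite !sgn_uniq0 // ?scale0r; first exact: ats_refl.
  by rewrite (perm_uniq (_ : perm_eq _ (leaves a ++ leaves b ++ leaves c))) ?perm_cat.
have := u; rewrite !cat_uniq => /and3P[ua _ /and3P[ub _ uc]].
have eqv y t : eqN (tw v y) (tw v t) -> uniq (leaves t) -> perm_eq (leaves y) (leaves t) ->
    eqN (meval mu v y) ((sgn (leaves y) * sgn (leaves t)) *: meval mu v t).
  move=> /(ats_eqZ (sgn (leaves y))) + ut lyt.
  by rewrite /tw !scalerA sgnM_self ?scale1r ?(perm_uniq lyt).
have := ats_congr (eqv _ _ (IHa _ pa) ua la) (eqv _ _ (IHb _ pb) ub lb) (eqv _ _ (IHc _ pc) uc lc).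
move/(ats_eqZ (sgn (leaves a' ++ leaves b' ++ leaves c'))).
rewrite (trilZ1 tri) (trilZ2 tri) (trilZ3 tri) !scalerA -!mulrA.
have := sgn_block u la lb lc; rewrite -!mulrA => <-.
by rewrite mulrA sgnM_self ?mul1r // (perm_uniq (_ : perm_eq _ (leaves a ++ leaves b ++ leaves c))) ?perm_cat.
Qed.

End Modulo.

(* Substituting trees, which have odd size, multiplies all signs by a common factor. *)
Lemma tw_subst (w : seq nat) v q : uniq w ->
  exists k : rat, forall t, perm_eq (leaves t) w ->
    tw v (subst q t) = k *: tw (fun i => meval mu v (q i)) t.
Proof.
move=> uw; exists (sgn (flatten [seq leaves (q i) | i <- w]) * sgn w) => t tw'.
have ut : uniq (leaves t) by rewrite (perm_uniq tw').
rewrite /tw meval_subst scalerA leaves_subst; congr (_ *: _).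
rewrite -(sgn_flatten (q := fun i => leaves (q i)) _ tw'); last by move=> i; apply: odd_leaves.
by rewrite -mulrA sgnM_self // mulr1.
Qed.

End Twisted.

(** * Twisted polynomials, their consequences and their symmetrization *)

Section Evaluation.
Variables (U : lmodType rat) (mu : U -> U -> U -> U).

Definition tsum (v : nat -> U) (z : tmonomial -> rat) : U :=
  \sum_(m <- mtrees) z m *: tw mu v m.

Lemma tsumD v y z : tsum v (fun m => y m + z m) = tsum v y + tsum v z.
Proof. by rewrite -big_split; apply: eq_bigr => m _; rewrite scalerDl. Qed.

Lemma tsumZ v c z : tsum v (fun m => c * z m) = c *: tsum v z.
Proof. by rewrite scaler_sumr; apply: eq_bigr => m _; rewrite scalerA. Qed.

Lemma eq_tsum v y z : {in mtrees, y =1 z} -> tsum v y = tsum v z.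
Proof. by move=> yz; rewrite /tsum big_seq [RHS]big_seq; apply: eq_bigr => m /yz ->. Qed.

Lemma tsum_sum v (I : Type) (r : seq I) (P : pred I) (z : I -> tmonomial -> rat) :
  tsum v (fun m => \sum_(i <- r | P i) z i m) = \sum_(i <- r | P i) tsum v (z i).
Proof.
by rewrite exchange_big; apply: eq_bigr => m _; rewrite scaler_suml.
Qed.

End Evaluation.

(* [conseq z] says that the twisted polynomial [\sum_m z m * m] follows from
   alternation and R. *)
Definition conseq (z : tmonomial -> rat) : Prop :=
  forall (U : lmodType rat) (mu : U -> U -> U -> U) (N : U -> Prop),
    ats_mod mu N -> forall v, N (tsum mu v z).

Lemma conseq_eq y z : {in mtrees, y =1 z} -> conseq y -> conseq z.
Proof. by move=> yz cy U mu N ats v; rewrite -(eq_tsum _ _ yz); apply: cy. Qed.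

Lemma conseqD y z : conseq y -> conseq z -> conseq (fun m => y m + z m).
Proof. by move=> cy cz U mu N ats v; rewrite tsumD; apply: (ats_add ats); [exact: cy | exact: cz]. Qed.

Lemma conseqZ c z : conseq z -> conseq (fun m => c * z m).
Proof. by move=> cz U mu N ats v; rewrite tsumZ; apply: (ats_scale ats); exact: cz. Qed.

Lemma conseqB y z : conseq y -> conseq z -> conseq (fun m => y m - z m).
Proof.
move=> cy cz; apply: conseq_eq (conseqD cy (conseqZ (-1) cz)) => m _ /=.
by rewrite mulN1r.
Qed.

Lemma conseq_sum (I : eqType) (r : seq I) (z : I -> tmonomial -> rat) :
  (forall i, i \in r -> conseq (z i)) -> conseq (fun m => \sum_(i <- r) z i m).
Proof.
move=> cz U mu N ats v; rewrite tsum_sum.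
by apply: (ats_sum ats) => i ir; apply: cz.
Qed.

Lemma tw_relabel (U : lmodType rat) (mu : U -> U -> U -> U) v g :
  exists k : rat, {in mtrees, forall t, tw mu v (relabel g t) = k *: tw mu (v \o g) t}.
Proof.
have [k kP] := tw_subst mu v (fun i => TVar (g i)) (iota_uniq 0 9).
by exists k => t; rewrite mem_mtrees; apply: kP.
Qed.

Lemma prelabelK (s : 'S_9) m : m \in mtrees -> prelabel s^-1%g (prelabel s m) = m.
Proof. by rewrite mem_mtrees => pm; rewrite prelabelM // mulgV prelabel1. Qed.

Lemma prelabelVK (s : 'S_9) m : m \in mtrees -> prelabel s (prelabel s^-1%g m) = m.
Proof. by rewrite mem_mtrees => pm; rewrite prelabelM // mulVg prelabel1. Qed.

Lemma prelabel_eq (s : 'S_9) x y : x \in mtrees -> y \in mtrees ->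
  (prelabel s x == prelabel s y) = (x == y).
Proof.
by move=> xM yM; apply/eqP/eqP => [xy | -> //]; rewrite -(prelabelK s xM) xy prelabelK.
Qed.

(** Relabelling the argument of [z] by [s] amounts to a substitution of the variables by the inverse
    permutation, up to a scalar common to all monomials. *)
Lemma conseq_prelabel (s : 'S_9) z : conseq z -> conseq (fun m => z (prelabel s m)).
Proof.
move=> cz U mu N ats v; have [k kP] := tw_relabel mu v (nth 0%N (word_of_perm s^-1%g)).
rewrite /tsum (_ : \sum_(m <- _) _ = k *: tsum mu (v \o nth 0%N (word_of_perm s^-1%g)) z).
  by apply: (ats_scale ats); apply: cz.
rewrite -(sum_mtrees_relabel s^-1%g) scaler_sumr big_seq [RHS]big_seq.
by apply: eq_bigr => m mM; rewrite prelabelVK // kP // !scalerA [k * _]mulrC.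
Qed.

Lemma planar_mtrees x m : m \in mtrees -> x \in planar m -> x \in mtrees.
Proof. by rewrite !mem_mtrees => pm /leaves_planar xm; apply: perm_trans xm pm. Qed.

Lemma sum_cnt (V : lmodType rat) (F : tmonomial -> V) m : m \in mtrees ->
  \sum_(x <- mtrees) (cnt x m)%:R *: F x = \sum_(x <- planar m) F x.
Proof.
move=> mM; under eq_bigr => x _ do rewrite cntE natr_sum scaler_suml.
rewrite exchange_big /= big_seq [RHS]big_seq; apply: eq_bigr => y ym.
rewrite (bigD1_seq y) ?uniq_mtrees ?(planar_mtrees mM ym) //= eqxx scale1r.
by rewrite big1 ?addr0 // => x /negbTE; rewrite eq_sym => ->; rewrite scale0r.
Qed.

(** The coefficient of [x] after each monomial [m] has been replaced by the sum of all its planar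
    embeddings. *)
Definition hat (z : tmonomial -> rat) (x : tmonomial) : rat :=
  \sum_(m <- mtrees) z m * (cnt x m)%:R.

(** A monomial of degree 9 has four products, hence 6^4 = 1296 embeddings, and all of them have the
    same twisted value modulo [N]. *)
Lemma tsum_hat (U : lmodType rat) (mu : U -> U -> U -> U) N z v : ats_mod mu N ->
  N (tsum mu v (hat z) - 1296%:R *: tsum mu v z).
Proof.
move=> ats; have -> : tsum mu v (hat z) = \sum_(m <- mtrees) z m *: \sum_(x <- planar m) tw mu v x.
  rewrite /tsum; under eq_bigr => x _ do rewrite scaler_suml.
  rewrite exchange_big /= big_seq [RHS]big_seq; apply: eq_bigr => m mM.
  rewrite -sum_cnt // scaler_sumr; apply: eq_bigr => x _.
  by rewrite -scalerA.
rewrite scaler_sumr -sumrB; apply: (ats_sum ats) => m mM.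
rewrite scalerA mulrC -scalerA -scalerBr; apply: (ats_scale ats).
have -> : 1296%:R *: tw mu v m = \sum_(x <- planar m) tw mu v m.
  rewrite big_const_seq count_predT size_planar iter_addr_0 scaler_nat; congr (_ *+ _).
  move: mM; rewrite mem_mtrees => /perm_size; rewrite size_leaves size_iota.
  by case=> /(congr1 half); rewrite doubleK => ->.
rewrite -sumrB; apply: (ats_sum ats) => x xm; exact: tw_planar.
Qed.

Lemma hatD y z x : hat (fun m => y m + z m) x = hat y x + hat z x.
Proof. by rewrite -big_split; apply: eq_bigr => m _; rewrite mulrDl. Qed.

Lemma hatZ c z x : hat (fun m => c * z m) x = c * hat z x.
Proof. by rewrite big_distrr; apply: eq_bigr => m _ /=; rewrite mulrA. Qed.

Lemma hat_planar z y x : y \in planar x -> hat z y = hat z x.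
Proof. by move=> yx; apply: eq_bigr => m _; rewrite (cnt_planarl _ yx). Qed.

Lemma cnt_prelabel (s : 'S_9) x m : x \in mtrees -> m \in mtrees ->
  cnt (prelabel s x) (prelabel s m) = cnt x m.
Proof.
move=> xM mM; rewrite /cnt planar_relabel count_map; apply: eq_in_count => y ym /=.
by rewrite prelabel_eq // (planar_mtrees mM).
Qed.

Lemma hat_prelabel (s : 'S_9) z x : x \in mtrees ->
  hat (fun m => z (prelabel s m)) x = hat z (prelabel s x).
Proof.
move=> xM; rewrite /hat -(sum_mtrees_relabel s (fun m => z m * _)) big_seq [RHS]big_seq.
by apply: eq_bigr => m mM; rewrite cnt_prelabel.
Qed.

(* The polynomials that vanish in the free associative algebra: the coefficient
   of the word w collects the 55 bracketings of w. *)
Definition vanishes (z : tmonomial -> rat) : Prop :=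
  forall s : 'S_9, \sum_(t <- shapes) hat z (prelabel s t) = 0.

Lemma shapes_mtrees t : t \in shapes -> t \in mtrees.
Proof. by move/shapes_leaves => lt; rewrite mem_mtrees lt. Qed.

Lemma vanishes_prelabel (s : 'S_9) z : vanishes z -> vanishes (fun m => z (prelabel s m)).
Proof.
move=> vz t; rewrite -[RHS](vz (t * s)%g) big_seq [RHS]big_seq; apply: eq_bigr => u uS.
have := shapes_mtrees uS; rewrite mem_mtrees => pu.
by rewrite hat_prelabel ?prelabelM // mem_mtrees leaves_prelabel.
Qed.

Lemma vanishesD y z : vanishes y -> vanishes z -> vanishes (fun m => y m + z m).
Proof.
by move=> vy vz s; under eq_bigr do rewrite hatD; rewrite big_split /= vy vz addr0.
Qed.

Lemma vanishesZ c z : vanishes z -> vanishes (fun m => c * z m).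
Proof.
by move=> vz s; under eq_bigr do rewrite hatZ; rewrite -big_distrr /= vz mulr0.
Qed.

(** * Colourings of weight (3, 2, 2, 2) *)

Definition phi (i : nat) : nat := nth 0%N [:: 0; 0; 0; 1; 1; 2; 2; 3; 3]%N i.

Notation colour m := (relabel phi m).

Definition stab (h : 'S_9) : bool := [forall i, phi (h i) == phi i].

Lemma stabP (h : 'S_9) : reflect (forall i, phi (h i) = phi i) (stab h).
Proof. exact: 'forall_eqP. Qed.

Lemma stabM g h : stab g -> stab (g * h)%g = stab h.
Proof.
move=> /stabP sg; apply/stabP/stabP => sh i.
  by rewrite -{1}(permKV g i) -permM sh -[in RHS](permKV g i) sg.
by rewrite permM sh sg.
Qed.

(* The colouring is preserved by exactly the products of transpositions inside
   the classes {0,1,2}, {3,4}, {5,6}, {7,8}. *)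
Lemma stab_ind (P : 'S_9 -> Prop) :
  P 1%g ->
  (forall h (i j : 'I_9), (val i, val j) \in [:: (0, 1); (1, 2); (3, 4); (5, 6); (7, 8)]%N ->
     P h -> P (h * tperm i j)%g) ->
  forall h, stab h -> P h.
Proof.
move=> P1 Pt h sh; pose gens := [:: (0, 1); (1, 2); (3, 4); (5, 6); (7, 8)]%N.
have Pt' g (i j : 'I_9) : phi i = phi j -> P g -> P (g * tperm i j)%g.
  have /allP/(_ (val i)) : all (fun x => all (fun y => (phi x == phi y) ==>
      [|| x == y, (x, y) \in gens, (y, x) \in gens, (x, y) == (0, 2)%N | (x, y) == (2, 0)%N])
      (iota 0 9)) (iota 0 9) by vm_compute.
  rewrite mem_iota ltn_ord => /(_ isT) /allP/(_ (val j)); rewrite mem_iota ltn_ord => /(_ isT) + pij Pg.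
  have P02 (k l : 'I_9) : val k = 0%N -> val l = 2%N -> P (g * tperm k l)%g.
    move=> k0 l2; pose o := Ordinal (isT : 1 < 9)%N.
    (* The transposition (0 2) is not among the generators; it is (1 2) conjugated by (0 1). *)
    have -> : tperm k l = (tperm k o * tperm o l * tperm k o)%g.
      rewrite -{1}[tperm k o]tpermV -mulgA -/(conjg _ _) tpermJ tpermR tpermD //.
        by rewrite -(inj_eq val_inj) k0 l2.
      by rewrite -(inj_eq val_inj) l2.
    have ko : (val k, val o) \in gens by rewrite k0.
    have ol : (val o, val l) \in gens by rewrite l2.
    by rewrite !mulgA; apply: (Pt _ _ _ ko); apply: (Pt _ _ _ ol); apply: (Pt _ _ _ ko).
  rewrite pij eqxx => /or4P[|ij|ji|/orP[]/eqP[k l]].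
  - by rewrite (inj_eq val_inj) => /eqP ->; rewrite tperm1 mulg1.
  - exact: Pt.
  - by rewrite tpermC; apply: Pt.
  - exact: P02.
  - by rewrite tpermC; apply: P02.
have [n] := ubnP #|[pred i | h i != i]|; elim: n h sh => // n IHn h sh hn.
have [/eqP h1 | ] := boolP ([forall i, h i == i]).
  by have -> : h = 1%g; [apply/permP => i; rewrite perm1; apply/eqP; move: h1 => /eqP/forallP|].
rewrite negb_forall => /existsP[i hi].
(* The factor [h * tperm i (h i)] fixes [i] and every fixed point of [h], so it moves fewer
   points. *)
have -> : h = (h * tperm i (h i) * tperm i (h i))%g by rewrite -mulgA tperm2 mulg1.
have phi_i := stabP _ sh i.
apply: Pt' => //; apply: IHn.
  apply/stabP => k; rewrite permM; case: tpermP => [hk | hk |]; rewrite -?(stabP _ sh k) ?hk //.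
rewrite -ltnS; apply: leq_trans hn; rewrite ltnS; apply/proper_card/properP; split.
  apply/subsetP => k; rewrite !inE permM; apply: contraNN => /eqP hk.
  by rewrite hk tpermD //; apply: contraNneq hi => ?; subst k; rewrite ?hk // -(inj_eq (@perm_inj _ h)) hk.
by exists i; rewrite !inE // permM tpermR eqxx.
Qed.

(** A symmetrization over planar embeddings and over the colour-preserving relabellings; its values
    depend only on the coloured unordered tree, by [havg_canon]. *)
Definition havg (z : tmonomial -> rat) (m : tmonomial) : rat :=
  \sum_(h : 'S_9 | stab h) hat z (prelabel h m).

Lemma tsum_havg (U : lmodType rat) (mu : U -> U -> U -> U) v z :
  tsum mu v (havg z) =
  \sum_(h : 'S_9 | stab h) tsum mu v (hat (fun m => z (prelabel h m))).
Proof.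
rewrite -tsum_sum; apply: eq_tsum => m mM; apply: eq_bigr => h _.
by rewrite hat_prelabel.
Qed.

Lemma conseq_havg z : conseq z -> conseq (havg z).
Proof.
move=> cz U mu N ats v; rewrite tsum_havg -big_filter.
apply: (ats_sum ats) => h _.
apply: (ats_eq0 ats (tsum_hat _ _ ats)); apply: (ats_scale ats).
exact: (conseq_prelabel h cz) ats v.
Qed.

(** Under the invariance hypothesis each summand of [havg z] is 1296 times [z] modulo consequences,
    so [havg z] is a nonzero multiple of [z] there. *)
Lemma havg_conseq z :
  (forall h : 'S_9, stab h -> conseq (fun m => z (prelabel h m) - z m)) ->
  conseq (havg z) -> conseq z.
Proof.
move=> zh cz U mu N ats v.
pose n : rat := \sum_(h : 'S_9 | stab h) 1296%:R.
have n0 : n != 0.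
  rewrite /n -natr_sum pnatr_eq0 -lt0n (bigD1 1%g) ?ltn_addr //=.
  by apply/stabP => i; rewrite perm1.
suff : N (n *: tsum mu v z).
  by move/(ats_scale ats n^-1); rewrite scalerA mulVf // scale1r.
apply: (ats_eq0 ats) (cz _ _ _ ats v).
apply: (ats_sym ats); rewrite tsum_havg scaler_suml -sumrB -big_filter.
apply: (ats_sum ats) => h; rewrite mem_filter => /andP[sh _].
apply: (ats_trans ats (tsum_hat _ _ ats)); apply: (ats_eqZ ats).
have := zh h sh _ _ _ ats v.
suff -> : tsum mu v (fun m => z (prelabel h m) - z m) =
          tsum mu v (fun m => z (prelabel h m)) - tsum mu v z by [].
rewrite -scaleN1r -tsumZ -tsumD; apply: eq_tsum => m _; by rewrite mulN1r.
Qed.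

Lemma havg_rows z (s : 'S_9) : vanishes z -> \sum_(t <- shapes) havg z (prelabel s t) = 0.
Proof.
move=> vz; rewrite exchange_big big1 // => h _; rewrite -[RHS](vz (s * h)%g).
rewrite big_seq [RHS]big_seq; apply: eq_bigr => t /shapes_mtrees.
by rewrite mem_mtrees => pt; rewrite prelabelM.
Qed.

Lemma havg_stab z h m : stab h -> m \in mtrees -> havg z (prelabel h m) = havg z m.
Proof.
move=> sh; rewrite mem_mtrees => pm.
rewrite /havg [RHS](reindex_inj (mulgI h)) /=; apply: eq_big => g; first by rewrite stabM.
by rewrite prelabelM.
Qed.

Lemma havg_planar z x m : x \in planar m -> havg z x = havg z m.
Proof.
move=> xm; apply: eq_bigr => h _; apply: hat_planar.
by rewrite planar_relabel map_f.
Qed.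

Lemma size_leaves_relabel g g' m m' : relabel g m = relabel g' m' ->
  size (leaves m) = size (leaves m').
Proof.
by move=> mm'; rewrite -(size_map g) -leaves_relabel mm' leaves_relabel size_map.
Qed.

(** The first equation forces the same bracketing on both trees, after which the leaf words
    decide. *)
Lemma relabel_transport g g' h m m' : relabel g m = relabel g' m' ->
  map h (leaves m) = leaves m' -> relabel h m = m'.
Proof.
elim: m m' => [i|a IHa b IHb c IHc] [j|a' b' c'] //=; first by move=> _ [hij]; rewrite /relabel /= hij.
case=> ea eb ec /eqP; rewrite !map_cat.
rewrite eqseq_cat ?size_map ?(size_leaves_relabel ea) // => /andP[/eqP la].
rewrite eqseq_cat ?size_map ?(size_leaves_relabel eb) // => /andP[/eqP lb /eqP lc].
by rewrite -(IHa _ ea la) -(IHb _ eb lb) -(IHc _ ec lc).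
Qed.

Lemma colour_eqP x y : x \in mtrees -> y \in mtrees -> colour x = colour y ->
  exists2 h, stab h & y = prelabel h x.
Proof.
rewrite !mem_mtrees => /word_of_permP[s xs] /word_of_permP[t yt] xy.
exists (s^-1 * t)%g; last first.
  apply/esym/(relabel_transport xy); rewrite xs yt -map_comp; apply: eq_map => i /=.
  by rewrite nth_word_of_perm permM permK.
apply/stabP => i; have := congr1 leaves xy.
rewrite !leaves_relabel xs yt => /(congr1 (fun w => nth 0%N w (s^-1%g i))).
rewrite !(nth_map 0%N) ?size_word_of_perm // !nth_word_of_perm permKV => ->.
by rewrite permM.
Qed.

Lemma havg_canon z x y : x \in mtrees -> y \in mtrees ->
  canon (colour x) = canon (colour y) -> havg z x = havg z y.
Proof.
move=> xM yM xy.
have := canon_planar (colour y); have := canon_planar (colour x).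
rewrite !planar_relabel => /mapP[x' x'x ex] /mapP[y' y'y ey].
have x'M := planar_mtrees xM x'x; have y'M := planar_mtrees yM y'y.
have [h sh yh] : exists2 h, stab h & y' = prelabel h x'.
  by apply: colour_eqP => //; rewrite -ex -ey.
by rewrite -(havg_planar z x'x) -(havg_planar z y'y) yh havg_stab.
Qed.

Definition poly_of (L : seq (Z * tmonomial)) (m : tmonomial) : rat :=
  \sum_(x <- L) zr x.1 * (m == x.2)%:R.

Lemma tsum_poly_of (U : lmodType rat) (mu : U -> U -> U -> U) v L :
  {in L, forall x, x.2 \in mtrees} -> tsum mu v (poly_of L) = feval (tw mu v) L.
Proof.
move=> LM; rewrite tsum_sum; rewrite /feval big_seq [RHS]big_seq; apply: eq_bigr => x /LM xM.
rewrite /tsum (bigD1_seq x.2) ?uniq_mtrees //= eqxx mulr1 big1 ?addr0 // => m /negbTE ->.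
by rewrite mulr0 scale0r.
Qed.

(** An embedding of [m] with the same colouring as [x] is [prelabel h x] for exactly one
    colour-preserving [h], because the labels of [x] are distinct. *)
Lemma cnt_colour x m : x \in mtrees -> m \in mtrees ->
  (\sum_(h : 'S_9 | stab h) cnt (prelabel h x) m)%N = cnt (colour x) (colour m).
Proof.
move=> xM mM; under eq_bigr do rewrite cntE.
rewrite exchange_big /= /cnt planar_relabel count_map -sum1_count [RHS]big_mkcond /=.
rewrite big_seq [RHS]big_seq; apply: eq_bigr => y ym.
have yM := planar_mtrees mM ym.
case: eqP => [yx | nyx].
  have [h sh yh] := colour_eqP xM yM (esym yx).
  rewrite (bigD1 h) //= yh eqxx big1 // => g /andP[sg gh]; apply/eqP; rewrite eqb0.
  apply: contraNneq gh => /(congr1 leaves).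
  move: xM; rewrite mem_mtrees !leaves_relabel => px gx; apply/eqP/permP => i; apply: val_inj.
  have ix : val i \in leaves x by rewrite (perm_mem px) mem_iota ltn_ord.
  have /(congr1 (fun w => nth 0%N w (index (val i) (leaves x)))) := gx.
  by rewrite !(nth_map 0%N) ?index_mem // !nth_index // !nth_word_of_perm => e; first [exact: e | exact: esym e].
rewrite big1 // => h sh; apply/eqP; rewrite eqb0; apply/eqP => yh; case: nyx.
rewrite yh relabel_comp; apply: eq_subst => i.
move: xM; rewrite mem_mtrees => px; rewrite (perm_mem px) mem_iota /= => i9; congr TVar.
by rewrite -[i]/(val (Ordinal i9)) /= (nth_word_of_perm h (Ordinal i9)) (stabP _ sh).
Qed.

Lemma havg_poly_of L m : {in L, forall x, x.2 \in mtrees} -> m \in mtrees ->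
  havg (poly_of L) m = (\sum_(x <- L | canon (colour x.2) == canon (colour m)) zr x.1) *
                       (cnt (canon (colour m)) (canon (colour m)))%:R.
Proof.
move=> LM mM.
have hatL y : hat (poly_of L) y = \sum_(x <- L) zr x.1 * (cnt y x.2)%:R.
  rewrite /hat; under eq_bigr => t _ do rewrite mulr_suml.
  rewrite exchange_big /= big_seq [RHS]big_seq; apply: eq_bigr => x /LM xM.
  rewrite (bigD1_seq x.2) ?uniq_mtrees //= eqxx mulr1 big1 ?addr0 // => t /negbTE ->.
  by rewrite mulr0 mul0r.
rewrite /havg; under eq_bigr => h _ do rewrite hatL.
rewrite exchange_big /= mulr_suml [RHS]big_mkcond big_seq [RHS]big_seq; apply: eq_bigr => x /LM xM.
rewrite -mulr_sumr -natr_sum cnt_colour // cnt_canon eq_sym.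
by case: eqP => [<- // | _]; rewrite mulr0.
Qed.

(** * Semisimplicity *)

(** With the generalized inverse M^- of the coefficient matrix M, the matrix 1 - M M^- has all its
    rows in the left kernel of M and fixes that kernel. *)
Lemma kernel_projection (T : eqType) (s : seq T) (J : finType) (e : T -> J -> rat) : uniq s ->
  exists p : T -> T -> rat,
    {in s, forall i, forall j, \sum_(x <- s) p i x * e x j = 0} /\
    (forall z : T -> rat, (forall j, \sum_(i <- s) z i * e i j = 0) ->
       {in s, forall x, z x = \sum_(i <- s) z i * p i x}).
Proof.
move=> us; pose tn := tnth (in_tuple s).
pose M : 'M[rat]_(size s, #|J|) := \matrix_(i, j) e (tn i) (enum_val j).
pose P := 1%:M - M *m pinvmx M.
have PM : P *m M = 0 by rewrite mulmxBl mul1mx mulmxKpV ?subrr.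
have idx i : insub (index (tn i) s) = Some i :> option 'I_(size s).
  rewrite (_ : index _ _ = i) ?valK // /tn.
  have x0 : T by case: (s) i => [[]|] //.
  by rewrite (tnth_nth x0) index_uniq.
have surj x : x \in s -> exists i, x = tn i.
  by move=> /(tnthP (in_tuple s)).
pose p i x := match insub (index i s), insub (index x s) with
  | Some i, Some j => P i j | _, _ => 0 end.
have pE i j : p (tn i) (tn j) = P i j by rewrite /p !idx.
exists p; split => [_ /surj[i ->] j | z ze _ /surj[k ->]].
  have PMij : (P *m M) i (enum_rank j) = 0 by rewrite PM mxE.
  rewrite -[RHS]PMij big_tnth -/tn [RHS]mxE.
  by apply: eq_bigr => k _; rewrite pE [M _ _]mxE enum_rankK.
pose Z : 'rV[rat]_(size s) := \row_i z (tn i).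
have ZM : Z *m M = 0.
  apply/rowP => j; rewrite [LHS]mxE [RHS]mxE -[RHS](ze (enum_val j)) [RHS]big_tnth.
  by apply: eq_bigr => i _; rewrite !mxE.
have : Z *m P = Z by rewrite mulmxBr mulmx1 mulmxA ZM mul0mx subr0.
move/rowP/(_ k); rewrite [Z 0 k]mxE => <-; rewrite [LHS]mxE [RHS]big_tnth; apply: eq_bigr => i _.
by rewrite pE mxE.
Qed.

(* Maschke: averaging a projection onto the polynomials that vanish. *)
Lemma equivariant_projection : exists k : tmonomial -> tmonomial -> rat,
  [/\ {in mtrees, forall m, vanishes (k m)},
      (forall z, vanishes z -> {in mtrees, forall x, z x = \sum_(m <- mtrees) z m * k m x})
    & (forall (s : 'S_9) m x, m \in mtrees -> x \in mtrees ->
         k (prelabel s m) (prelabel s x) = k m x)].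
Proof.
(* The matrix from monomials to words; its left kernel consists of the polynomials that vanish. *)
pose e m (s : 'S_9) : rat := \sum_(t <- shapes) (cnt (prelabel s t) m)%:R.
have eP z : vanishes z <-> (forall s, \sum_(m <- mtrees) z m * e m s = 0).
  have E s : \sum_(t <- shapes) hat z (prelabel s t) = \sum_(m <- mtrees) z m * e m s.
    by rewrite exchange_big; apply: eq_bigr => m _; rewrite big_distrr.
  by split => vz s; [rewrite -E | rewrite E].
have [p [pe zp]] := kernel_projection e uniq_mtrees.
pose n : rat := (#|{: 'S_9}|)%:R.
have n0 : n != 0 by rewrite pnatr_eq0 -lt0n; apply/card_gt0P; exists 1%g.
exists (fun m x => n^-1 * \sum_(s : 'S_9) p (prelabel s m) (prelabel s x)); split.
- move=> m mM; apply: vanishesZ => t.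
  have -> : \sum_(u <- shapes) hat (fun x => \sum_(s : 'S_9) p (prelabel s m) (prelabel s x)) (prelabel t u)
     = \sum_(s : 'S_9) \sum_(u <- shapes) hat (fun x => p (prelabel s m) (prelabel s x)) (prelabel t u).
    rewrite [RHS]exchange_big; apply: eq_bigr => u _; rewrite [RHS]exchange_big; apply: eq_bigr => x _ /=.
    by rewrite mulr_suml.
  rewrite big1 // => s _.
  have /(vanishes_prelabel s) : vanishes (p (prelabel s m)) by apply/eP => j; apply: pe; apply: prelabel_mtrees.
  exact.
- move=> z vz x xM.
  transitivity (n^-1 * \sum_(s : 'S_9) z x).
    by rewrite sumr_const -[_ *+ _]mulr_natl mulrA mulVf // mul1r.
  under [RHS]eq_bigr => m _ do rewrite mulrCA mulr_sumr.
  rewrite -mulr_sumr; congr (_ * _); rewrite exchange_big; apply: eq_bigr => s _.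
  have /eP/zp/(_ _ (prelabel_mtrees s xM)) := vanishes_prelabel s^-1%g vz.
  rewrite prelabelK // => ->; rewrite -(sum_mtrees_relabel s) big_seq [RHS]big_seq.
  by apply: eq_bigr => m mM; rewrite prelabelK.
move=> s m x; rewrite !mem_mtrees => pm px; congr (_ * _).
rewrite [RHS](reindex_inj (mulgI s)) /=; apply: eq_bigr => t _.
by rewrite !prelabelM.
Qed.

(** * Sparse elimination modulo 31 *)

HB.instance Definition _ := hasDecEq.Build positive Pos.eqb_spec.

Definition srow := seq (positive * Z).

Section Elimination.
Local Open Scope Z_scope.

Definition modulus : Z := 31.

Fixpoint add_entry (i : positive) (c : Z) (r : srow) : srow :=
  match r with
  | [::] => [:: (i, c)]
  | (j, d) :: r' =>
    match Pos.compare i j with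
    | Lt => (i, c) :: r
    | Eq => let e := c + d in if Z.eqb e 0 then r' else (i, e) :: r'
    | Gt => (j, d) :: add_entry i c r'
    end
  end.

Fixpoint axpy (c : Z) (r : srow) {struct r} : srow -> srow :=
  fix axpy_r (s : srow) : srow :=
  match r, s with
  | _, [::] => r
  | [::], (j, d) :: s' => (j, (c * d) mod modulus) :: axpy_r s'
  | (i, a) :: r', (j, d) :: s' =>
     match Pos.compare i j with
     | Lt => (i, a) :: axpy c r' s
     | Gt => (j, (c * d) mod modulus) :: axpy_r s'
     | Eq => let e := (a + c * d) mod modulus in
             if Z.eqb e 0 then axpy c r' s' else (i, e) :: axpy c r' s'
     end
  end.

(** Only leading entries are eliminated, and [n] is fuel. Running out of it cannot harm soundness,
    since [elim_rows] inspects the row that results. *)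
Fixpoint reduce (n : nat) (M : PositiveMap.t srow) (r : srow) : srow :=
  match n, r with
  | n'.+1, (i, a) :: _ =>
    if PositiveMap.find i M is Some s then reduce n' M (axpy (- a) r s) else r
  | _, _ => r
  end.

(** The inverses modulo 31 in a table. It needs no proof, because [elim_rows] tests that the scaled
    leading entry is 1. *)
Definition inverse (a : Z) : Z :=
  nth 0 [:: 0; 1; 16; 21; 8; 25; 26; 9; 4; 7; 28; 17; 13; 12; 20; 29; 2; 11; 19; 18;
            14; 3; 24; 27; 22; 5; 6; 23; 10; 15; 30] (Z.to_nat (a mod modulus)).

(* Pivot rows are scaled to start with 1. *)
Fixpoint elim_rows (M : PositiveMap.t srow) (s : positive) (rows : seq srow) : bool :=
  match rows with
  | [::] => true
  | r :: rows' =>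
    if axpy (inverse (head (xH, 0) (reduce 1000 M r)).2) [::] (reduce 1000 M r)
      is (i, a) :: r' then
      [&& Pos.eqb i s, Z.eqb a 1, all (fun t => Pos.ltb s t.1) r'
        & elim_rows (PositiveMap.add s ((i, a) :: r') M) (Pos.succ s) rows']
    else false
  end.

End Elimination.

Definition row_val (R : pzRingType) (x : positive -> R) (r : srow) : R :=
  \sum_(t <- r) (int_of_Z t.2)%:~R * x t.1.

Lemma row_val_cons (R : pzRingType) (x : positive -> R) i c r :
  row_val x ((i, c) :: r) = (int_of_Z c)%:~R * x i + row_val x r.
Proof. exact: big_cons. Qed.

Lemma row_val_nil (R : pzRingType) (x : positive -> R) : row_val x [::] = 0.
Proof. exact: big_nil. Qed.

Lemma int_of_ZD a b : int_of_Z (Z.add a b) = int_of_Z a + int_of_Z b.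
Proof. exact: (rmorphD int_of_Z). Qed.

Lemma int_of_ZM a b : int_of_Z (Z.mul a b) = int_of_Z a * int_of_Z b.
Proof. exact: (rmorphM int_of_Z). Qed.

Lemma row_val_add_entry (R : pzRingType) (x : positive -> R) i c r :
  row_val x (add_entry i c r) = (int_of_Z c)%:~R * x i + row_val x r.
Proof.
elim: r => [|[j d] r IHr] /=; first by rewrite row_val_cons.
case: (Pos.compare_spec i j) => [<-|_|_].
- rewrite row_val_cons addrA -mulrDl -intrD -int_of_ZD.
  case: Z.eqb_spec => [-> | _]; last by rewrite row_val_cons.
  by rewrite mul0r add0r.
- by rewrite row_val_cons.
- by rewrite !row_val_cons IHr addrCA.
Qed.

Section ModP.
Variable x : positive -> 'F_31.
Let zf (c : Z) : 'F_31 := (int_of_Z c)%:~R.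

Lemma zf_mod a : zf (Z.modulo a modulus) = zf a.
Proof.
rewrite [in RHS](Z.div_mod a modulus) // /zf int_of_ZD int_of_ZM intrD intrM.
by rewrite [X in X * _](_ : _ = 0) ?mul0r ?add0r //; apply/eqP.
Qed.

Lemma row_val_axpy c r s : row_val x (axpy c r s) = row_val x r + zf c * row_val x s.
Proof.
have zfD a b : zf (Z.add a b) = zf a + zf b by rewrite /zf int_of_ZD intrD.
have zfM a b : zf (Z.mul a b) = zf a * zf b by rewrite /zf int_of_ZM intrM.
elim: r s => [|[i a] r IHr]; first elim=> [|[j d] s IHs] /=.
- by rewrite row_val_nil mulr0 addr0.
- by rewrite !row_val_cons IHs row_val_nil !add0r -/(zf _) -/(zf _) zf_mod zfM mulrDr mulrA.
elim=> [|[j d] s IHs]; first by rewrite /= row_val_nil mulr0 addr0.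
rewrite [axpy _ _ _]/=; case: (Pos.compare_spec i j) => [<-|_|_].
- rewrite !row_val_cons -!/(zf _) mulrDr addrACA -IHr mulrA -mulrDl -zfM -zfD -[zf (Z.add _ _)]zf_mod.
  case: Z.eqb_spec => [-> | _]; last by rewrite row_val_cons.
  by rewrite mul0r add0r.
- by rewrite row_val_cons IHr [row_val x ((i, a) :: r)]row_val_cons addrA.
rewrite row_val_cons -/(axpy _ _ _) [LHS]/=.
rewrite -[X in _ + row_val x X]/(axpy c ((i, a) :: r) s) IHs.
by rewrite [row_val x ((j, d) :: s)]row_val_cons -!/(zf _) zf_mod zfM mulrDr mulrA addrCA.
Qed.

Local Arguments axpy : simpl never.

Lemma row_val_reduce n M r :
  (forall i s, PositiveMap.find i M = Some s -> row_val x s = 0) ->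
  row_val x r = 0 -> row_val x (reduce n M r) = 0.
Proof.
move=> M0; elim: n r => [|n IHn] [|[i a] r] //= r0.
case E: (PositiveMap.find i M) => [s|] //; apply: IHn.
by rewrite row_val_axpy r0 (M0 _ _ E) mulr0 addr0.
Qed.

Local Arguments reduce : simpl never.
Local Arguments inverse : simpl never.

(** The rows are ordered so that each successive one has its pivot in the next column and its other
    entries further right. The triangular system is then solved from the last unknown backwards; the
    unknowns beyond the rows are zero by hypothesis. *)
Lemma elim_rowsP M s rows :
  (forall i s, PositiveMap.find i M = Some s -> row_val x s = 0) ->
  elim_rows M s rows ->
  (forall r, r \in rows -> row_val x r = 0) ->
  (forall i, (Pos.to_nat s + size rows <= Pos.to_nat i)%N -> x i = 0) ->
  forall i, (Pos.to_nat s <= Pos.to_nat i)%N -> x i = 0.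
Proof.
elim: rows M s => [|r rows IHr] M s M0; first by move=> _ _ H i si; apply: H; rewrite addn0.
rewrite [elim_rows _ _ _]/=.
set q := axpy _ _ _; move=> + rows0 xbig.
have q0 : row_val x q = 0.
  by rewrite row_val_axpy row_val_nil add0r row_val_reduce ?mulr0 // rows0 ?mem_head.
case: q q0 => // -[i a] q q0 /and4P[/Pos.eqb_eq ei /Z.eqb_eq ea /allP qs E].
subst i a; have x0 : forall i, (Pos.to_nat (Pos.succ s) <= Pos.to_nat i)%N -> x i = 0.
  apply: (IHr _ _ _ E) => [i t | t tr | i si].
  - case: (Pos.eq_dec i s) => [-> | ne]; first by rewrite PositiveMap.gss => -[<-].
    by rewrite PositiveMap.gso //; apply: M0.
  - by apply: rows0; rewrite inE tr orbT.
  by apply: xbig; move: si; rewrite /= Pos2Nat.inj_succ; lia.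
move=> i; rewrite leq_eqVlt => /predU1P[/Pos2Nat.inj <- | si]; last by apply: x0; rewrite Pos2Nat.inj_succ.
move: q0; rewrite row_val_cons [row_val _ _]big_seq big1 ?addr0; first by rewrite mul1r.
move=> [j c] /qs /Pos.ltb_lt sj; rewrite x0 ?mulr0 //= Pos2Nat.inj_succ; exact/ltP/Pos2Nat.inj_lt.
Qed.

End ModP.

(* A rational solution is an integral one up to scaling, and an integral solution
   is divisible by every power of 31. *)
Lemma elim_rows_rat rows (x : positive -> rat) :
  elim_rows (PositiveMap.empty _) xH rows ->
  (forall r, r \in rows -> row_val x r = 0) ->
  (forall i, (size rows < Pos.to_nat i)%N -> x i = 0) ->
  forall i, x i = 0.
Proof.
move=> E rows0 xbig; pose n := size rows.
have in_l i : (Pos.to_nat i <= n)%N -> i \in [seq Pos.of_succ_nat k | k <- iota 0 n].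
  move=> lin; apply/mapP; exists (Pos.to_nat i).-1; last by rewrite -[LHS]Pos2Nat.id; lia.
  by rewrite mem_iota; have := Pos2Nat.is_pos i; lia.
(* A common denominator exists because only finitely many [x i] can be nonzero. *)
have [D D0 DP] : exists2 D : int, D != 0 & forall i, D%:~R * x i = (numq (D%:~R * x i))%:~R.
  suff [D D0 DP] : exists2 D : int, D != 0 &
      {in [seq Pos.of_succ_nat k | k <- iota 0 n], forall i, D%:~R * x i \is a Num.int}.
    exists D => // i; apply/esym/numqK.
    have [/in_l/DP // | /xbig ->] := leqP (Pos.to_nat i) n.
    by rewrite mulr0.
  elim: [seq _ | _ <- _] => [|i l [D D0 DP]]; first by exists 1.
  exists (denq (x i) * D) => [|j]; first by rewrite mulf_neq0 ?denq_neq0.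
  rewrite inE => /predU1P[-> | jl]; last by rewrite intrM -mulrA rpredM ?intr_int ?DP.
  by rewrite intrM mulrAC [X in X * _]mulrC -numqE -intrM intr_int.
pose X i := numq (D%:~R * x i).
have X0 r : r \in rows -> row_val X r = 0.
  move=> rr; apply/eqP; rewrite -(intr_eq0 rat) raddf_sum /=.
  under eq_bigr => t _ do rewrite rmorphM /= intz -DP mulrCA.
  by rewrite -mulr_sumr -/(row_val x r) rows0 ?mulr0.
have Xbig i : (n < Pos.to_nat i)%N -> X i = 0 by move=> /xbig xi; rewrite /X xi mulr0.
suff dvX k (Y : positive -> int) : (forall r, r \in rows -> row_val Y r = 0) ->
    (forall i, (n < Pos.to_nat i)%N -> Y i = 0) -> forall i, (31%:Z ^+ k %| Y i)%Z.
  move=> i; apply/eqP; have /eqP := DP i; rewrite -/(X i).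
  suff -> : X i = 0 by rewrite mulf_eq0 intr_eq0 (negbTE D0).
  (* The exponent |X i| is large enough: 31^k exceeds k, so a nonzero [X i] cannot be divisible by
     this power. *)
  apply/eqP/contraT => Xi; have := dvX `|X i|%N X X0 Xbig i.
  rewrite dvdzE abszX => /dvdn_leq; rewrite absz_gt0 => /(_ Xi).
  by rewrite leqNgt ltn_expl.
elim: k Y => [|k IHk] Y Y0 Ybig i; first by rewrite dvd1z.
have dvY j : (31%:Z %| Y j)%Z.
  have : (Y j)%:~R = 0 :> 'F_31.
    apply: (elim_rowsP (x := fun j => (Y j)%:~R) _ E) => [l s | r rr | l nl | ].
    - by rewrite PositiveMap.gempty.
    - have := congr1 (intr : int -> 'F_31) (Y0 r rr); rewrite raddf_sum /= => Yr.
      by rewrite -[RHS]Yr; apply: eq_bigr => t _; rewrite rmorphM /= intz.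
    - by rewrite Ybig //; move: nl; rewrite /= add1n.
    - by have := Pos2Nat.is_pos j; lia.
  by move/eqP; rewrite -(dvdz_pcharf (pchar_Fp (isT : prime 31))).
pose Z0 j := (Y j %/ 31)%Z.
have YZ j : Y j = Z0 j * 31 by rewrite divzK.
rewrite YZ exprSr dvdz_mul2r //; apply: IHk => [r rr | j nj]; last by rewrite /Z0 Ybig ?div0z.
have := Y0 r rr; rewrite /row_val; under eq_bigr => t _ do rewrite YZ mulrA.
by rewrite -mulr_suml => /eqP; rewrite mulf_eq0 orbF => /eqP.
Qed.

(** * The linear system *)

(* Four bits per letter, first letter lowest. *)
Fixpoint word_of (p : positive) : seq nat :=
  match p with
  | (q~0~0~0~0)%positive => 0 :: word_of q
  | (q~0~0~0~1)%positive => 1 :: word_of q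
  | (q~0~0~1~0)%positive => 2 :: word_of q
  | (q~0~0~1~1)%positive => 3 :: word_of q
  | (q~0~1~0~0)%positive => 4 :: word_of q
  | (q~0~1~0~1)%positive => 5 :: word_of q
  | (q~0~1~1~0)%positive => 6 :: word_of q
  | (q~0~1~1~1)%positive => 7 :: word_of q
  | (q~1~0~0~0)%positive => 8 :: word_of q
  | _ => [::]
  end%N.

(* Postfix notation, three bits per symbol, first symbol lowest; 4 is the product. *)
Fixpoint tree_of (st : seq tmonomial) (p : positive) : tmonomial :=
  match p with
  | (q~0~0~0)%positive => tree_of (TVar 0 :: st) q
  | (q~0~0~1)%positive => tree_of (TVar 1 :: st) q
  | (q~0~1~0)%positive => tree_of (TVar 2 :: st) q
  | (q~0~1~1)%positive => tree_of (TVar 3 :: st) q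
  | (q~1~0~0)%positive => if st is c :: b :: a :: st' then tree_of (TMul a b c :: st') q else TVar 0
  | _ => head (TVar 0) st
  end.

(** A key for the map, whose lowest bit separates products from leaves. It is not injective on all
    labels, so [look] also compares the trees. *)
Fixpoint code (m : tmonomial) (k : positive) : positive :=
  match m with
  | TVar 0 => k~0~0~0
  | TVar 1 => k~0~1~0
  | TVar 2 => k~1~0~0
  | TVar _ => k~1~1~0
  | TMul a b c => (code a (code b (code c k)))~1
  end%positive.

(* Consequences of R in degree 9: {R, x, y}, and R with a product of three
   variables in its first or in its second argument. *)
Definition masters (k : nat) : seq (Z * tmonomial) :=
  let lift (q : nat -> tmonomial) := [seq (x.1, subst q x.2) | x <- relR] in
  match k with
  | 0 => [seq (x.1, TMul x.2 (TVar 7) (TVar 8)) | x <- relR]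
  | 1 => lift (fun i => if i is 0 then tvars [:: 0; 1; 2] else TVar i.+2)
  | _ => lift (fun i => match i with 0 => TVar 0 | 1 => tvars [:: 1; 2; 3] | _ => TVar i.+2 end)
  end%N.

(* Words whose bracketings give the equations, each with the colour class of
   trees that serves as pivot. *)
Definition word_data : list (positive * positive) := [::
(0x1826415307,0xc92221021b); (0x1826413507,0xc92121201b); (0x1824615307,0xc92240901b); (0x1824613075,0xc921011698);
(0x1826415073,0xc91a110059); (0x1824613570,0xc91a204642); (0x1824615370,0xc922408658); (0x1824651370,0xc922440658);
(0x1864253170,0xc91a284601); (0x1824617035,0xc923011458); (0x1826415370,0xc91a204681); (0x1826413570,0xc921210698);
(0x1826431570,0xc9112c4680); (0x1824617530,0xc92221a608); (0x1872641530,0xc91108c6c0); (0x1826417350,0xc922219610);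
(0x1862415307,0xc92101221b); (0x1842613507,0xc92200941b); (0x1862451307,0xc91110809b); (0x1847261350,0xc91b310050);
(0x1286415370,0xc91a204688); (0x1864253710,0xc92344801a); (0x1824617503,0xc923410258); (0x1824716035,0xc91008c643);
(0x1468253170,0xc91a08c601); (0x1842631570,0xc923411019); (0x1842761350,0xc923419210); (0x1426817503,0xc923612009);
(0x1842716305,0xc923019450); (0x1862417305,0xc921019690); (0x1826417305,0xc923208498); (0x1846235170,0xc91a244602);
(0x1846235710,0xc923450019); (0x1648235170,0xc91908c602); (0x1826451370,0xc919094640); (0x1824631570,0xc91a04c680);
(0x1862451370,0xc92321101a); (0x1862741530,0xc92321a408); (0x1842671530,0xc923410648); (0x1624817305,0xc923609012);
(0x1685241730,0xc91a5080c8); (0x1628417305,0xc923208612); (0x1872461350,0xc9110846c1); (0x1862714503,0xc92301a448);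
(0x1628415073,0xc922019650); (0x1842617305,0xc91911005a); (0x1826714053,0xc92101a611); (0x1482361750,0xc923410219);
(0x1826417053,0xc91a118051); (0x1862471350,0xc92221b210); (0x1682541730,0xc92221901a); (0x1284615370,0xc9224096c0);
(0x1824615730,0xc9224086c8); (0x1862541730,0xc919044483); (0x1842613570,0xc922009698); (0x1862415370,0xc921012658);
(0x1862417503,0xc92101a688); (0x1682415703,0xc91a1080d1); (0x1628417053,0xc923019411); (0x1286413570,0xc9212126c0);
(0x1846253170,0xc91204c603); (0x1846253710,0xc922419019); (0x1864235170,0xc909094603); (0x1864235710,0xc92121a01a);
(0x1826714530,0xc91a0c4448); (0x1642581370,0xc923419011); (0x1642831570,0xc92221b011); (0x1462851370,0xc91a084641);
(0x1628514703,0xc9110dc440); (0x1628417503,0xc923218488); (0x1826471350,0xc923440650); (0x1827461350,0xc9222086d0);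
(0x1824761350,0xc923409610); (0x1826415703,0xc9222106c8); (0x1826415730,0xc923409418); (0x1482631570,0xc91a044681);
(0x1862451730,0xc92340901a); (0x1824716305,0xc923218450); (0x1824617305,0xc919119090); (0x1682471530,0xc91a0cc440);
(0x1462831750,0xc9190c4442); (0x1824716350,0xc912204643); (0x1824617350,0xc923212218); (0x1824671350,0xc91a119050);
(0x1682451730,0xc923212608); (0x1826417530,0xc919084642); (0x1482631750,0xc923212019); (0x1826417503,0xc923411218);
(0x1842651370,0xc912119019); (0x1842671350,0xc923211610); (0x1842631750,0xc923208690); (0x1682451370,0xc919084681);
(0x1824613750,0xc923211418); (0x1824613705,0xc91a08c640); (0x1642851370,0xc919044682); (0x1826714503,0xc923418448);
(0x1628514730,0xc923240690); (0x1624831570,0xc923240498); (0x1642831750,0xc923408650); (0x1482671350,0xc923418250);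
(0x1624518370,0xc923640450); (0x1824713605,0xc9190c4481); (0x1824713650,0xc92221a218); (0x1824631750,0xc9222406d0);
(0x1624831750,0xc923258410); (0x1628471350,0xc923648410); (0x1862431570,0xc91a10901a); (0x1862471530,0xc92221b408);
(0x1628415703,0xc9110cc680); (0x1482671530,0xc91a0c4441); (0x1428316750,0xc923480648); (0x1426851370,0xc923480258);
(0x1826431750,0xc9212106d0); (0x1826413750,0xc91908c680); (0x1842361750,0xc91a084243); (0x1428617503,0xc923410609);
(0x1842731650,0xc9190cc480); (0x1652481370,0xc923219410); (0x1624185073,0xc9190d4202); (0x1826741350,0xc91a1090d0);
(0x1826714350,0xc91a11a048); (0x1462381570,0xc92321a011); (0x1624815703,0xc9190d4440); (0x1826451730,0xc9224406c8);
(0x1824651730,0xc91a119088); (0x1826715403,0xc91a0c4242); (0x1628471530,0xc923640488); (0x1426318570,0xc923680448);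
(0x1428671350,0xc923680250); (0x1628517403,0xc921218690); (0x1628514370,0xc92121a610); (0x1628431570,0xc921218498);
(0x1642381570,0xc9090d4680); (0x1624381570,0xc922219418); (0x1824316705,0xc92121a418); (0x1432861750,0xc91a0d4240);
(0x1862751430,0xc92341a208); (0x1624318570,0xc91b404242); (0x1628431750,0xc92121b410); (0x1628413705,0xc92121b012);
(0x1428671530,0xc923690208); (0x1628571430,0xc91b484240); (0x1423618570,0xc91b509010); (0x1426851730,0xc923498208);
(0x1862741350,0xc92121841a); (0x1682541370,0xc9090c4682); (0x1826714305,0xc92121061a); (0x1826541370,0xc9090c4483);
(0x1652841370,0xc9090dc480); (0x1824316750,0xc91a404243); (0x1826751430,0xc91a4c4240); (0x1423816750,0xc91a509018);
(0x1625418370,0xc91b204481); (0x1824731650,0xc919204483); (0x1426871530,0xc923612208); (0x1824361570,0xc9120c4243);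
(0x1824317650,0xc9121090d8); (0x1824371650,0xc922419218); (0x1826514307,0xc91210901b); (0x1842361570,0xc922418258);
(0x1842371650,0xc922408619); (0x1824615703,0xc922418219); (0x1482361570,0xc9120c4641); (0x1826514370,0xc9120c4648);
(0x1625814370,0xc919312018); (0x1426581370,0xc922418648); (0x1462581370,0xc923210688); (0x1842761530,0xc9120cc640);
(0x1824716530,0xc922419608); (0x1428651730,0xc92241b208); (0x1428316570,0xc9121190c8); (0x1482651730,0xc923419408);
(0x1423816570,0xc9120dc240); (0x1428615703,0xc92241b009); (0x1426518370,0xc91b312008); (0x1428371650,0xc9120446c8);
(0x1827416305,0xc923608450); (0x1624518730,0xc91b111050); (0x1624871530,0xc923608488); (0x1682741530,0xc923611210);
(0x1624871350,0xc923609410); (0x1426318750,0xc923610448); (0x1426315870,0xc923611408); (0x1426871350,0xc923610250);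
(0x1827641350,0xc9090946c0); (0x1872461530,0xc91204c6c0); (0x1624531870,0xc9112046c2); (0x1628741350,0xc9090846c2);
(0x1428761530,0xc9120446c1); (0x1432681750,0xc91b094240); (0x1652481730,0xc91b04c480); (0x1426351870,0xc9122046c1);
(0x1624318750,0xc91b084242); (0x1628714305,0xc91b109012); (0x1827614305,0xc91b109090); (0x1682751430,0xc91b044442);
(0x1872651430,0xc8d8890848); (0x1423615870,0xc91b112048); (0x1432871650,0xc91b112009); (0x1426581730,0xc91b044481);
(0x1625431870,0xc91b084441); (0x1628714350,0xc91b084448); (0x1827614530,0xc91131b010); (0x1428716350,0xc91b044488);
(0x1827416350,0xc91231b008); (0x1462871530,0xc923611011); (0x1642871350,0xc923608411); (0x1642581730,0xc91b111011);
(0x1824761530,0xc923440688); (0x1876245130,0xc90808c6d0); (0x1687245130,0xc90808c6c2); (0x1824163075,0xc919094203);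
(0x1867245130,0xc9110dc202); (0x1842617503,0xc92201a648); (0x1872614503,0xc91111005b); (0x1824615073,0xc92201a258);
(0x1824716053,0xc9100cc642); (0x1862413705,0xc9210116d0); (0x1862471305,0xc9080cc682); (0x1682471305,0xc921019612);
(0x1682417305,0xc92101b212); (0x1862741305,0xc91a10805a); (0x1862413075,0xc92120069a); (0x1826413075,0xc921019498);
(0x1648251370,0xc8d18c8880); (0x1468251370,0xc92201a219); (0x1628415370,0xc91a319010); (0x1628541370,0xc91a284640);
(0x1624813750,0xc923458210); (0x1624581730,0xc91a2c4440); (0x1428613570,0xc91a31a008); (0x1426817530,0xc923458408);
(0x1423681570,0xc91a244680); (0x1684251730,0xc91a3100c8); (0x1826714035,0xc92101a419); (0x1658241730,0xc92101b488);
(0x1824167035,0xc91a0cc202); (0x1842671305,0xc90808c683); (0x1867241530,0xc91b508088); (0x1876241530,0xc9210126c8);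
(0x1682571403,0xc91a0d4201); (0x1687241530,0xc92101b450); (0x1872416305,0xc9110d4203); (0x1824136075,0xc91a08c203);
(0x1862413507,0xc92121041b); (0x1862413057,0xc92120049b); (0x1872641305,0xc91b08c202); (0x1846251370,0xc919110099);
(0x1842615073,0xc922400659); (0x1864251730,0xc9220116c8); (0x1842615703,0xc922019611); (0x1486251370,0xc9191100d1);
(0x1874261350,0xc9220096d0); (0x1487261350,0xc92201b250); (0x1842613705,0xc92200961a); (0x1842731605,0xc9190cc402);
(0x1862741503,0xc91a0cc401); (0x1682471503,0xc9190d4401); (0x1862471503,0xc9110dc401); (0x1842671503,0xc9100d4641);
(0x1482671503,0xc92201a609); (0x1486251730,0xc922019688); (0x1846251730,0xc9100cc681); (0x1482615703,0xc922418609);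
(0x1482615073,0xc9224006c9); (0x1826154073,0xc9110cc403); (0x1826147053,0xc91a04c403); (0x1826145073,0xc922019419);
(0x1826147035,0xc92201921a); (0x1826157043,0xc9100d4243); (0x1847263150,0xc91b284401); (0x1487263150,0xc91008c6c1);
(0x1842631507,0xc9100dc441); (0x1842615307,0xc92240821b); (0x1872461503,0xc91b08c401); (0x1842615037,0xc92240025b);
(0x1482761503,0xc91b110089); (0x1482617503,0xc92201b409); (0x1826175043,0xc9100dc242); (0x1847236150,0xc91b244402);
(0x1487236150,0xc91b04c402); (0x1624815073,0xc92201b211); (0x1826174053,0xc91908c403); (0x1468251730,0xc92201b448);
(0x1826174035,0xc9091100da); (0x1842371605,0xc9090dc402); (0x1826143075,0xc91004c683); (0x1682517403,0xc9090d4403);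
(0x1862143075,0xc92100869a); (0x1642871503,0xc91b110051); (0x1827416053,0xc923610211); (0x1682741503,0xc91004c6c2);
(0x1462871503,0xc923610409); (0x1628715043,0xc92320841a); (0x1625187043,0xc91a1100c9); (0x1843267150,0xc9100d4648);
(0x1483261750,0xc9193100d0); (0x1483276150,0xc9192c4402); (0x1483261570,0xc919310098); (0x1843726150,0xc91200464b);
(0x1826150473,0xc919284403); (0x1628437150,0xc8c98d0880); (0x1625184370,0xc91a084648); (0x1624837150,0xc91b244480);
(0x1624873150,0xc8d9888880); (0x1625148370,0xc91b204442); (0x1847326150,0xc9120046c9); (0x1874261530,0xc91b310088);
(0x1847261503,0xc92221a019); (0x1864251370,0xc91a310019); (0x1842617350,0xc923210419); (0x1482613570,0xc91a044688);
(0x1821647035,0xc923440611); (0x1846237150,0xc91a244403); (0x1826471503,0xc91a2c4401); (0x1824763150,0xc91a310058);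
(0x1826154730,0xc923250418); (0x1826147530,0xc9100cc688); (0x1824736150,0xc923448610); (0x1486273150,0xc923448418);
(0x1826147350,0xc9192c4480); (0x1842736105,0xc923440419); (0x1842673105,0xc92340821a); (0x1862174503,0xc923450608);
(0x1426183750,0xc923650408); (0x1428376150,0xc91008c6c8); (0x1426138570,0xc91004c6d0); (0x1826145370,0xc9113100d8);
(0x1826174530,0xc9100dc448); (0x1862147305,0xc92324041a); (0x1826147305,0xc92325001a); (0x1682473105,0xc923258012);
(0x1426873150,0xc91b510048); (0x1824736105,0xc91931001a); (0x1826437150,0xc922258610); (0x1426187530,0xc91b444401);
(0x1687243150,0xc8da848880); (0x1423867150,0xc9090846d0); (0x1687251430,0xc923688210); (0x1426871503,0xc923690009);
(0x1428671503,0xc923418211); (0x1642518370,0xc923640411); (0x1643287150,0xc8898d8880); (0x1827463150,0xc9112846c0);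
(0x1463251870,0xc9112c4403); (0x1628471053,0xc923650011); (0x1862145370,0xc92224061a); (0x1862154370,0xc92344021a);
(0x1827614035,0xc91b108091); (0x1862154073,0xc92200865a); (0x1842163075,0xc922008699); (0x1847216305,0xc9110046ca);
(0x1862451037,0xc92200845b); (0x1876245103,0xc9100446d1); (0x1487621530,0xc91b404441); (0x1687245103,0xc9222006d1);
(0x1872461053,0xc92201121b); (0x1846235107,0xc91100468b); (0x1824610573,0xc923450218); (0x1824610735,0xc923218411);
(0x1842610573,0xc922010659); (0x1462158730,0xc923680211); (0x1846215370,0xc92221a640); (0x1286145730,0xc923411640);
(0x1286415730,0xc923409680); (0x1648215370,0xc91a318050); (0x1846215037,0xc92201025b); (0x1826431507,0xc92225001b);
(0x1862150473,0xc91008464b); (0x1847621503,0xc9100846c9); (0x1862145307,0xc92224041b); (0x1876214530,0xc91b404448);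
(0x1621587043,0xc923680409); (0x1685214730,0xc91a404648); (0x1284615730,0xc922419640); (0x1248615730,0xc92241b240);
(0x1486271350,0xc92301a250); (0x1824176035,0xc92101b411); (0x1621584370,0xc92325a010); (0x1621548370,0xc923651010);
(0x1621587430,0xc923689010); (0x1487362150,0xc91b28c400); (0x1628714053,0xc9080dc442); (0x1624187053,0xc92101a458);
(0x1862431507,0xc90911009b); (0x1864235107,0xc92101141b); (0x1862431057,0xc92100849b); (0x1682751403,0xc91b094201);
(0x1842761053,0xc922018651); (0x1842167035,0xc92340025a); (0x1621580473,0xc91a00464a); (0x1843276105,0xc922018459);
(0x1621580743,0xc922018689); (0x1684215703,0xc91a004689); (0x1843621570,0xc9100c444b); (0x1462853170,0xc923458011);
(0x1824761053,0xc91a318011); (0x1462158370,0xc91b310011); (0x1462358170,0xc92301a211); (0x1642358170,0xc9180d4242);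
(0x1624518073,0xc91808c688); (0x1462318570,0xc91b508011); (0x1462318750,0xc9080d4642); (0x1462138570,0xc923688011);
(0x1436215870,0xc9112046d0); (0x1624185703,0xc8da888840); (0x1642587130,0xc91b444202); (0x1426875130,0xc91b484201);
(0x1426875103,0xc91b510009); (0x1867254130,0xc92101941a); (0x1462857130,0xc9080d4681); (0x1824167053,0xc91a108099);
(0x1842761305,0xc921012619); (0x1624158073,0xc9080946c1); (0x1624158703,0xc908094643); (0x1824165073,0xc9121080d9);
(0x1824176053,0xc9080dc481); (0x1462587130,0xc9120dc201); (0x1876254130,0xc91210805b); (0x1862541307,0xc9080cc483);
(0x1824173065,0xc92101a650); (0x1687241350,0xc91b508050); (0x1842317605,0xc9120cc203); (0x1867241305,0xc9090046d2);
(0x1867243105,0xc9080446d2); (0x1682413705,0xc921218612); (0x1682413075,0xc9212006d2); (0x1624875130,0xc91b308090);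
(0x1624138750,0xc91b284202); (0x1624158730,0xc9080946c8); (0x1847265130,0xc8d9890840); (0x1642318705,0xc91b108052);
(0x1682741305,0xc923608212); (0x1642871305,0xc9191080d2); (0x1687243105,0xc9210086d2); (0x1642138705,0xc923640212);
(0x1628471305,0xc923648012); (0x1624873105,0xc91b308012); (0x1628473105,0xc923240612); (0x1846231570,0xc8d18d0840);
(0x1862457310,0xc91a284203); (0x1842176305,0xc91a3080d0); (0x1682475103,0xc91a2c4202); (0x1628547130,0xc91a30801a);
(0x1864257130,0xc9080d4688); (0x1864213570,0xc91a308098); (0x1824163570,0xc9123080d8); (0x1826457130,0xc922458608);
(0x1421683570,0xc92345a008); (0x1421683750,0xc923652008); (0x1421687530,0xc923691008); (0x1621485370,0xc923459010);
(0x1687542130,0xc91b48c200); (0x1842165073,0xc922200699); (0x1826410573,0xc921010699); (0x1826104573,0xc923400459);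
(0x1846215073,0xc9100c4689); (0x1486215073,0xc9220106c9); (0x1842651037,0xc92220045b); (0x1872651043,0xc923400689);
(0x1846213507,0xc92101045b); (0x1876215043,0xc9110046d1); (0x1876254103,0xc9080846d1); (0x1876421503,0xc91004468b);
(0x1486721350,0xc90808468b); (0x1846732150,0xc91a2cc400); (0x1486732150,0xc91b44c400); (0x1826510473,0xc92220065a);
(0x1862415073,0xc92101065a); (0x1826105473,0xc9100c464a); (0x1864752130,0xc91a2d4200); (0x1864215073,0xc92201825a);
(0x1847362150,0xc9192d4400); (0x1487265103,0xc9100446ca); (0x1847261305,0xc9080846ca); (0x1847261053,0xc923400651);
(0x1874261053,0xc9220086d1); (0x1826410753,0xc9210106d1); (0x1684752130,0xc91b294200); (0x1864210357,0xc92000949b);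
(0x1824176350,0xc9080dc488); (0x1827645130,0xc8918d8840); (0x1842163570,0xc922440619); (0x1827465103,0xc9122446c0);
(0x1465287130,0xc9122c4203); (0x1621435870,0xc92225b010); (0x1421653870,0xc92245b008); (0x1824657130,0xc91a508058);
(0x1824310675,0xc909004693); (0x1286475130,0xc92345a200); (0x1421685370,0xc923499008); (0x1654213870,0xc91b204488);
(0x1824167530,0xc9080cc690); (0x1685247130,0xc91a444203); (0x1421685730,0xc8d28c8840); (0x1867542130,0xc908044693);
(0x1865742130,0xc919044690); (0x1824136570,0xc9090c4690); (0x1824130675,0xc91a4cc200); (0x1865214370,0xc91a404641);
(0x1826754130,0xc91a4c4201); (0x1842130675,0xc923488019); (0x1826754103,0xc91a508019); (0x1824167503,0xc923480219);
(0x1483216750,0xc919204690); (0x1482675103,0xc923498009); (0x1428675103,0xc923480609); (0x1826451307,0xc92244801b);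
(0x1864210537,0xc92001145b); (0x1843621507,0xc91131001b); (0x1874362150,0xc9112dc400); (0x1842163507,0xc92244021b);
(0x1874216350,0xc9122046c8); (0x1876542130,0xc91230801b); (0x1867452310,0xc923691200); (0x1864251073,0xc92301025a);
(0x1864213075,0xc91900468a); (0x1864213705,0xc9080c468a); (0x1824106375,0xc92101845a); (0x1684521370,0xc92320045a);
(0x1824103675,0xc919004691); (0x1685421370,0xc9080c4691); (0x1846213075,0xc923200499); (0x1865274103,0xc921018499);
(0x1684213075,0xc921018652); (0x1842731065,0xc923200652); (0x1687241035,0xc921018691); (0x1862741035,0xc923200691);
(0x1864210375,0xc92001945a); (0x1865421370,0xc9080c448b); (0x1865421307,0xc9122dc200); (0x1684210375,0xc9200096d2);
(0x1864732105,0xc9192d4002); (0x1846231075,0xc923008499); (0x1842106375,0xc920011699); (0x1846210375,0xc920019499);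
(0x1846732105,0xc91a2cc002); (0x1846210537,0xc92001225b); (0x1867432105,0xc90004c6d2); (0x1284163750,0xc923211680);
(0x1846237510,0xc923212640); (0x1268457310,0xc923459400); (0x1846732510,0xc923448680); (0x1847632510,0xc923651400);
(0x1286413750,0xc92121a680); (0x1268413750,0xc92121b480); (0x1684573210,0xc91a2d4001); (0x1846752310,0xc923499200);
(0x1864732510,0xc92325a400); (0x1286471350,0xc92321a440); (0x1286417350,0xc92221b440); (0x1286471530,0xc91a319080);
(0x1286417530,0xc922219680); (0x1268417350,0xc923219480); (0x1264817350,0xc923609480); (0x1284673510,0xc923451600);
(0x1824673510,0xc923451018); (0x1268541730,0xc91a519040); (0x1284136750,0xc91a5090c0); (0x1284165730,0xc923488640);
(0x1685472310,0xc91a31a040); (0x1284675310,0xc923489600); (0x1824675310,0xc923489018); (0x1248651730,0xc923498240);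
(0x1286571430,0xc92341a240); (0x1286143750,0xc91931a080); (0x1268437510,0xc923250680); (0x1286154730,0xc9193120c0);
(0x1284316750,0xc91a519200); (0x1286574310,0xc923252600); (0x1826574310,0xc923252018); (0x1847362510,0xc91b312040);
(0x1847652310,0xc923652200); (0x1824376510,0xc923258480); (0x1284376510,0xc923458440); (0x1284671530,0xc923419440);
(0x1264817530,0xc923611440); (0x1246817530,0xc923612240); (0x1284731650,0xc923648480); (0x1265847310,0xc91b311080);
(0x1268471350,0xc923650440); (0x1287641530,0xc923688440); (0x1264187530,0xc91b511040); (0x1248671530,0xc923690240);
(0x1286741350,0xc91b509080); (0x1264857310,0xc923689400); (0x1286451370,0xc9224486c0); (0x1846735210,0xc91a28c003);
(0x1864753210,0xc92001165a); (0x1864735210,0xc919294003); (0x1867452103,0xc91b48c001); (0x1486735210,0xc91b44c002);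
(0x1684735210,0xc91b28c002); (0x1286451730,0xc922458640); (0x1865427310,0xc9190c4488); (0x1284176530,0xc9123190c0);
(0x1248176530,0xc91231b040); (0x1826457310,0xc922459600); (0x1286457130,0xc92245b200); (0x1286457310,0xc922459018);
(0x1846572310,0xc91900448b); (0x1876452310,0xc922458019); (0x1284765310,0xc91b312200); (0x1843627510,0xc922258680);
(0x1284631750,0xc922258418); (0x1286174530,0xc91131a0c0); (0x1286145370,0xc9222506c0); (0x1287164530,0xc91131b080);
(0x1872645310,0xc91a00444b); (0x1846372510,0xc92225b400); (0x1874632510,0xc92225801a); (0x1876245310,0xc91b511200);
(0x1824637510,0xc92225a600); (0x1284637510,0xc92225a018); (0x1864573210,0xc9122dc001); (0x1684753210,0xc91b294001);
(0x1862104375,0xc9000d464a); (0x1684375210,0xc91930009a); (0x1847632105,0xc90008c6ca); (0x1847635210,0xc8d9891800);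
(0x1487635210,0xc9122cc003); (0x1847653210,0xc91a44c003); (0x1846753210,0xc9000cc68a); (0x1846573210,0xc91a300099);
(0x1862104573,0xc92001a459); (0x1846210573,0xc920012659); (0x1486210573,0xc9200126c9); (0x1862105473,0xc90009464b);
(0x1864210573,0xc92001a25a); (0x1847365210,0xc9000946c9); (0x1487365210,0xc9000d4689); (0x1842106573,0xc9000cc691);
(0x1842103675,0xc90004c693); (0x1847652103,0xc91a4cc001); (0x1865742103,0xc91a500059); (0x1865473210,0xc8d28c9800);
(0x1486753210,0xc90008c6d1); (0x1846375210,0xc9112dc002); (0x1867453210,0xc8da889800); (0x1687543210,0xc9112d4003);
(0x1865421037,0xc91230005b); (0x1876452103,0xc9000cc48b); (0x1874653210,0xc9123000d9); (0x1874635210,0xc91130009b);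
(0x1874210365,0xc91b300052); (0x1654873210,0xc920019652); (0x1874321065,0xc9193000d2); (0x1876453210,0xc9113000da);
(0x1862104537,0xc9000d444b); (0x1436875210,0xc91b500089); (0x1876210543,0xc92001a689); (0x1487652103,0xc91a5000c9);
(0x1687421035,0xc91b500051); (0x1867421035,0xc91b300091); (0x1874621053,0xc9200116d1); (0x1687421053,0xc920019691);
(0x1876421035,0xc91a3000d1); (0x1847621035,0xc92001a651); (0x1846721035,0xc923010651); (0x1864721035,0xc923008691);
(0x1864217035,0xc923011611); (0x1864210753,0xc91804468a); (0x1867214035,0xc90911809a); (0x1821764053,0xc923011419);
(0x1862714053,0xc9111180d1); (0x1846217035,0xc911118099); (0x1624581073,0xc923011650); (0x1624583170,0xc9110cc602);
(0x1864231075,0xc9090d4602); (0x1624180573,0xc92300845a); (0x1821406375,0xc9110d4601); (0x1264853710,0xc91a28c600);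
(0x1821064753,0xc918084689); (0x1821604573,0xc923010459); (0x1642108573,0xc9180d4441); (0x1682715403,0xc923011688);
(0x1821647530,0xc91a318088); (0x1428167530,0xc91a518048); (0x1821467530,0xc91a44c600); (0x1423685170,0xc8d28488c0);
(0x1862714305,0xc923009690); (0x1684271530,0xc923019488); (0x1685472103,0xc918044691); (0x1685421073,0xc91a444601);
(0x1685271430,0xc91804c690); (0x1821406573,0xc912118059); (0x1846251073,0xc9120cc601); (0x1865241073,0xc91804c483);
(0x1682715043,0xc923010689); (0x1486721053,0xc92301a409); (0x1468572103,0xc91a518009); (0x1486521073,0xc9121180c9);
(0x1426583170,0xc9180cc481); (0x1486271530,0xc923012648); (0x1846217503,0xc923012219); (0x1862715403,0xc918094243);
(0x1862715043,0xc923012609); (0x1684271350,0xc92300941a); (0x1624385170,0xc919318090); (0x1281647350,0xc919294600);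
(0x1821064735,0xc91808464a); (0x1682105473,0xc919284602); (0x1628147350,0xc9180cc442); (0x1625483170,0xc8c98908c0);
(0x1843265170,0xc918094648); (0x1821746035,0xc919118091); (0x1628154073,0xc918094641); (0x1842631075,0xc91808c642);
(0x1824617053,0xc923012258); (0x1642815703,0xc91808c681); (0x1682541703,0xc91804c682); (0x1462817503,0xc91a118089);
(0x1648217053,0xc923018451); (0x1642817053,0xc923600451); (0x1642108753,0xc92001b451); (0x1682451703,0xc919094601);
(0x1628145073,0xc91a04c602); (0x1826417035,0xc923009498); (0x1468217053,0xc923018489); (0x1462817053,0xc923600489);
(0x1468721053,0xc92001b489); (0x1642831705,0xc923019212); (0x1642817305,0xc919118052); (0x1684271035,0xc923008652);
(0x1648217035,0xc923018252); (0x1642817035,0xc923600252); (0x1648210735,0xc92001b252); (0x1628147305,0xc919318012);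
(0x1642813705,0xc923009612); (0x1684321705,0xc9091180d2); (0x1842635710,0xc912318019); (0x1842107365,0xc91804448b);
(0x1842710365,0xc9180cc488); (0x1645281370,0xc912318058); (0x1864523710,0xc9122c4601); (0x1824653170,0xc8918c88c0);
(0x1842716350,0xc912244603); (0x1284653170,0xc9122cc600); (0x1821704653,0xc9180c4489); (0x1821764503,0xc9123180c8);
(0x1821074653,0xc9000dc489); (0x1645281703,0xc91b004489); (0x1824635170,0xc911284603); (0x1846325710,0xc91808444b);
(0x1826435170,0xc8898d08c0); (0x1862453107,0xc91131801a); (0x1846357210,0xc9112d4600); (0x1628435170,0xc9113180d0);
(0x1827146305,0xc9112c4602); (0x1864532170,0xc911318098); (0x1821704635,0xc9180c444a); (0x1821764530,0xc9180d4448);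
(0x1821076453,0xc9000dc44a); (0x1643587210,0xc91b00444a)]%positive.

(* Consequences of R, given by the number of the master and the substituted labels,
   each with the colour class of trees that serves as pivot. *)
Definition rel_data : list (nat * positive * positive) := [::
((2%N, 0x1654328107), 0xc8d18888c0); ((0%N, 0x1658742103), 0xc923219012); ((0%N, 0x1658432107), 0xc923218212);
((0%N, 0x1658743210), 0xc919119012); ((0%N, 0x1876432105), 0xc92221101b); ((0%N, 0x1876542103), 0xc92220841b);
((0%N, 0x1876543210), 0xc91111101b); ((0%N, 0x1438762105), 0xc92341a009); ((0%N, 0x1438652107), 0xc923418409);
((0%N, 0x1438765210), 0xc91a11a009); ((2%N, 0x1872106435), 0xc922240698); ((2%N, 0x1862105437), 0xc922250618);
((0%N, 0x1218765430), 0xc923450640); ((0%N, 0x1648752103), 0xc923408611); ((0%N, 0x1648732105), 0xc923210611);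
((0%N, 0x1648753210), 0xc922218611); ((0%N, 0x1648532107), 0xc91a119011); ((0%N, 0x1846532107), 0xc922218419);
((1%N, 0x1876210543), 0xc911204683); ((2%N, 0x1876215430), 0xc91131a018); ((2%N, 0x1876435210), 0xc922011619);
((2%N, 0x1876524103), 0xc92101a21a); ((2%N, 0x1876543210), 0xc92101161a); ((2%N, 0x1872106543), 0xc922458218);
((2%N, 0x1652108743), 0xc923650210); ((2%N, 0x1842107653), 0xc923488218); ((2%N, 0x1874326105), 0xc922019458);
((2%N, 0x1432108765), 0xc923688408); ((2%N, 0x1842106537), 0xc922448618); ((2%N, 0x1432108657), 0xc923488608);
((0%N, 0x1218654307), 0xc91a31a200); ((0%N, 0x1218764305), 0xc9222116c0); ((0%N, 0x1218765403), 0xc91a3110c0);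
((2%N, 0x1862107435), 0xc919204682); ((2%N, 0x1865437210), 0xc92301121a); ((1%N, 0x1876543210), 0xc90008c68b);
((1%N, 0x1876521430), 0xc909084683); ((1%N, 0x1874321650), 0xc912044643); ((1%N, 0x1654321870), 0xc91b08c440);
((2%N, 0x1876425103), 0xc922011658); ((2%N, 0x1652108437), 0xc923250610); ((1%N, 0x1876432510), 0xc9111100d9);
((2%N, 0x1864325107), 0xc9100cc443); ((1%N, 0x1865432710), 0xc91808c443); ((2%N, 0x1865427103), 0xc91108c603);
((2%N, 0x1864327105), 0xc91111805a); ((1%N, 0x1874210653), 0xc9122c4640); ((2%N, 0x1874216530), 0xc912319018);
((1%N, 0x1654210873), 0xc91b284440); ((2%N, 0x1654218730), 0xc9110846c8); ((2%N, 0x1642108735), 0xc91b311010);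
((1%N, 0x1643210875), 0xc91b444440); ((2%N, 0x1643218750), 0xc9110446d0); ((2%N, 0x1642108753), 0xc91b511008);
((2%N, 0x1876423105), 0xc91910809a); ((1%N, 0x1843210765), 0xc91a519008); ((2%N, 0x1843217650), 0xc91a444640);
((2%N, 0x1865423107), 0xc9111080da); ((1%N, 0x1876542310), 0xc9080d4443); ((1%N, 0x1865210743), 0xc919284680);
((2%N, 0x1865217430), 0xc91931a010); ((0%N, 0x1628754103), 0xc9191110d0); ((0%N, 0x1628543107), 0xc922218650);
((0%N, 0x1847652103), 0xc923408419); ((0%N, 0x1847653210), 0xc922210619); ((0%N, 0x1847632105), 0xc91a111019);
((2%N, 0x1876542103), 0xc8d18d1800); ((2%N, 0x1865432107), 0xc92000969a); ((2%N, 0x1876432105), 0xc91a30005a);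
((2%N, 0x1642108537), 0xc9110c4688); ((1%N, 0x1864210753), 0xc91a204443); ((2%N, 0x1874216503), 0xc8908c88c8);
((2%N, 0x1843216507), 0xc922409618); ((2%N, 0x1874326510), 0xc912119058); ((2%N, 0x1876214305), 0xc8d08d0848);
((2%N, 0x1865214307), 0xc921212618); ((2%N, 0x1876524310), 0xc91a109098); ((2%N, 0x1643218705), 0xc8d8888888);
((2%N, 0x1654328710), 0xc9110446c2); ((2%N, 0x1654218703), 0xc91b111088); ((0%N, 0x1428763105), 0xc923411608);
((0%N, 0x1428653107), 0xc922218688); ((0%N, 0x1865432107), 0xc92221821a); ((0%N, 0x1628743105), 0xc923210650);
((0%N, 0x1628754310), 0xc92321a210); ((0%N, 0x1867432105), 0xc92321021a); ((0%N, 0x1867543210), 0xc92220861a);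
((0%N, 0x1867542103), 0xc91911101a); ((2%N, 0x1862107543), 0xc923440458); ((2%N, 0x1842107635), 0xc919084688);
((2%N, 0x1864217530), 0xc91a311018); ((0%N, 0x1428765310), 0xc923408688); ((0%N, 0x1428765103), 0xc91a1110c8);
((1%N, 0x1865421730), 0xc919084443); ((1%N, 0x1864321750), 0xc91a044642); ((0%N, 0x1826543107), 0xc922218458);
((2%N, 0x1843217605), 0xc923408458); ((2%N, 0x1654218307), 0xc9110c4642); ((2%N, 0x1864217503), 0xc911044683);
((2%N, 0x1643218507), 0xc9110c4681); ((2%N, 0x1864327510), 0xc91a044443); ((2%N, 0x1865217403), 0xc923210458);
((2%N, 0x1864217305), 0xc9110d4640); ((2%N, 0x1865427310), 0xc911084643); ((1%N, 0x1876421530), 0xc9110c4443);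
((2%N, 0x1876215403), 0xc922210658); ((0%N, 0x1827643105), 0xc922211618); ((0%N, 0x1827654310), 0xc8d08c8888);
((0%N, 0x1827654103), 0xc922208698); ((2%N, 0x1874216305), 0xc919111098); ((2%N, 0x1864215307), 0xc9111110d8);
((2%N, 0x1876425310), 0xc91a111058)]%positive.

(** The columns of the two square systems: [true] for the classes determined by words, [false] for
    those cleared by consequences of R. *)
Definition pivots (b : bool) : seq tmonomial :=
  [seq canon (tree_of [::] p) | p <- if b then [seq d.2 | d <- word_data] else [seq d.2 | d <- rel_data]].

Definition table := PositiveMap.t (tmonomial * bool * positive).

Fixpoint fill (b : bool) (T : table) (s : positive) (l : seq tmonomial) : table :=
  if l is t :: l' then fill b (PositiveMap.add (code t xH) (t, b, s) T) (Pos.succ s) l' else T.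

Definition the_table : table :=
  fill false (fill true (PositiveMap.empty _) xH (pivots true)) xH (pivots false).

Definition look (T : table) (t : tmonomial) : option (bool * positive) :=
  if PositiveMap.find (code t xH) T is Some (t', b, s) then
    if tcmp t t' is Eq then Some (b, s) else None
  else None.

(** Columns of the other kind are dropped, but a class outside the table makes the result [None];
    success therefore certifies that every term of [L] has a column. *)
Fixpoint row_of (T : table) (b : bool) (L : seq (Z * tmonomial)) (r : srow) : option srow :=
  match L with
  | [::] => Some r
  | (c, t) :: L' =>
    if look T (canon t) is Some (b', s) then
      row_of T b L' (if eqb b b' then add_entry s c r else r)
    else None
  end.

Definition word_terms (p : positive) : seq (Z * tmonomial) :=
  let w := word_of p in [seq (Zpos xH, relabel (fun i => phi (nth 0%N w i)) t) | t <- shapes].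

Definition rel_terms (k : nat) (p : positive) : seq (Z * tmonomial) :=
  let w := word_of p in [seq (x.1, relabel (fun i => phi (nth 0%N w i)) x.2) | x <- masters k].

Fixpoint all_some (A : Type) (l : seq (option A)) : option (seq A) :=
  match l with
  | [::] => Some [::]
  | x :: l' => match x, all_some l' with Some a, Some r => Some (a :: r) | _, _ => None end
  end.

Definition rows_ok (rows : seq (option srow)) : bool :=
  if all_some rows is Some r then elim_rows (PositiveMap.empty _) xH r else false.

Definition words_ok : bool :=
  rows_ok [seq row_of the_table true (word_terms d.1) [::] | d <- word_data].

Definition rels_ok : bool :=
  rows_ok [seq row_of the_table false (rel_terms d.1.1 d.1.2) [::] | d <- rel_data].

(** Finding each pivot at its own position shows that no later entry has overwritten it, hence that
    the pivots are distinct and of one kind only. *)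
Fixpoint listed (b : bool) (T : table) (s : positive) (l : seq tmonomial) : bool :=
  if l is t :: l' then
    (if look T t is Some (b', s') then eqb b b' && Pos.eqb s s' else false) &&
    listed b T (Pos.succ s) l'
  else true.

Definition is_label_word (w : seq nat) : bool :=
  (size w == 9) && all (fun i => i \in w) (iota 0 9).

Definition labels_ok : bool :=
  all is_label_word [seq word_of d.1 | d <- word_data] &&
  all is_label_word [seq word_of d.1.2 | d <- rel_data].

(** Selections with repetition and without regard to order, as suits factors of unordered trees. *)
Fixpoint pairs (l : seq tmonomial) : seq (tmonomial * tmonomial) :=
  if l is x :: l' then [seq (x, y) | y <- l] ++ pairs l' else [::].

Fixpoint triples (l : seq tmonomial) : seq tmonomial :=
  if l is x :: l' then [seq sort3 x p.1 p.2 | p <- pairs l] ++ triples l' else [::].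

(** Every subtree of a tree with colour weight (3, 2, 2, 2) obeys these bounds, so heavier trees can
    be discarded at each stage of the enumeration. *)
Definition light (t : tmonomial) : bool :=
  let w := leaves t in
  [&& (count_mem 0 w <= 3)%N, (count_mem 1 w <= 2)%N, (count_mem 2 w <= 2)%N & (count_mem 3 w <= 2)%N].

Definition light2 (l l' : seq tmonomial) : seq tmonomial :=
  filter light [seq sort3 t p.1 p.2 | t <- l, p <- pairs l'].

Definition light_trees0 := [seq TVar i | i <- iota 0 4].
Definition light_trees1 := filter light (triples light_trees0).
Definition light_trees2 := light2 light_trees1 light_trees0.
Definition light_trees3 := light2 light_trees2 light_trees0 ++ light2 light_trees0 light_trees1.
(** Below the root, three products are distributed over the factors as 3 + 0 + 0, 2 + 1 + 0 or 1 + 1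
    + 1. *)
Definition light_trees4 :=
  light2 light_trees3 light_trees0 ++
  filter light [seq sort3 p.1 p.2 u | p <- [seq (s, t) | s <- light_trees2, t <- light_trees1],
                                      u <- light_trees0] ++
  filter light (triples light_trees1).

(* Representatives of the classes with [n] products. *)
Definition light_trees (n : nat) : seq tmonomial :=
  match n with
  | 0 => light_trees0 | 1 => light_trees1 | 2 => light_trees2 | 3 => light_trees3
  | _ => light_trees4
  end.

Definition covered : bool :=
  all (fun t => if look the_table t is Some _ then true else false) light_trees4.

Lemma words_okT : words_ok. Proof. by vm_compute. Qed.
Lemma rels_okT : rels_ok. Proof. by vm_compute. Qed.
Lemma labels_okT : labels_ok. Proof. by vm_compute. Qed.
Lemma listedT b : listed b the_table xH (pivots b). Proof. by case: b; vm_compute. Qed.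
Lemma coveredT : covered. Proof. by vm_compute. Qed.

(** * Correctness of the table and solution of the two systems *)

Definition table_sound (T : table) : Prop := forall k t b s,
  PositiveMap.find k T = Some (t, b, s) ->
  nth (TVar 0) (pivots b) (Pos.to_nat s).-1 = t /\ (Pos.to_nat s <= size (pivots b))%N.

Lemma fill_sound b T s l : table_sound T -> drop (Pos.to_nat s).-1 (pivots b) = l ->
  table_sound (fill b T s l).
Proof.
elim: l T s => [|t l IHl] T s sT dr //=; apply: IHl; last first.
  have := congr1 behead dr; rewrite -drop1 drop_drop /= => <-; congr (drop _ _).
  by have := Pos2Nat.is_pos s; rewrite Pos2Nat.inj_succ; lia.
move=> k u b' s'; case: (Pos.eq_dec k (code t xH)) => [-> | ne]; last first.
  by rewrite PositiveMap.gso //; apply: sT.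
rewrite PositiveMap.gss => -[<- <- <-].
have sz : ((Pos.to_nat s).-1 < size (pivots b))%N.
  by rewrite ltnNge; apply/negP => /drop_oversize; rewrite dr.
split; first by rewrite -[X in nth _ _ X]addn0 -nth_drop dr.
by have := Pos2Nat.is_pos s; lia.
Qed.

Lemma the_table_sound : table_sound the_table.
Proof.
apply: fill_sound; last exact: drop0.
apply: fill_sound; last exact: drop0.
by move=> k t b s; rewrite PositiveMap.gempty.
Qed.

Lemma lookP t b s : look the_table t = Some (b, s) ->
  nth (TVar 0) (pivots b) (Pos.to_nat s).-1 = t /\ (Pos.to_nat s <= size (pivots b))%N.
Proof.
rewrite /look; case E: (PositiveMap.find _ _) => [[[u b'] s']|] //.
case: (tcmp t u) (@tcmp_eq t u) => // /(_ erefl) -> [<- <-].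
exact: the_table_sound E.
Qed.

Lemma look_pivots t b s : look the_table t = Some (b, s) -> t \in pivots b.
Proof.
move=> /lookP[<- le]; by apply: mem_nth; rewrite prednK //; apply/ltP/Pos2Nat.is_pos.
Qed.

Lemma listedP b T s l i : listed b T s l -> (i < size l)%N ->
  exists2 s', look T (nth (TVar 0) l i) = Some (b, s') & Pos.to_nat s' = (Pos.to_nat s + i)%N.
Proof.
elim: l s i => [|t l IHl] s i //= /andP[+ lst].
case E: (look T t) => [[b' s']|] // /andP[/eqbP eb /Pos.eqb_eq es]; subst b' s'.
case: i => [|i] /=; first by exists s; rewrite ?E ?addn0.
rewrite ltnS => /(IHl _ _ lst)[u lu eu]; exists u => //.
by rewrite eu Pos2Nat.inj_succ addSnnS.
Qed.

Lemma look_nth b i : (i < size (pivots b))%N ->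
  exists2 s, look the_table (nth (TVar 0) (pivots b) i) = Some (b, s) & Pos.to_nat s = i.+1.
Proof. by move=> /(listedP (listedT b))[s ls es]; exists s; rewrite ?es. Qed.

Lemma uniq_pivots b : uniq (pivots b).
Proof.
apply/(uniqP (TVar 0)) => i j il jl eij.
have [s ls es] := look_nth il; have [u lu eu] := look_nth jl.
by move: ls; rewrite eij lu => -[eus]; move: eu; rewrite eus es => -[].
Qed.

Lemma pivots_look t b : t \in pivots b -> exists s, look the_table t = Some (b, s).
Proof. by move=> /(nthP (TVar 0))[i il <-]; have [s ls _] := look_nth il; exists s. Qed.

Section RowValues.
Variable y : tmonomial -> rat.

Let val b (s : positive) : rat :=
  if (Pos.to_nat s <= size (pivots b))%N then y (nth (TVar 0) (pivots b) (Pos.to_nat s).-1) else 0.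

Lemma row_of_val b L r r' : row_of the_table b L r = Some r' ->
  row_val (val b) r' = row_val (val b) r +
    \sum_(x <- L | canon x.2 \in pivots b) zr x.1 * y (canon x.2).
Proof.
elim: L r => [|[c t] L IHL] r /=; first by move=> [<-]; rewrite big_nil addr0.
case E: (look the_table (canon t)) => [[b' s]|] // /IHL ->; rewrite big_cons /=.
case: eqbP => [ebb | nbb].
  subst b'; rewrite (look_pivots E) row_val_add_entry -addrA addrCA; congr (_ + (_ + _)).
  by have [<- le] := lookP E; rewrite /val le.
case: ifP => // /pivots_look[u]; rewrite E => -[ebb]; by rewrite ebb in nbb.
Qed.

Lemma val_pivots b : (forall s, val b s = 0) -> {in pivots b, forall t, y t = 0}.
Proof.
move=> v0 t /(nthP (TVar 0))[i il <-].
by have := v0 (Pos.of_succ_nat i); rewrite /val SuccNat2Pos.id_succ il.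
Qed.

Lemma all_someP (A : Type) (l : seq (option A)) r : all_some l = Some r -> l = map Some r.
Proof.
elim: l r => [|[a|] l IHl] r //=; first by move=> [<-].
by case: (all_some l) IHl => // r' /(_ _ erefl) -> [<-].
Qed.

(** There are as many rows as pivots, so a completed elimination leaves no free unknown. *)
Lemma rows_okP (D : eqType) (data : seq D) (terms : D -> seq (Z * tmonomial)) b :
  size data = size (pivots b) ->
  rows_ok [seq row_of the_table b (terms d) [::] | d <- data] ->
  {in data, forall d, \sum_(x <- terms d | canon x.2 \in pivots b) zr x.1 * y (canon x.2) = 0} ->
  {in pivots b, forall t, y t = 0}.
Proof.
move=> sz; rewrite /rows_ok; case E: (all_some _) => [rows|] // el y0.
have {}E := all_someP E.
apply: val_pivots; apply: (elim_rows_rat el) => [r rr | i]; last first.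
  have := congr1 size E; rewrite !size_map sz => <-.
  by rewrite ltnNge /val => /negbTE ->.
have : Some r \in [seq row_of the_table b (terms d) [::] | d <- data].
  by rewrite E map_f.
by move=> /mapP[d dD /esym/row_of_val ->]; rewrite row_val_nil add0r y0.
Qed.

End RowValues.

(** Since the row exists, a class that is not a pivot of kind [b] is one of the other kind, where
    [y] is zero. *)
Lemma sum_some (b : bool) (y : tmonomial -> rat) L r r' :
  row_of the_table b L r = Some r' ->
  {in pivots (~~ b), forall t, y t = 0} ->
  \sum_(x <- L | canon x.2 \in pivots b) zr x.1 * y (canon x.2) = \sum_(x <- L) zr x.1 * y (canon x.2).
Proof.
elim: L r => [|[c t] L IHL] r /=; first by rewrite !big_nil.
case E: (look the_table (canon t)) => [[b' s]|] // /IHL H y0; rewrite !big_cons /= H //.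
case: ifP => // /negP nb.
have : canon t \in pivots (~~ b).
  have := look_pivots E; case: (eqVneq b' b) => [eb | ]; first by rewrite eb => /nb.
  by case: b' {E} b {H y0 IHL nb} => [] [].
by move=> /y0 ->; rewrite mulr0 add0r.
Qed.

Lemma rows_ok_some (D : eqType) (data : seq D) (F : D -> option srow) d :
  rows_ok [seq F d | d <- data] -> d \in data -> exists r, F d = Some r.
Proof.
rewrite /rows_ok; case E: (all_some _) => [rows|] // _ /(map_f F).
by rewrite (all_someP E) => /mapP[r _ ->]; exists r.
Qed.

#[local] Opaque the_table row_of elim_rows shapes word_data rel_data all_some.

Lemma words_determine (y : tmonomial -> rat) :
  {in pivots false, forall t, y t = 0} ->
  (forall w, is_label_word w ->
     \sum_(t <- shapes) y (canon (colour (relabel (nth 0%N w) t))) = 0) ->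
  {in pivots true, forall t, y t = 0}.
Proof.
move=> y0 yw; apply: (rows_okP (terms := fun d => word_terms d.1) _ words_okT).
  by rewrite !size_map.
move=> d dD.
have H := @rows_ok_some _ word_data (fun d => row_of the_table true (word_terms d.1) [::]) d.
have {H} H := H words_okT.
have [r dr] := H dD.
rewrite (sum_some dr) // /word_terms big_map -[RHS](yw (word_of d.1)).
  by apply: eq_bigr => t _; rewrite mul1r relabel_comp.
have /andP[/allP lw _] := labels_okT.
by apply: lw; apply: (map_f (fun d => word_of d.1)).
Qed.

(** Elimination gives the matrix [B] of the relations on the [false] classes a trivial kernel. Being
    square, [B] is invertible, and [a] is obtained from the values of [y] by its inverse. *)
Lemma rels_span (y : tmonomial -> rat) : exists a : 'I_(size rel_data) -> rat,
  {in pivots false, forall t, y t = \sum_(k < size rel_data) a k *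
     \sum_(x <- rel_terms (tnth (in_tuple rel_data) k).1.1 (tnth (in_tuple rel_data) k).1.2
        | canon x.2 == t) zr x.1}.
Proof.
pose n := size rel_data; pose T (i : 'I_n) := nth (TVar 0) (pivots false) i.
have sz : size (pivots false) = n by rewrite !size_map.
have Tinj : injective T.
  by move=> i j /eqP; rewrite nth_uniq ?uniq_pivots ?sz //; move/eqP/val_inj.
have Tsurj t : t \in pivots false -> exists i, t = T i.
  move=> /(nthP (TVar 0))[i]; rewrite sz => il <-; by exists (Ordinal il).
pose terms (d : nat * positive * positive) := rel_terms d.1.1 d.1.2.
pose B : 'M[rat]_n := \matrix_(k, i)
  \sum_(x <- terms (tnth (in_tuple rel_data) k) | canon x.2 == T i) zr x.1.
have B_inj (v : 'cV[rat]_n) : B *m v = 0 -> v = 0.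
  move=> Bv; pose x t := \sum_(i | T i == t) v i 0.
  have xT i : x (T i) = v i 0 by rewrite /x (eq_bigl (pred1 i)) ?big_pred1_eq // => j; rewrite (inj_eq Tinj).
  suff x0 : {in pivots false, forall t, x t = 0}.
    by apply/colP => i; rewrite mxE -xT; apply: x0; apply: mem_nth; rewrite sz.
  apply: (rows_okP (terms := fun d => rel_terms d.1.1 d.1.2) _ rels_okT) => [|d dD]; first by rewrite sz.
  have [k ->] := tnthP (in_tuple rel_data) _ dD.
  have Bvk : (B *m v) k 0 = 0 by rewrite Bv mxE.
  rewrite -[RHS]Bvk [RHS]mxE; under [RHS]eq_bigr => j _ do rewrite mxE big_mkcond mulr_suml.
  rewrite [RHS]exchange_big [LHS]big_mkcond; apply: eq_bigr => u _ /=.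
  case: ifP => uP.
    rewrite mulr_sumr big_mkcond; apply: eq_bigr => j _ /=.
    by rewrite eq_sym; case: ifP; rewrite ?mul0r.
  rewrite big1 // => j _; case: eqP => [uj | _]; last by rewrite mul0r.
  by move: uP; rewrite uj mem_nth // sz.
have uB : B \in unitmx.
  rewrite -unitmx_tr -row_free_unit; apply: inj_row_free => v vB.
  by apply: trmx_inj; rewrite trmx0; apply: B_inj; apply: trmx_inj; rewrite trmx_mul trmxK vB trmx0.
pose a := (\row_i y (T i)) *m invmx B.
exists (a 0) => _ /Tsurj[i ->].
have : a *m B = \row_i y (T i) by rewrite mulmxKV.
move/rowP/(_ i); rewrite [RHS]mxE => <-; rewrite [LHS]mxE; apply: eq_bigr => k _.
by congr (_ * _); rewrite [LHS]mxE.
Qed.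

Lemma is_label_wordP w : is_label_word w -> perm_eq w (iota 0 9).
Proof.
move=> /andP[/eqP sw /allP w9].
have sz : (size w <= size (iota 0 9))%N by rewrite sw.
have [_ ww] := uniq_min_size (iota_uniq 0 9) w9 sz.
by apply: uniq_perm; rewrite ?iota_uniq ?(leq_size_uniq (iota_uniq 0 9) w9 sz).
Qed.

Lemma pairs_mem l x y : x \in l -> y \in l -> ((x, y) \in pairs l) || ((y, x) \in pairs l).
Proof.
elim: l => // z l IHl xl yl.
have zl w : w \in z :: l -> (z, w) \in pairs (z :: l) by move=> wl; rewrite mem_cat map_f.
move: xl yl; rewrite inE => /predU1P[-> /zl -> // | xl].
rewrite inE => /predU1P[-> | yl]; first by rewrite zl ?orbT // inE xl orbT.
by case/orP: (IHl xl yl) => H; rewrite !mem_cat H ?orbT.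
Qed.

Lemma triples_mem l x y z : x \in l -> y \in l -> z \in l -> sort3 x y z \in triples l.
Proof.
elim: l x y z => // u l IHl.
have Hu y z : y \in u :: l -> z \in u :: l ->
    sort3 u y z \in triples (u :: l).
  move=> yl zl; rewrite mem_cat; have /orP[yz | zy] := pairs_mem yl zl.
    by rewrite (map_f (fun p => sort3 u p.1 p.2) yz).
  by rewrite -sort3C23 (map_f (fun p => sort3 u p.1 p.2) zy).
move=> x y z xl yl zl.
have [-> | xu] := eqVneq x u; first exact: Hu.
have [-> | yu] := eqVneq y u; first by rewrite sort3C12; apply: Hu.
have [-> | zu] := eqVneq z u; first by rewrite sort3C23 sort3C12; apply: Hu.
move: xl yl zl; rewrite !inE (negbTE xu) (negbTE yu) (negbTE zu) /= => xl yl zl.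
by rewrite mem_cat IHl ?orbT.
Qed.

Lemma light2_mem l l' t x y : t \in l -> x \in l' -> y \in l' -> light (sort3 t x y) ->
  sort3 t x y \in light2 l l'.
Proof.
move=> tl xl yl lt; rewrite mem_filter lt /=; have /orP[xy | yx] := pairs_mem xl yl.
  by apply/allpairsP; exists (t, (x, y)).
by rewrite -sort3C23; apply/allpairsP; exists (t, (y, x)).
Qed.

Lemma light_perm t u : perm_eq (leaves t) (leaves u) -> light t = light u.
Proof. by move=> tu; rewrite /light !(seq.permP tu). Qed.

Lemma light_mul a b c : light (TMul a b c) -> [/\ light a, light b & light c].
Proof.
rewrite /light /= !count_cat => /and4P[h0 h1 h2 h3].
by split; apply/and4P; split; lia.
Qed.

(** The symmetry of [sort3] reduces the claim to factors with decreasing numbers of products, which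
    is the order used by the enumeration. *)
Lemma light_trees_mul i j k x y z : light (sort3 x y z) -> (i + j + k <= 3)%N ->
  x \in light_trees i -> y \in light_trees j -> z \in light_trees k ->
  sort3 x y z \in light_trees (i + j + k).+1.
Proof.
(* The abstract [L] keeps simplification from computing the enumerations. *)
have : exists2 L : nat -> seq tmonomial, L = light_trees &
    [/\ L 0%N = light_trees0, L 1%N = light_trees1, L 2%N = light_trees2,
      L 3%N = light_trees3 & L 4%N = light_trees4] by exists light_trees.
rewrite /light_trees4 /light_trees3 /light_trees2 /light_trees1.
move=> [L <- [E0 E1 E2 E3 E4]].
rewrite -E0 in E1 E2 E3 E4; rewrite -E1 in E2 E3 E4; rewrite -E2 in E3 E4; rewrite -E3 in E4.
have sorted i' j' k' x' y' z' : (k' <= j' <= i')%N -> light (sort3 x' y' z') -> (i' + j' + k' <= 3)%N ->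
  x' \in L i' -> y' \in L j' -> z' \in L k' -> sort3 x' y' z' \in L (i' + j' + k').+1.
  { move=> + lt; case: i' => [|[|[|[|i']]]]; case: j' => [|[|j']]; case: k' => [|[|k']] //; try lia.
  all: move=> _ _ xl yl zl; rewrite ?addn0 /addn /=.
  - by rewrite E1 mem_filter lt; apply: triples_mem.
  - by rewrite E2; apply: light2_mem.
  - rewrite E3 mem_cat; apply/orP; right; rewrite -sort3C23 -sort3C12.
    by apply: light2_mem; rewrite // sort3C12 sort3C23.
  - by rewrite E4 !mem_cat [X in _ || (_ || X)]mem_filter lt triples_mem ?orbT.
  - by rewrite E3 mem_cat light2_mem.
  - rewrite E4 !mem_cat; apply/orP; right; apply/orP; left; rewrite mem_filter lt /=.
    by apply/allpairsP; exists ((x', y'), z'); split=> //; apply/allpairsP; exists (x', y').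
  - by rewrite E4 mem_cat light2_mem. }
have swap i' j' k' x' y' z' : (k' <= j')%N -> light (sort3 x' y' z') -> (i' + j' + k' <= 3)%N ->
  x' \in L i' -> y' \in L j' -> z' \in L k' -> sort3 x' y' z' \in L (i' + j' + k').+1.
  move=> kj lt3 n3 xl yl zl; have [ji | ij] := leqP j' i'.
    by apply: sorted lt3 n3 xl yl zl; rewrite kj.
  have ltyx : light (sort3 y' x' z') by rewrite sort3C12.
  rewrite -sort3C12 (addnC i') in n3 *; have [ki | ik] := leqP k' i'.
    by apply: sorted ltyx n3 yl xl zl; rewrite ki ltnW.
  have ltyz : light (sort3 y' z' x') by rewrite sort3C23.
  rewrite -sort3C23 addnAC in n3 *.
  by apply: sorted ltyz n3 yl zl xl; rewrite kj ltnW.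
move=> lt3 n3 xl yl zl; have [kj | jk] := leqP k j; first exact: swap kj lt3 n3 xl yl zl.
have ltxz : light (sort3 x z y) by rewrite sort3C23.
rewrite -sort3C23 addnAC in n3 *.
by apply: swap ltxz n3 xl zl yl; apply: ltnW.
Qed.

Lemma light_trees_complete t : light t -> all (fun i => (i < 4)%N) (leaves t) ->
  (nodes t <= 4)%N -> canon t \in light_trees (nodes t).
Proof.
have canon_light a b c : light (TMul a b c) -> light (sort3 (canon a) (canon b) (canon c)).
  by rewrite (light_perm (leaves_planar (canon_planar (TMul a b c)))).
elim: t => [i _ /= /andP[i4 _] _|a IHa b IHb c IHc lt]; first by rewrite map_f // mem_iota.
rewrite [leaves _]/= !all_cat => /and3P[la lb lc].
have [ta tb tc] := light_mul lt.
rewrite [canon _]/= [nodes _]/= => n4; have {}lt := canon_light _ _ _ lt.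
apply: light_trees_mul => //; [exact: IHa ta la (ltac:(lia)) | exact: IHb tb lb (ltac:(lia)) | exact: IHc tc lc (ltac:(lia))].
Qed.

Definition instance (k : nat) (p : positive) : seq (Z * tmonomial) :=
  [seq (x.1, relabel (nth 0%N (word_of p)) x.2) | x <- masters k].

Lemma rel_terms_colour k p : rel_terms k p = [seq (x.1, colour x.2) | x <- instance k p].
Proof. by rewrite /instance -map_comp; apply: eq_map => x /=; rewrite relabel_comp. Qed.

Lemma relR_leaves : all (fun x => perm_eq (leaves x.2) (iota 0 7)) relR.
Proof. by vm_compute. Qed.

(** The appended letters are increasing and exceed all others, so they add no inversion; this lets R
    factor out of {R, x, y} in [masters_ats]. *)
Lemma relR_sign : all (fun x => odd_inv (leaves x.2 ++ [:: 7; 8]%N) == odd_inv (leaves x.2)) relR.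
Proof. by vm_compute. Qed.

Lemma masters_leaves k : all (fun x => perm_eq (leaves x.2) (iota 0 9)) (masters k).
Proof. by case: k => [|[|k]]; vm_compute. Qed.

Lemma feval_subst (U : lmodType rat) (mu : U -> U -> U -> U) v q w L : uniq w ->
  all (fun x => perm_eq (leaves x.2) w) L ->
  exists k : rat, feval (tw mu v) [seq (x.1, subst q x.2) | x <- L] =
    k *: feval (tw mu (fun i => meval mu v (q i))) L.
Proof.
move=> uw /allP Lw; have [k kP] := tw_subst mu v q uw; exists k.
rewrite /feval big_map scaler_sumr big_seq [RHS]big_seq; apply: eq_bigr => x xL /=.
by rewrite kP ?Lw // [LHS]scalerA [RHS]scalerA mulrC.
Qed.

Lemma masters_ats (U : lmodType rat) (mu : U -> U -> U -> U) N k v : ats_mod mu N ->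
  N (feval (tw mu v) (masters k)).
Proof.
move=> ats; have N_lift q : N (feval (tw mu v) [seq (x.1, subst q x.2) | x <- relR]).
  have [c ->] := feval_subst mu v q (iota_uniq 0 7) relR_leaves.
  by apply: (ats_scale ats); apply: ats_R ats _.
case: k => [|[|k]]; [ | exact: N_lift | exact: N_lift].
have -> : feval (tw mu v) (masters 0) = mu (feval (tw mu v) relR) (v 7%N) (v 8%N).
  rewrite /feval /masters big_map.
  have tri := ats_tri ats.
  rewrite (big_morph (fun x => mu x (v 7%N) (v 8%N)) (fun x y => trilD1 tri x y _ _) (tril01 tri _ _)).
  rewrite big_seq [RHS]big_seq; apply: eq_bigr => x xR /=.
  rewrite (trilZ1 tri) (trilZ1 tri); congr (_ *: (_ *: _)).
  have px := allP relR_leaves _ xR; have /eqP sx := allP relR_sign _ xR.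
  have ux : uniq (leaves x.2) by rewrite (perm_uniq px) iota_uniq.
  rewrite /sgn [leaves _]/= sx ux (perm_uniq (_ : perm_eq _ (iota 0 9))) ?iota_uniq //.
  by rewrite -[iota 0 9]/(iota 0 7 ++ [:: 7; 8]%N) perm_cat2r.
by apply: (ats_ideal ats); apply: ats_R ats _.
Qed.

Lemma instance_mtrees k p : is_label_word (word_of p) ->
  {in instance k p, forall x, x.2 \in mtrees}.
Proof.
move=> /is_label_wordP /word_of_permP[s ws] _ /mapP[x xk ->] /=.
by rewrite ws; apply: prelabel_mtrees; rewrite mem_mtrees; apply: (allP (masters_leaves k)).
Qed.

Lemma instance_conseq k p : is_label_word (word_of p) -> conseq (poly_of (instance k p)).
Proof.
move=> wp U mu N ats v; rewrite tsum_poly_of; last exact: instance_mtrees.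
have [c ->] := feval_subst mu v (fun i => TVar (nth 0%N (word_of p) i)) (iota_uniq 0 9) (masters_leaves k).
by apply: (ats_scale ats); apply: masters_ats ats.
Qed.

(** The value at some monomial of the class [p], which is the value on the whole class if [Z] is
    [pattern_dependent]; the default 0 covers patterns without monomials. *)
Definition on_pattern (Z : tmonomial -> rat) (p : tmonomial) : rat :=
  head 0 [seq Z m | m <- mtrees & canon (colour m) == p].

Definition pattern_dependent (Z : tmonomial -> rat) : Prop :=
  {in mtrees &, forall x y, canon (colour x) = canon (colour y) -> Z x = Z y}.

Lemma on_patternE Z m : pattern_dependent Z -> m \in mtrees ->
  on_pattern Z (canon (colour m)) = Z m.
Proof.
move=> Zp mM; rewrite /on_pattern.
have := mem_filter (fun x => canon (colour x) == canon (colour m)) m mtrees.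
rewrite eqxx mM; case E: (filter _ _) => [|x l] // _ /=.
have : x \in [seq x <- mtrees | canon (colour x) == canon (colour m)] by rewrite E mem_head.
by rewrite mem_filter => /andP[/eqP xm xM]; apply: Zp.
Qed.

Lemma on_pattern0 Z p : (forall m, m \in mtrees -> canon (colour m) = p -> Z m = 0) ->
  on_pattern Z p = 0.
Proof.
move=> Z0; rewrite /on_pattern; case E: (filter _ _) => [|x l] //=.
have : x \in [seq x <- mtrees | canon (colour x) == p] by rewrite E mem_head.
by rewrite mem_filter => /andP[/eqP xp xM]; apply: Z0.
Qed.

Lemma colour_covered m : m \in mtrees -> exists b, canon (colour m) \in pivots b.
Proof.
move=> mM; have pl : perm_eq (leaves (colour m)) (map phi (iota 0 9)).
  by rewrite leaves_relabel perm_map // -mem_mtrees.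
have : canon (colour m) \in light_trees 4.
  have sz := perm_size pl; rewrite size_map size_iota size_leaves in sz.
  have n4 : nodes (colour m) = 4 by lia.
  rewrite -[4%N]n4; apply: light_trees_complete; rewrite ?n4 //.
    rewrite /light !(seq.permP pl); by vm_compute.
  by rewrite (perm_all _ pl); vm_compute.
move/(allP coveredT); case E: (look _ _) => [[b s]|] // _.
by exists b; apply: look_pivots E.
Qed.

(** Relations are subtracted from [havg z] so as to clear the [false] classes. The remainder [W]
    still satisfies all word equations, because relations vanish too, and so it is zero on the
    [true] classes as well. The first hypothesis is supplied later by [conseq_vanishes]. *)
Lemma conseq_of_stab z : (forall y, conseq y -> vanishes y) -> vanishes z ->
  (forall h : 'S_9, stab h -> conseq (fun m => z (prelabel h m) - z m)) -> conseq z.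
Proof.
move=> cv vz zh; apply: havg_conseq zh _.
pose dat k := tnth (in_tuple rel_data) k.
pose inst k := instance (dat k).1.1 (dat k).1.2.
have lab k : is_label_word (word_of (dat k).1.2).
  have /andP[_ /allP] := labels_okT; apply; apply: (map_f (fun d => word_of d.1.2)).
  exact: mem_tnth.
pose R k := havg (poly_of (inst k)).
have Rc k : conseq (R k) by apply: conseq_havg; apply: instance_conseq.
(* The division removes the automorphism count that [havg_poly_of] puts into the coefficients of the
   relations. *)
have [a aP] := rels_span (fun t => on_pattern (havg z) t / (cnt t t)%:R).
pose W m := havg z m - \sum_(k < size rel_data) a k * R k m.
suff W0 : {in mtrees, forall m, W m = 0}.
  apply: (conseq_eq (y := fun m => \sum_(k <- index_enum _) a k * R k m)) => [m mM|].
    by apply/esym/eqP; rewrite -subr_eq0 -/(W m) W0.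
  by apply: conseq_sum => k _; apply: conseqZ.
have Wp : pattern_dependent W.
  move=> x y xM yM xy; rewrite /W (havg_canon _ xM yM xy); congr (_ - _).
  by apply: eq_bigr => k _; rewrite /R (havg_canon _ xM yM xy).
have free0 : {in pivots false, forall t, on_pattern W t = 0}.
  move=> t tP; apply: on_pattern0 => m mM mt; apply/eqP; rewrite subr_eq0; apply/eqP.
  have c0 : (cnt t t)%:R != 0 :> rat by rewrite pnatr_eq0 -lt0n cnt_canon_gt0.
  have := aP t tP; rewrite -{1}mt on_patternE //; last by move=> x y; apply: havg_canon.
  move/(canRL (mulfVK c0)) => ->; rewrite mulr_suml; apply: eq_bigr => k _.
  rewrite -mulrA /R havg_poly_of //; last exact: instance_mtrees.
  congr (_ * (_ * _)); last by rewrite mt.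
  by rewrite rel_terms_colour big_map mt.
have all0 b : {in pivots b, forall t, on_pattern W t = 0}.
  case: b => //; apply: words_determine => // w /is_label_wordP/word_of_permP[s ->].
  have -> : \sum_(t <- shapes) on_pattern W (canon (colour (prelabel s t))) =
            \sum_(t <- shapes) W (prelabel s t).
    rewrite big_seq [RHS]big_seq; apply: eq_bigr => t tS; rewrite on_patternE //.
    by apply: prelabel_mtrees; apply: shapes_mtrees.
  rewrite sumrB havg_rows // exchange_big big1 ?subr0 // => k _.
  rewrite -mulr_sumr havg_rows ?mulr0 //; apply: cv; exact: instance_conseq.
move=> m mM; rewrite -(on_patternE Wp mM); have [b mb] := colour_covered mM.
exact: all0 mb.
Qed.

(** * Formal sums *)

Section FormalSums.
Variables (K : Type) (cmp : K -> K -> comparison).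
Hypothesis cmp_eq : forall x y, cmp x y = Eq -> x = y.

Fixpoint merge_sums (l : seq (Z * K)) : seq (Z * K) -> seq (Z * K) :=
  fix merge_r (l' : seq (Z * K)) : seq (Z * K) :=
  match l, l' with
  | [::], _ => l'
  | _, [::] => l
  | (c, x) :: r, (d, y) :: r' =>
    match cmp x y with
    | Lt => (c, x) :: merge_sums r l'
    | Gt => (d, y) :: merge_r r'
    | Eq => let e := Z.add c d in
            if Z.eqb e Z0 then merge_sums r r' else (e, x) :: merge_sums r r'
    end
  end.

Fixpoint push_sum (l : seq (Z * K)) (st : seq (seq (Z * K))) : seq (seq (Z * K)) :=
  match st with
  | [::] => [:: l]
  | [::] :: st' => l :: st'
  | l' :: st' => [::] :: push_sum (merge_sums l' l) st'
  end.

(* Merge sort by means of a binary counter of sorted sums. *)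
Definition collect (l : seq (Z * K)) : seq (Z * K) :=
  foldl merge_sums [::] (foldl (fun st x => push_sum [:: x] st) [::] l).

Variables (U : lmodType rat) (F : K -> U).

Definition fsum (l : seq (Z * K)) : U := \sum_(x <- l) zr x.1 *: F x.2.

Lemma fsum_cons c x l : fsum ((c, x) :: l) = zr c *: F x + fsum l.
Proof. exact: big_cons. Qed.

Lemma fsum_nil : fsum [::] = 0.
Proof. exact: big_nil. Qed.

Lemma fsum_cat l l' : fsum (l ++ l') = fsum l + fsum l'.
Proof. exact: big_cat. Qed.

Lemma fsum_flatten (ls : seq (seq (Z * K))) : fsum (flatten ls) = \sum_(l <- ls) fsum l.
Proof. exact: big_flatten. Qed.

Lemma zrD c d : zr (Z.add c d) = zr c + zr d.
Proof. by rewrite /zr (rmorphD int_of_Z) intrD. Qed.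

Lemma zrM c d : zr (Z.mul c d) = zr c * zr d.
Proof. by rewrite /zr (rmorphM int_of_Z) intrM. Qed.

Lemma zrN c : zr (Z.opp c) = - zr c.
Proof. by rewrite /zr (rmorphN int_of_Z) intrN. Qed.

Lemma fsum_merge l l' : fsum (merge_sums l l') = fsum l + fsum l'.
Proof.
elim: l l' => [|[c x] l IHl] l'; first by case: l' => *; rewrite fsum_nil add0r.
elim: l' => [|[d y] l' IHl']; first by rewrite fsum_nil addr0.
rewrite [merge_sums _ _]/=; case E: (cmp x y).
- rewrite (cmp_eq E) !fsum_cons addrACA -IHl -scalerDl -zrD.
  case: Z.eqb_spec => [-> | _]; last by rewrite fsum_cons.
  by rewrite scale0r add0r.
- by rewrite !fsum_cons IHl fsum_cons addrA.
rewrite fsum_cons; have /= -> := IHl'.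
by rewrite [in RHS](fsum_cons d) addrCA.
Qed.

Local Arguments merge_sums : simpl never.

Lemma fsum_push l st :
  \sum_(k <- push_sum l st) fsum k = fsum l + \sum_(k <- st) fsum k.
Proof.
elim: st l => [|[|x l'] st IHst] l /=; first by rewrite big_cons.
  by rewrite !big_cons fsum_nil add0r.
by rewrite !big_cons IHst fsum_nil add0r fsum_merge addrA [fsum l + _]addrC.
Qed.

Lemma fsum_collect l : fsum (collect l) = fsum l.
Proof.
have merged st a : fsum (foldl merge_sums a st) = fsum a + \sum_(k <- st) fsum k.
  elim: st a => [|k st IHst] a /=; first by rewrite big_nil addr0.
  by rewrite IHst fsum_merge big_cons addrA.
have pushed st : \sum_(k <- foldl (fun st x => push_sum [:: x] st) st l) fsum k =
    \sum_(k <- st) fsum k + fsum l.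
  elim: l st => [|[c x] l IHl] st /=; first by rewrite fsum_nil addr0.
  by rewrite IHl fsum_push !fsum_cons fsum_nil addr0 addrA; congr (_ + _); rewrite addrC.
by rewrite /collect merged pushed fsum_nil big_nil !add0r.
Qed.

Definition scale_sum (c : Z) (l : seq (Z * K)) : seq (Z * K) := [seq (Z.mul c x.1, x.2) | x <- l].

Lemma fsum_scale c l : fsum (scale_sum c l) = zr c *: fsum l.
Proof.
by rewrite /fsum big_map scaler_sumr; apply: eq_bigr => x _ /=; rewrite zrM scalerA.
Qed.

End FormalSums.

(* Normal form for products that alternate in the last two arguments, and whose
   non-central arguments are alternating products. *)
Definition ssort3 (a b c : tmonomial) : bool * tmonomial :=
  let insert s a b c :=
    match tcmp b c with
    | Gt => match tcmp a c with Gt => (s, TMul c a b) | _ => (~~ s, TMul a c b) end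
    | _ => (s, TMul a b c)
    end in
  match tcmp a b with Gt => insert true b a c | _ => insert false a b c end.

Fixpoint scanon (m : tmonomial) : bool * tmonomial :=
  match m with
  | TVar i => (false, TVar i)
  | TMul a b c =>
    let: (sa, a') := scanon a in let: (sb, b') := scanon b in let: (sc, c') := scanon c in
    let: (s, t) := ssort3 a' b' c' in (sa (+) sb (+) sc (+) s, t)
  end.

Fixpoint pcanon (m : tmonomial) : bool * tmonomial :=
  match m with
  | TVar i => (false, TVar i)
  | TMul a b c =>
    let: (sa, a') := pcanon a in let: (sb, b') := scanon b in let: (sc, c') := scanon c in
    let: (s, t) := if tcmp b' c' is Gt then (true, TMul a' c' b') else (false, TMul a' b' c') in
    (sa (+) sb (+) sc (+) s, t)
  end.

Definition zsign (s : bool) (c : Z) : Z := if s then Z.opp c else c.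

Definition pnormal (l : seq (Z * tmonomial)) : seq (Z * tmonomial) :=
  collect tcmp [seq (let: (s, t) := pcanon x.2 in (zsign s x.1, t)) | x <- l].

Section PQ.
Variables (U : lmodType rat) (mu : U -> U -> U -> U).
Hypothesis tri : is_trilinear mu.
Hypothesis mu23 : forall x y z, mu x z y = - mu x y z.
Hypothesis mu_inner : forall x a b c y, mu x (mu b a c) y = - mu x (mu a b c) y.

(** Equality as a noncentral argument. Products alternate fully there, whereas in the centre they
    alternate only in their last two arguments. *)
Let eqv u u' := forall x y, mu x u y = mu x u' y.

(** In a noncentral product, Q moves the first factor to the second place, where the hypothesis
    about it applies. *)
Lemma eqv_mul a b c a' b' c' : eqv a a' -> eqv b b' -> eqv c c' -> eqv (mu a b c) (mu a' b' c').
Proof.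
move=> aa bb cc x y.
have -> : mu a b c = mu a b' c' by rewrite bb mu23 cc -mu23.
by rewrite mu_inner aa -mu_inner.
Qed.

Lemma eqvZ k u u' : eqv u u' -> eqv (k *: u) (k *: u').
Proof. by move=> uu x y; rewrite !(trilZ2 tri) uu. Qed.

Lemma eqv_trans u v w : eqv u v -> eqv v w -> eqv u w.
Proof. by move=> uv vw x y; rewrite uv vw. Qed.

Variable v : nat -> U.
Local Notation ev := (meval mu v).
Local Notation sg := (fun s : bool => (-1) ^+ s : rat).

Lemma mu_inner23 x a b c y : mu x (mu a c b) y = - mu x (mu a b c) y.
Proof. by rewrite [mu a c b]mu23 -scaleN1r (trilZ2 tri) scaleN1r. Qed.

Lemma ssort3P a b c : eqv (mu (ev a) (ev b) (ev c))
  (sg (ssort3 a b c).1 *: ev (ssort3 a b c).2).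
Proof.
move=> x y; rewrite (trilZ2 tri) /ssort3.
case: (tcmp a b); case: (tcmp b c); case: (tcmp a c) => /=;
  rewrite ?expr0 ?scale1r ?expr1 ?scaleN1r //.
all: try by rewrite mu_inner23 ?opprK.
all: try by rewrite mu_inner mu_inner23 ?opprK.
all: try by rewrite mu_inner23 mu_inner ?opprK.
all: try by rewrite mu_inner ?opprK.
all: try by rewrite mu_inner mu_inner23 mu_inner ?opprK.
Qed.

Lemma scanonP m : eqv (ev m) (sg (scanon m).1 *: ev (scanon m).2).
Proof.
elim: m => [i|a IHa b IHb c IHc] /=; first by rewrite expr0 scale1r.
case: (scanon a) IHa => sa a' /= IHa; case: (scanon b) IHb => sb b' /= IHb.
case: (scanon c) IHc => sc c' /= IHc.
have := ssort3P a' b' c'; case: (ssort3 a' b' c') => s t /= st.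
apply: eqv_trans (eqv_mul IHa IHb IHc) _.
rewrite (trilZ1 tri) (trilZ2 tri) (trilZ3 tri) !scalerA -!signr_addb.
apply: eqv_trans (eqvZ _ st) _; rewrite scalerA -signr_addb => x y.
by rewrite ?addbA.
Qed.

Lemma pcanonP m : ev m = sg (pcanon m).1 *: ev (pcanon m).2.
Proof.
elim: m => [i|a IHa b _ c _] /=; first by rewrite expr0 scale1r.
case: (pcanon a) IHa => sa a' /= ->.
have := scanonP b; case: (scanon b) => sb b' /= eb.
have := scanonP c; case: (scanon c) => sc c' /= ec.
rewrite eb mu23 ec -mu23 (trilZ1 tri) (trilZ2 tri) (trilZ3 tri) !scalerA -!signr_addb.
by case: (tcmp b' c'); rewrite ?addbF //= addbT mu23 -scaleN1r scalerA signrN mulrN1 ?signrN.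
Qed.

Lemma fsum_pnormal l : fsum ev (pnormal l) = fsum ev l.
Proof.
rewrite (fsum_collect tcmp_eq) /fsum big_map; apply: eq_bigr => -[c t] _ /=.
rewrite [in RHS]pcanonP; case: (pcanon t) => s t' /=.
by case: s; rewrite /= ?expr0 ?scale1r // expr1 scaleN1r zrN scalerN scaleNr.
Qed.

End PQ.

(** * R and S as integral sums over permutations *)

Definition zsgn (w : seq nat) : Z := zsign (odd_inv w) (Zpos xH).

Definition permR : seq (Z * tmonomial) :=
  let x w i := TVar (nth 0 w i).+1 in
  [seq (Z.mul (Zpos 1) (zsgn w), TMul (TMul (TVar 0) (TMul (x w 0) (x w 1) (x w 2)) (x w 3)) (x w 4) (x w 5))
     | w <- permutations (iota 0 6)] ++
  [seq (Z.mul (Zneg 1) (zsgn w), TMul (TMul (TVar 0) (x w 0) (x w 1)) (TMul (x w 2) (x w 3) (x w 4)) (x w 5))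
     | w <- permutations (iota 0 6)].

(** This is 12 times S: the coefficients 1/4, 1/6 and 1/12 become 3, 2 and 1. *)
Definition permS : seq (Z * tmonomial) :=
  let a := TVar 0 in let g := TVar 6 in
  let x w i := TVar (nth 0 w i).+1 in
  let sum k F := [seq (Z.mul k (zsgn w), F (x w 0) (x w 1) (x w 2) (x w 3) (x w 4))
                    | w <- permutations (iota 0 5)] in
  sum (Zpos 3) (fun b c d e f => TMul (TMul (TMul a b c) d g) e f) ++
  sum (Zneg 2) (fun b c d e f => TMul (TMul a (TMul b c d) e) f g) ++
  sum (Zpos 3) (fun b c d e f => TMul (TMul a (TMul b c g) d) e f) ++
  sum (Zpos 1) (fun b c d e f => TMul (TMul a b c) (TMul d e f) g) ++
  sum (Zneg 2) (fun b c d e f => TMul a (TMul (TMul b c d) e g) f) ++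
  sum (Zneg 1) (fun b c d e f => TMul a (TMul b c d) (TMul e f g)).

Section Teval.
Variables (A : lmodType rat) (mu : A -> A -> A -> A) (v : nat -> A).
Local Notation ev := (meval mu v).

Lemma teval_supp (S : seq tmonomial) f : uniq S -> {subset msupp f <= S} ->
  teval mu v f = \sum_(m <- S) f@_m *: ev m.
Proof.
move=> uS fS; rewrite /teval [RHS](bigID (fun m => m \in msupp f)) /=.
rewrite [X in _ + X]big1 ?addr0; last by move=> m /mcoeff_outdom ->; rewrite scale0r.
rewrite -[RHS]big_filter; apply: perm_big; apply: uniq_perm; rewrite ?fset_uniq ?filter_uniq // => m.
by rewrite mem_filter; case: (boolP (m \in msupp f)) => [/fS ->|].
Qed.

Lemma tevalD f g : teval mu v (f + g) = teval mu v f + teval mu v g.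
Proof.
pose S := undup (msupp f ++ msupp g).
have fS : {subset msupp f <= S} by move=> m mf; rewrite mem_undup mem_cat mf.
have gS : {subset msupp g <= S} by move=> m mg; rewrite mem_undup mem_cat mg orbT.
have fgS : {subset msupp (f + g) <= S}.
  move=> m; rewrite -mcoeff_neq0 mcoeffD; apply: contraR => mS.
  by rewrite !mcoeff_outdom ?addr0 //; apply: contra mS; [apply: gS | apply: fS].
rewrite (teval_supp (undup_uniq _) fS) (teval_supp (undup_uniq _) gS) (teval_supp (undup_uniq _) fgS).
by rewrite -big_split; apply: eq_bigr => m _; rewrite mcoeffD scalerDl.
Qed.

Lemma tevalZ c f : teval mu v (c *: f) = c *: teval mu v f.
Proof.
have cf : {subset msupp (c *: f) <= msupp f}.
  by move=> m; rewrite -!mcoeff_neq0 mcoeffZ; apply: contraNN => /eqP ->; rewrite mulr0.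
rewrite (teval_supp (fset_uniq _) cf) /teval scaler_sumr.
by apply: eq_bigr => m _; rewrite mcoeffZ scalerA.
Qed.

Lemma tevalVZ k f : teval mu v (k%:R^-1 *: f) = k%:R^-1 *: teval mu v f.
Proof. exact: tevalZ. Qed.

Lemma teval0 : teval mu v 0 = 0.
Proof. by rewrite -[X in teval _ _ X](scale0r (0 : tpoly)) tevalZ scale0r. Qed.

Lemma tevalB f g : teval mu v (f - g) = teval mu v f - teval mu v g.
Proof. by rewrite -[- g]scaleN1r tevalD tevalZ scaleN1r. Qed.

Lemma tevalU m : teval mu v << m >> = ev m.
Proof.
rewrite (@teval_supp [:: m]) //; last by move=> k; rewrite msuppU oner_eq0 in_fset1 inE.
by rewrite big_seq1 mcoeffUU scale1r.
Qed.

Lemma teval_alt_sum n (F : 'S_n.+1 -> tmonomial) (G : seq nat -> tmonomial) :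
  (forall s, F s = G (word_of_perm s)) ->
  teval mu v (alt_sum F) = \sum_(w <- permutations (iota 0 n.+1)) sgn w *: ev (G w).
Proof.
move=> FG; rewrite -(@sum_words n.+1 _ (fun w => sgn w *: ev (G w))) /alt_sum.
rewrite (big_morph (teval mu v) (@tevalD) teval0); apply: eq_bigr => s _.
by rewrite tevalZ tevalU sgn_word_of_perm FG.
Qed.

Lemma pvarE n (s : 'S_n.+1) i : (i < n.+1)%N -> pvar s i = TVar (nth 0%N (word_of_perm s) i).+1.
Proof. by move=> lt; rewrite /pvar -[in RHS](inordK lt) nth_word_of_perm. Qed.

Lemma zr_zsgn w : uniq w -> zr (zsgn w) = sgn w.
Proof. by move=> uw; rewrite /sgn uw /zsgn; case: (odd_inv w). Qed.

Lemma fsum_perms n c (G : seq nat -> tmonomial) :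
  fsum ev [seq (Z.mul c (zsgn w), G w) | w <- permutations (iota 0 n)] =
  zr c *: \sum_(w <- permutations (iota 0 n)) sgn w *: ev (G w).
Proof.
rewrite /fsum big_map scaler_sumr big_seq [RHS]big_seq; apply: eq_bigr => w.
rewrite mem_permutations => pw; rewrite zrM zr_zsgn ?scalerA //.
by rewrite (perm_uniq pw) iota_uniq.
Qed.

Lemma tevalVB k l f g :
  teval mu v (k%:R^-1 *: f - l%:R^-1 *: g) = k%:R^-1 *: teval mu v f + (- l%:R^-1) *: teval mu v g.
Proof. by rewrite tevalB !tevalVZ scaleNr. Qed.

Lemma tevalVD k f g : teval mu v (g + k%:R^-1 *: f) = teval mu v g + k%:R^-1 *: teval mu v f.
Proof. by rewrite tevalD tevalVZ. Qed.

Lemma tevalVBr k f g : teval mu v (g - k%:R^-1 *: f) = teval mu v g + (- k%:R^-1) *: teval mu v f.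
Proof. by rewrite tevalB tevalVZ scaleNr. Qed.

Lemma teval_alt_sumZ n (F : 'S_n.+1 -> tmonomial) (G : seq nat -> tmonomial) k d c :
  (forall s, F s = G (word_of_perm s)) -> d * zr k = c ->
  c *: teval mu v (alt_sum F) =
  d *: fsum ev [seq (Z.mul k (zsgn w), G w) | w <- permutations (iota 0 n.+1)].
Proof. by move=> FG <-; rewrite (teval_alt_sum FG) -scalerA -fsum_perms. Qed.

Lemma teval_identR : teval mu v identR = 12%:R^-1 *: fsum ev permR.
Proof.
have c12 : 12%:R^-1 * zr (Zpos 1) = 12%:R^-1 :> rat by rewrite mulr1.
have cm12 : 12%:R^-1 * zr (Zneg 1) = - 12%:R^-1 :> rat by rewrite mulrN1.
apply: etrans (tevalVB _ _ _ _) _; rewrite /permR fsum_cat scalerDr.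
congr (_ + _).
- pose x w i := TVar (nth 0%N w i).+1.
  apply: (@teval_alt_sumZ 5 _ (fun w => TMul (TMul (TVar 0) (TMul (x w 0) (x w 1) (x w 2)) (x w 3)) (x w 4) (x w 5))%N _ _ _ _ c12) => s.
  by rewrite !pvarE.
- pose x w i := TVar (nth 0%N w i).+1.
  apply: (@teval_alt_sumZ 5 _ (fun w => TMul (TMul (TVar 0) (x w 0) (x w 1)) (TMul (x w 2) (x w 3) (x w 4)) (x w 5))%N _ _ _ _ cm12) => s.
  by rewrite !pvarE.
Qed.

Lemma teval_identS : teval mu v identS = 12%:R^-1 *: fsum ev permS.
Proof.
pose a := TVar 0; pose g := TVar 6; pose x w i := TVar (nth 0%N w i).+1.
have c4 : 12%:R^-1 * zr (Zpos 3) = 4%:R^-1 :> rat by [].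
have c6 : 12%:R^-1 * zr (Zneg 2) = - 6%:R^-1 :> rat by [].
have c12 : 12%:R^-1 * zr (Zpos 1) = 12%:R^-1 :> rat by rewrite mulr1.
have cm12 : 12%:R^-1 * zr (Zneg 1) = - 12%:R^-1 :> rat by rewrite mulrN1.
rewrite /permS !fsum_cat !scalerDr !addrA.
apply: etrans (tevalVBr _ _ _) _; congr (_ + _); last first.
  apply: (@teval_alt_sumZ 4 _ (fun w => TMul a (TMul (x w 0) (x w 1) (x w 2)) (TMul (x w 3) (x w 4) g))%N _ _ _ _ cm12) => s.
  by rewrite !pvarE.
apply: etrans (tevalVBr _ _ _) _; congr (_ + _); last first.
  apply: (@teval_alt_sumZ 4 _ (fun w => TMul a (TMul (TMul (x w 0) (x w 1) (x w 2)) (x w 3) g) (x w 4))%N _ _ _ _ c6) => s.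
  by rewrite !pvarE.
apply: etrans (tevalVD _ _ _) _; congr (_ + _); last first.
  apply: (@teval_alt_sumZ 4 _ (fun w => TMul (TMul a (x w 0) (x w 1)) (TMul (x w 2) (x w 3) (x w 4)) g)%N _ _ _ _ c12) => s.
  by rewrite !pvarE.
apply: etrans (tevalVD _ _ _) _; congr (_ + _); last first.
  apply: (@teval_alt_sumZ 4 _ (fun w => TMul (TMul a (TMul (x w 0) (x w 1) g) (x w 2)) (x w 3) (x w 4))%N _ _ _ _ c4) => s.
  by rewrite !pvarE.
apply: etrans (tevalVB _ _ _ _) _; congr (_ + _).
  apply: (@teval_alt_sumZ 4 _ (fun w => TMul (TMul (TMul a (x w 0) (x w 1)) (x w 2) g) (x w 3) (x w 4))%N _ _ _ _ c4) => s.
  by rewrite !pvarE.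
apply: (@teval_alt_sumZ 4 _ (fun w => TMul (TMul a (TMul (x w 0) (x w 1) (x w 2)) (x w 3)) (x w 4) g)%N _ _ _ _ c6) => s.
by rewrite !pvarE.
Qed.

Lemma fsum_teval0 f (l : seq (Z * tmonomial)) :
  teval mu v f = 12%:R^-1 *: fsum ev l -> teval mu v f = 0 <-> fsum ev l = 0.
Proof.
move=> ->; split=> [/eqP | ->]; last by rewrite scaler0.
by rewrite scaler_eq0 invr_eq0 pnatr_eq0 => /eqP.
Qed.

End Teval.

(** * The split null extension of an algebra that satisfies P, Q, R and S *)

Definition signed (l : seq (Z * tmonomial)) : seq (Z * tmonomial) :=
  [seq (Z.mul (zsgn (leaves x.2)) x.1, x.2) | x <- l].

Definition msubst (q : nat -> nat) (l : seq (Z * tmonomial)) : seq (Z * tmonomial) :=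
  [seq (x.1, relabel q x.2) | x <- l].

(* The second component of a monomial in the split null extension [nullext],
   where the variable [j + 7] stands for the second component of the variable [j]. *)
Fixpoint lifts (m : tmonomial) : seq (Z * tmonomial) :=
  match m with
  | TVar i => [:: (Zpos xH, TVar (i + 7)%N)]
  | TMul a b c =>
      [seq (x.1, TMul x.2 b c) | x <- lifts a] ++
      [seq (Z.opp x.1, TMul x.2 a c) | x <- lifts b] ++
      [seq (x.1, TMul x.2 a b) | x <- lifts c]
  end.

Definition liftR : seq (Z * tmonomial) :=
  flatten [seq scale_sum x.1 (lifts x.2) | x <- signed relR].

(* R with the second component of the variable 0 as its centre. *)
Definition centreR : seq (Z * tmonomial) := msubst (fun j => if j is k.+1 then k.+1 else 7%N) permR.

(* R and S with the second component of the variable [i] as their centre. *)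
Definition branchRS (i : nat) : seq (Z * tmonomial) :=
  let rest := [seq j <- iota 1 6 | j != i] in
  let qR j := (if j is k.+1 then nth 0 (0 :: rest) k else i + 7)%N in
  let qS j := (if j is k.+1 then if k is 5 then 0 else nth 0 rest k else i + 7)%N in
  scale_sum (if odd i then Zpos 1 else Zneg 1)
    (msubst qS permS ++ scale_sum (Zneg 1) (msubst qR permR)).

(** Modulo P and Q, each term of [signed relR] stands for the 3! * 2! = 12 terms of the sum over S_6
    that differ by the order inside its two alternating groups. *)
Lemma relR_normal : pnormal (scale_sum (Zneg 12) (signed relR) ++ permR) = [::].
Proof. by vm_compute. Qed.

(** The second component of R splits according to the variable that contributes its second component
    and thereby becomes the centre. For the variable 0 this is R; for any other it is, modulo P and
    Q, plus or minus S - R, with the old centre 0 as last argument of S and first noncentral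
    argument of R. *)
Lemma liftR_normal :
  pnormal (scale_sum (Zneg 12) liftR ++ centreR ++ flatten [seq branchRS i | i <- iota 1 6]) = [::].
Proof. by vm_compute. Qed.

Section NullExtension.
Variables (A : lmodType rat) (mu : A -> A -> A -> A).
Hypothesis tri : is_trilinear mu.
Hypothesis idP : satisfies mu identP.
Hypothesis idQ : satisfies mu identQ.
Hypothesis idR : satisfies mu identR.
Hypothesis idS : satisfies mu identS.

Lemma identP_skew x y z : mu x z y = - mu x y z.
Proof.
have := idP (nth 0 [:: x; y; z]); rewrite /identP tevalD !tevalU /= => /eqP.
by rewrite addrC addr_eq0 => /eqP.
Qed.

Lemma identQ_skew x a b c y : mu x (mu b a c) y = - mu x (mu a b c) y.
Proof.
have := idQ (nth 0 [:: x; a; b; c; y]); rewrite /identQ tevalD !tevalU /= => /eqP.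
by rewrite addrC addr_eq0 => /eqP.
Qed.

Let fsum_normal v := fsum_pnormal tri identP_skew identQ_skew v.

Lemma fsum_signed v l : all (fun x => uniq (leaves x.2)) l ->
  fsum (meval mu v) (signed l) = feval (tw mu v) l.
Proof.
move=> /allP ul; rewrite /fsum big_map /feval big_seq [RHS]big_seq.
by apply: eq_bigr => x /ul ux; rewrite /= zrM zr_zsgn // mulrC scalerA.
Qed.

Lemma fsum_msubst v q l : fsum (meval mu v) (msubst q l) = fsum (meval mu (v \o q)) l.
Proof. by rewrite /fsum big_map; apply: eq_bigr => x _; rewrite meval_relabel. Qed.

Lemma fsum_permR v : fsum (meval mu v) permR = 0.
Proof. exact/(fsum_teval0 (teval_identR mu v))/idR. Qed.

Lemma fsum_permS v : fsum (meval mu v) permS = 0.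
Proof. exact/(fsum_teval0 (teval_identS mu v))/idS. Qed.

Lemma fsum_normal0 v c l l' : (Z.eqb c Z0 = false) ->
  pnormal (scale_sum c l ++ l') = [::] -> fsum (meval mu v) l' = 0 -> fsum (meval mu v) l = 0.
Proof.
move=> c0 n0 l0; have := fsum_normal v (scale_sum c l ++ l').
rewrite n0 fsum_nil fsum_cat l0 addr0 fsum_scale => /esym/eqP.
rewrite scaler_eq0 => /orP[/eqP c0'|/eqP //]; case: Z.eqb_spec c0 => // c0 _; case: c0.
by apply: (can_inj int_of_ZK); apply: (@intr_inj rat).
Qed.

Lemma fsum_relR v : fsum (meval mu v) (signed relR) = 0.
Proof. by apply: fsum_normal0 relR_normal (fsum_permR v). Qed.

Lemma fsum_branchRS v i : fsum (meval mu v) (branchRS i) = 0.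
Proof.
rewrite /branchRS fsum_scale fsum_cat fsum_scale !fsum_msubst.
by rewrite fsum_permR fsum_permS scaler0 addr0 scaler0.
Qed.

Lemma fsum_liftR v : fsum (meval mu v) liftR = 0.
Proof.
apply: fsum_normal0 liftR_normal _ => //.
rewrite fsum_cat fsum_msubst fsum_permR add0r fsum_flatten big_map.
by apply: big1_seq => i _; apply: fsum_branchRS.
Qed.

(* The split null extension of [A] with its alternating product. *)
Definition nullext (p q r : A * A) : A * A :=
  (mu p.1 q.1 r.1, mu p.2 q.1 r.1 - mu q.2 p.1 r.1 + mu r.2 p.1 q.1).

(** The product of A does not alternate in its first two arguments, but by Q the defect annihilates
    as a noncentral argument. Computing modulo this ideal takes the place of a quotient algebra. *)
Definition null_ideal (p : A * A) : Prop := p.2 = 0 /\ forall x y, mu x p.1 y = 0.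

Lemma meval_nullext1 u m : (meval nullext u m).1 = meval mu (fun i => (u i).1) m.
Proof. by elim: m => //= a -> b -> c ->. Qed.

Lemma meval_nullext2 u m : all (fun i => i < 7)%N (leaves m) ->
  (meval nullext u m).2 =
  fsum (meval mu (fun i => if (i < 7)%N then (u i).1 else (u (i - 7)%N).2)) (lifts m).
Proof.
set w := (X in fsum (meval _ X)); have ev m' : all (fun i => i < 7)%N (leaves m') ->
    (meval nullext u m').1 = meval mu w m'.
  elim: m' => [i|a IHa b IHb c IHc] /=; first by rewrite andbT /w => ->.
  by rewrite !all_cat => /and3P[/IHa -> /IHb -> /IHc ->].
elim: m => [i|a IHa b IHb c IHc] /=.
  by move=> _; rewrite fsum_cons fsum_nil addr0 scale1r /= /w ltnNge leq_addl addnK.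
rewrite !all_cat => /and3P[la lb lc]; rewrite !ev // IHa // IHb // IHc //.
rewrite !fsum_cat /fsum !big_map addrA; congr (_ + _ + _).
- rewrite (big_morph (fun x => mu x (meval mu w b) (meval mu w c)) (id1 := 0) (op1 := +%R)) //.
  + by apply: eq_bigr => x _; rewrite (trilZ1 tri).
  + by move=> x y; rewrite (trilD1 tri).
  + exact: tril01.
- rewrite (big_morph (fun x => mu x (meval mu w a) (meval mu w c)) (id1 := 0) (op1 := +%R)) //.
  + by rewrite -sumrN; apply: eq_bigr => x _; rewrite (trilZ1 tri) zrN scaleNr.
  + by move=> x y; rewrite (trilD1 tri).
  + exact: tril01.
- rewrite (big_morph (fun x => mu x (meval mu w a) (meval mu w b)) (id1 := 0) (op1 := +%R)) //.
  + by apply: eq_bigr => x _; rewrite (trilZ1 tri).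
  + by move=> x y; rewrite (trilD1 tri).
  + exact: tril01.
Qed.

Lemma relR_multilinear :
  all (fun x => uniq (leaves x.2) && all (fun i => i < 7)%N (leaves x.2)) relR.
Proof. by vm_compute. Qed.

Lemma nullext_tri : is_trilinear nullext.
Proof.
split=> [q r k p p' | p r k q q' | p q k r r']; rewrite /nullext /=;
  rewrite !(trilD1 tri, trilD2 tri, trilD3 tri, trilZ1 tri, trilZ2 tri, trilZ3 tri);
  apply/pair_eqP; rewrite /pair_eq /= eqxx /= !scalerDr !scalerN !opprD; apply/eqP.
- by rewrite [RHS]addrACA [X in _ = X + _]addrACA.
- by rewrite [RHS]addrACA [X in _ = X + _]addrACA.
- by rewrite [RHS]addrACA [X in _ = X + _]addrACA.
Qed.

(** In the second component alternation follows from the signs in [nullext] and from P, and R is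
    [fsum_liftR]; in the first, Q puts the failure of alternation into the ideal. *)
Lemma nullext_ats : ats_mod nullext null_ideal.
Proof.
have C0 x y z t : mu x (mu y z t) 0 = 0 by rewrite (tril03 tri).
split.
- exact: nullext_tri.
- by split=> // x y; rewrite (tril02 tri).
- move=> p q [p2 p1] [q2 q1]; split=> [|x y]; first by rewrite /= p2 q2 addr0.
  by rewrite /= (trilD2 tri) p1 q1 addr0.
- move=> c p [p2 p1]; split=> [|x y]; first by rewrite /= p2 scaler0.
  by rewrite /= (trilZ2 tri) p1 scaler0.
- move=> p q r [p2 p1]; split=> [|x y] /=; first by rewrite p2 (tril01 tri) !p1 subrr addr0.
  by rewrite -[LHS]opprK -identQ_skew p1 (tril02 tri) oppr0.
- move=> p q r; split=> [|x y] /=; last by rewrite (trilD2 tri) [X in _ + X]identQ_skew subrr.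
  rewrite [mu r.2 q.1 p.1]identP_skew addrACA subrr addr0.
  by rewrite -[mu q.2 _ _ - _]opprB subrr.
- move=> p q r; split=> [|x y] /=.
    by rewrite [mu p.2 r.1 q.1]identP_skew [X in X + _]addrAC -opprD addrACA subrr add0r addNr.
  by rewrite [mu p.1 r.1 q.1]identP_skew subrr (tril02 tri).
move=> v; have uR : all (fun x => uniq (leaves x.2)) relR.
  by apply: sub_all relR_multilinear => x /andP[].
split=> [|x y].
  rewrite -(fsum_liftR (fun i => if (i < 7)%N then (v i).1 else (v (i - 7)%N).2)).
  rewrite fsum_flatten big_map big_map /feval raddf_sum big_seq [RHS]big_seq.
  apply: eq_bigr => -[c m] /(allP relR_multilinear) /andP[/= um lm].
  by rewrite fsum_scale /= meval_nullext2 // scalerA zrM zr_zsgn // mulrC.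
rewrite (_ : (feval _ _).1 = 0) ?(tril02 tri) //.
rewrite -(fsum_relR (fun i => (v i).1)) fsum_signed // /feval raddf_sum.
by apply: eq_bigr => z _; rewrite /tw /= meval_nullext1.
Qed.

End NullExtension.

(** * The partially alternating ternary sum satisfies P, Q, R and S *)

Definition combine (X Y T : Type) (h : X -> Y -> T) (p : seq (Z * X)) (q : seq (Z * Y)) :
    seq (Z * T) :=
  [seq (Z.mul x.1 y.1, h x.2 y.2) | x <- p, y <- q].

Definition opp_sum (T : Type) (p : seq (Z * T)) : seq (Z * T) := scale_sum (Zneg xH) p.

(* Expansion of a noncentral argument, where both products become concatenation. *)
Fixpoint aexp (m : tmonomial) : seq (Z * seq nat) :=
  match m with
  | TVar i => [:: (Zpos xH, [:: i])]
  | TMul a b c =>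
      let f x y z := combine cat (combine cat (aexp x) (aexp y)) (aexp z) in
      f a b c ++ opp_sum (f a c b) ++ opp_sum (f b a c) ++ f c a b ++ f b c a ++ opp_sum (f c b a)
  end.

Definition word_r (x : seq nat * seq nat) (w : seq nat) := (x.1, x.2 ++ w).
Definition word_l (x : seq nat * seq nat) (w : seq nat) := (w ++ x.1, x.2).

(* The pair (u, w) stands for u |- x -| w, where x is the centre of the monomial. *)
Fixpoint cexp (m : tmonomial) : seq (Z * (seq nat * seq nat)) :=
  match m with
  | TVar _ => [:: (Zpos xH, ([::], [::]))]
  | TMul a b c =>
      let p := cexp a in let q := aexp b in let s := aexp c in
      let R := combine word_r in let L := combine word_l in
      R (R p q) s ++ opp_sum (R (R p s) q) ++ opp_sum (R (L p q) s) ++ R (L p s) q ++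
      L (L p s) q ++ opp_sum (L (L p q) s)
  end.

Fixpoint wcmp (u w : seq nat) : comparison :=
  match u, w with
  | [::], [::] => Eq
  | [::], _ => Lt
  | _, [::] => Gt
  | i :: u', j :: w' => match Nat.compare i j with Eq => wcmp u' w' | o => o end
  end.

Definition pcmp (x y : seq nat * seq nat) : comparison :=
  match wcmp x.1 y.1 with Eq => wcmp x.2 y.2 | o => o end.

Lemma pcmp_eq x y : pcmp x y = Eq -> x = y.
Proof.
have wcmp_eq u w : wcmp u w = Eq -> u = w.
  elim: u w => [|i u IHu] [|j w] //=; case E: (Nat.compare i j) => // /IHu ->.
  by congr (_ :: _); apply: PeanoNat.Nat.compare_eq.
case: x y => [u w] [u' w']; rewrite /pcmp /=.
by case E: (wcmp u u') => // /wcmp_eq ->; rewrite (wcmp_eq _ _ E).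
Qed.

Definition expand (l : seq (Z * tmonomial)) : seq (Z * (seq nat * seq nat)) :=
  collect pcmp (flatten [seq scale_sum x.1 (cexp x.2) | x <- l]).

Definition sumP : seq (Z * tmonomial) :=
  let x i := TVar i in [:: (Zpos xH, TMul (x 0) (x 1) (x 2)); (Zpos xH, TMul (x 0) (x 2) (x 1))]%N.

Definition sumQ : seq (Z * tmonomial) :=
  let x i := TVar i in
  [:: (Zpos xH, TMul (x 0) (TMul (x 1) (x 2) (x 3)) (x 4));
      (Zpos xH, TMul (x 0) (TMul (x 2) (x 1) (x 3)) (x 4))]%N.

(** Since [cexp] forgets which variable is the centre, expansions can be compared only among terms
    with the same centre. *)
Definition centred (l : seq (Z * tmonomial)) : bool := all (fun x => head 0%N (leaves x.2) == 0%N) l.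

Lemma expand_sumP : centred sumP && nilp (expand sumP).
Proof. by vm_compute. Qed.

Lemma expand_sumQ : centred sumQ && nilp (expand sumQ).
Proof. by vm_compute. Qed.

Lemma expand_relR : centred (signed relR) && nilp (expand (signed relR)).
Proof. by vm_compute. Qed.

(** Collecting the 720 terms of [permS] first keeps the expansion small; each monomial of degree 7
    yields 6^3 words. *)
Lemma expand_permS : centred (pnormal permS) && nilp (expand (pnormal permS)).
Proof. by vm_compute. Qed.

Section Bimodule.
Variables (D : lmodType rat) (l r : D -> D -> D).
Hypothesis dialg : is_dialgebra l r.

Let lDl a b c : l (a + b) c = l a c + l b c.
Proof. by have [[H _] _] := dialg; have := H c 1 a b; rewrite !scale1r. Qed.
Let lDr a b c : l c (a + b) = l c a + l c b.
Proof. by have [[_ H] _] := dialg; have := H c 1 a b; rewrite !scale1r. Qed.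
Let rDl a b c : r (a + b) c = r a c + r b c.
Proof. by have [_ [H _]] := dialg; have := H c 1 a b; rewrite !scale1r. Qed.
Let rDr a b c : r c (a + b) = r c a + r c b.
Proof. by have [_ [_ H]] := dialg; have := H c 1 a b; rewrite !scale1r. Qed.
Let l0l c : l 0 c = 0. Proof. by apply: (addrI (l 0 c)); rewrite -lDl !addr0. Qed.
Let l0r c : l c 0 = 0. Proof. by apply: (addrI (l c 0)); rewrite -lDr !addr0. Qed.
Let r0l c : r 0 c = 0. Proof. by apply: (addrI (r 0 c)); rewrite -rDl !addr0. Qed.
Let r0r c : r c 0 = 0. Proof. by apply: (addrI (r c 0)); rewrite -rDr !addr0. Qed.
Let lZl k a c : l (k *: a) c = k *: l a c.
Proof. by have [[H _] _] := dialg; have := H c k a 0; rewrite !addr0 l0l addr0. Qed.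
Let lZr k a c : l c (k *: a) = k *: l c a.
Proof. by have [[_ H] _] := dialg; have := H c k a 0; rewrite !addr0 l0r addr0. Qed.
Let rZl k a c : r (k *: a) c = k *: r a c.
Proof. by have [_ [H _]] := dialg; have := H c k a 0; rewrite !addr0 r0l addr0. Qed.
Let rZr k a c : r c (k *: a) = k *: r c a.
Proof. by have [_ [_ H]] := dialg; have := H c k a 0; rewrite !addr0 r0r addr0. Qed.

Lemma pats_tri : is_trilinear (pats l r).
Proof.
split=> [y z k x x' | x z k y y' | x y k z z']; rewrite /pats;
  rewrite !(lDl, lDr, rDl, rDr, lZl, lZr, rZl, rZr) !scalerDr !scalerN !opprD;
  rewrite [RHS]addrACA; congr (_ + _);
  rewrite [RHS]addrACA; congr (_ + _);
  rewrite [RHS]addrACA; congr (_ + _);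
  rewrite [RHS]addrACA; congr (_ + _);
  by rewrite [RHS]addrACA.
Qed.

Lemma fsum_combine (X Y T : Type) (h : X -> Y -> T) (F : T -> D) p q :
  fsum F (combine h p q) = \sum_(x <- p) \sum_(y <- q) zr x.1 *: (zr y.1 *: F (h x.2 y.2)).
Proof.
rewrite /fsum big_allpairs_dep; apply: eq_bigr => x _.
by apply: eq_bigr => y _; rewrite zrM scalerA.
Qed.

Lemma fsum_opp (T : Type) (F : T -> D) p : fsum F (opp_sum p) = - fsum F p.
Proof. by rewrite fsum_scale scaleN1r. Qed.

Variable v : nat -> D.

Let right x w := foldl (fun x i => l x (v i)) x w.
Let left x w := foldr (fun i => r (v i)) x w.

Definition acts (p : seq (Z * seq nat)) (a : D) : Prop :=
  forall x, l x a = fsum (right x) p /\ r a x = fsum (left x) p.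

Lemma acts_cat p q a b : acts p a -> acts q b -> acts (p ++ q) (a + b).
Proof.
by move=> pa qb x; rewrite !fsum_cat lDr rDl !(proj1 (pa x), proj2 (pa x), proj1 (qb x), proj2 (qb x)).
Qed.

Lemma acts_opp p a : acts p a -> acts (opp_sum p) (- a).
Proof.
move=> pa x; rewrite !fsum_opp -!scaleN1r lZr rZl.
by rewrite (proj1 (pa x)) (proj2 (pa x)).
Qed.

(** By the bar axioms the two products of [a] and [b] cannot be told apart when they act from a
    noncentral position. *)
Lemma acts_mul p q a b : acts p a -> acts q b -> acts (combine cat p q) (l a b) /\ acts (combine cat p q) (r a b).
Proof.
move=> pa qb.
have right_cat x : fsum (right x) (combine cat p q) = l (l x a) b.
  rewrite fsum_combine (proj1 (pa x)) /fsum (big_morph (l^~ b) (id1 := 0) (op1 := +%R)) //.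
  apply: eq_bigr => u _; rewrite lZl (proj1 (qb _)) scaler_sumr.
  by apply: eq_bigr => w _; rewrite /right foldl_cat.
have left_cat x : fsum (left x) (combine cat p q) = r a (r b x).
  rewrite fsum_combine (proj2 (qb x)) /fsum (big_morph (r a) (id1 := 0) (op1 := +%R)) // exchange_big.
  apply: eq_bigr => w _; rewrite rZr (proj2 (pa _)) scaler_sumr.
  by apply: eq_bigr => u _; rewrite /left foldr_cat scalerA mulrC -scalerA.
split=> x; rewrite right_cat left_cat.
  by rewrite (dialg_assocl dialg) (dialg_barl dialg) (dialg_assocr dialg).
by rewrite -(dialg_barr dialg) (dialg_assocl dialg) (dialg_assocr dialg).
Qed.

Lemma acts_aexp m : acts (aexp m) (meval (pats l r) v m).
Proof.
elim: m => [i|a IHa b IHb c IHc] /=; first by move=> x; rewrite !fsum_cons !fsum_nil !addr0 !scale1r.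
have L p q x y (px : acts p x) (qy : acts q y) := proj1 (acts_mul px qy).
have R p q x y (px : acts p x) (qy : acts q y) := proj2 (acts_mul px qy).
rewrite !catA; repeat apply: acts_cat; try apply: acts_opp;
  by [apply: (L _ _ _ _ (L _ _ _ _ _ _) _) | apply: (L _ _ _ _ (R _ _ _ _ _ _) _)
     | apply: (R _ _ _ _ (R _ _ _ _ _ _) _)].
Qed.

Variable e : D.

Let place (x : seq nat * seq nat) := left (right e x.2) x.1.

Lemma place_r p q b : acts q b -> fsum place (combine word_r p q) = l (fsum place p) b.
Proof.
move=> qb; rewrite fsum_combine /fsum (big_morph (l^~ b) (id1 := 0) (op1 := +%R)) //.
apply: eq_bigr => -[c [u w]] _; rewrite lZl -scaler_sumr; congr (_ *: _).
(* Inner associativity carries the new right factor past the letters on the left of the centre. *)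
have -> : l (place (u, w)) b = left (l (right e w) b) u.
  by rewrite /place /=; elim: u => //= i u <-; rewrite (dialg_inner dialg).
rewrite (proj1 (qb _)) /fsum (big_morph (left^~ u) (id1 := 0) (op1 := +%R)).
- by apply: eq_bigr => s _; rewrite /place /= /right foldl_cat; elim: u => //= i u <-; rewrite rZr.
- by move=> x y; elim: u => //= i u ->; rewrite rDr.
- by elim: u => //= i u ->; rewrite r0r.
Qed.

Lemma place_l p q b : acts q b -> fsum place (combine word_l p q) = r b (fsum place p).
Proof.
move=> qb; rewrite fsum_combine /fsum (big_morph (r b) (id1 := 0) (op1 := +%R)) //.
apply: eq_bigr => -[c [u w]] _; rewrite rZr -scaler_sumr; congr (_ *: _).
rewrite (proj2 (qb _)) /fsum; apply: eq_bigr => s _.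
by rewrite /place /left foldr_cat.
Qed.

Lemma fsum_cexp m : head 0%N (leaves m) = 0%N -> v 0%N = e ->
  meval (pats l r) v m = fsum place (cexp m).
Proof.
move=> + v0; elim: m => [i|a IHa b _ c _] /=.
  by move=> ->; rewrite fsum_cons fsum_nil addr0 scale1r.
have := size_leaves_gt0 a; case: (leaves a) IHa => [//|i w] IHa _ /= /IHa ea.
have [qb qc] := (acts_aexp b, acts_aexp c).
rewrite !fsum_cat !fsum_opp !(place_r _ qb, place_r _ qc, place_l _ qb, place_l _ qc) -ea.
by rewrite /pats !(dialg_assocr dialg) !addrA.
Qed.

End Bimodule.

Section PatsIdentities.
Variables (D : lmodType rat) (l r : D -> D -> D).
Hypothesis dialg : is_dialgebra l r.
Let mu := pats l r.
Let tri : is_trilinear mu := pats_tri dialg.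

Lemma fsum_expand v s : centred s && nilp (expand s) -> fsum (meval mu v) s = 0.
Proof.
move=> /andP[/allP cs /nilP ns].
have := fsum_collect pcmp_eq (fun x => foldr (fun i => r (v i)) (foldl (fun x i => l x (v i)) (v 0%N) x.2) x.1)
  (flatten [seq scale_sum x.1 (cexp x.2) | x <- s]).
rewrite -/(expand s) ns fsum_nil => ->.
rewrite fsum_flatten big_map /fsum big_seq [RHS]big_seq; apply: eq_bigr => x /cs /eqP hx.
by rewrite (fsum_cexp dialg hx (erefl _)) -fsum_scale.
Qed.

Lemma pats_identP : satisfies mu identP.
Proof.
move=> v; rewrite /identP tevalD !tevalU -[RHS](fsum_expand v expand_sumP).
by rewrite !fsum_cons fsum_nil addr0 !scale1r.
Qed.

Lemma pats_identQ : satisfies mu identQ.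
Proof.
move=> v; rewrite /identQ tevalD !tevalU -[RHS](fsum_expand v expand_sumQ).
by rewrite !fsum_cons fsum_nil addr0 !scale1r.
Qed.

(** The expansion is checked on the 120 terms of [relR]; P and Q, already established, transfer the
    result to the full alternating sums. *)
Lemma pats_identR : satisfies mu identR.
Proof.
move=> v; apply/(fsum_teval0 (teval_identR mu v)).
have := fsum_pnormal tri (identP_skew pats_identP) (identQ_skew pats_identQ) v
  (scale_sum (Zneg 12) (signed relR) ++ permR).
by rewrite relR_normal fsum_nil fsum_cat fsum_scale (fsum_expand v expand_relR) scaler0 add0r.
Qed.

Lemma pats_identS : satisfies mu identS.
Proof.
move=> v; apply/(fsum_teval0 (teval_identS mu v)).
by rewrite -(fsum_pnormal tri (identP_skew pats_identP) (identQ_skew pats_identQ)) (fsum_expand v expand_permS).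
Qed.

End PatsIdentities.

(** * Words in an associative algebra *)

Section AssociativeAlgebra.
Variable U : algType rat.
Local Notation mu := (pats (@GRing.mul U) (@GRing.mul U)).

(** When both products coincide, the PATS is the alternating ternary sum. *)
Lemma mul_dialgebra : is_dialgebra (@GRing.mul U) (@GRing.mul U).
Proof.
have bil : is_bilinear (@GRing.mul U).
  by split=> a k x y; rewrite ?mulrDl ?mulrDr -?scalerAl -?scalerAr.
by split=> // a b c; rewrite !mulrA.
Qed.

Lemma mul_ats : ats_mod mu (fun x => x = 0).
Proof.
have tri := pats_tri mul_dialgebra; split=> //.
- by move=> x y -> ->; rewrite addr0.
- by move=> c x ->; rewrite scaler0.
- by move=> x y z ->; rewrite (tril01 tri).
- move=> x y z; apply/eqP; rewrite addrC addr_eq0 /pats !opprD !opprK.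
  by rewrite [eqbLHS](ACl (3*5*1*6*2*4))%AC.
- move=> x y z; apply/eqP; rewrite addrC addr_eq0 /pats !opprD !opprK.
  by rewrite [eqbLHS](ACl (2*1*4*3*6*5))%AC.
move=> v; rewrite -(fsum_signed _ _ (sub_all _ relR_multilinear)).
  exact: fsum_expand mul_dialgebra _ _ expand_relR.
by move=> x /andP[].
Qed.

(** The six terms of the ternary sum are the six orders of the factors, and their signs are those of
    the leaf words because the blocks are odd. *)
Lemma meval_words v m : uniq (leaves m) -> meval mu v m =
  \sum_(x <- planar m) (sgn (leaves x) * sgn (leaves m)) *: \prod_(i <- leaves x) v i.
Proof.
have tri := pats_tri mul_dialgebra.
elim: m => [i|a IHa b IHb c IHc] /= u; first by rewrite !big_seq1 scale1r.
have := u; rewrite !cat_uniq => /and3P[ua _ /and3P[ub _ uc]].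
rewrite (big_planar _ a b c) {}IHa // {}IHb // {}IHc //.
pose D x := (sgn (leaves x) * sgn (leaves a)).
rewrite (big_morph (fun x => mu x _ _) (id1 := 0) (op1 := +%R)); first last.
- exact: (tril01 tri).
- by move=> x y; rewrite (trilD1 tri).
rewrite big_seq [RHS]big_seq; apply: eq_bigr => a' pa.
rewrite (big_morph (fun x => mu _ x _) (id1 := 0) (op1 := +%R)); first last.
- exact: (tril02 tri).
- by move=> x y; rewrite (trilD2 tri).
rewrite big_seq [RHS]big_seq; apply: eq_bigr => b' pb.
rewrite (big_morph (fun x => mu _ _ x) (id1 := 0) (op1 := +%R)); first last.
- exact: (tril03 tri).
- by move=> x y; rewrite (trilD3 tri).
rewrite big_seq [RHS]big_seq; apply: eq_bigr => c' pc.
rewrite (trilZ1 tri) (trilZ2 tri) (trilZ3 tri) !scalerA.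
have [la lb lc] := And3 (leaves_planar pa) (leaves_planar pb) (leaves_planar pc).
have := sgn_block u la lb lc; rewrite -!mulrA => <-.
rewrite /orders !big_cons big_nil /= addr0.
have [oa ob oc] := And3 (odd_leaves a') (odd_leaves b') (odd_leaves c').
have s12 p q s : odd (size p) -> odd (size q) -> sgn (q ++ p ++ s) = - sgn (p ++ q ++ s).
  exact: (@sgn_swap_odd [::]).
have s23 p q s : odd (size q) -> odd (size s) -> sgn (p ++ s ++ q) = - sgn (p ++ q ++ s).
  by move=> oq os; have := @sgn_swap_odd p _ _ [::] oq os; rewrite !cats0.
set A' := leaves a'; set B' := leaves b'; set C' := leaves c'.
have e1 := s23 A' _ _ ob oc. have e2 := s12 _ _ C' oa ob.
have e3 := s23 B' _ _ oa oc. have e4 := s12 _ _ B' oa oc. have e5 := s23 C' _ _ oa ob.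
rewrite e5 e4 e3 e2 e1 !opprK !mulNr !scaleNr !big_cat /= !mulrA.
rewrite /pats !scalerDr !scalerN !addrA.
by rewrite [RHS](ACl (1*2*3*5*4*6))%AC.
Qed.

Lemma tsum_words v z : tsum mu v z =
  \sum_(s : 'S_9) (\sum_(t <- shapes) hat z (prelabel s t)) *:
    (sgn (word_of_perm s) *: \prod_(i <- word_of_perm s) v i).
Proof.
pose G x := sgn (leaves x) *: \prod_(i <- leaves x) v i.
have twG m : m \in mtrees -> tw mu v m = \sum_(x <- mtrees) (cnt x m)%:R *: G x.
  move=> mM; have um : uniq (leaves m).
    by move: mM; rewrite mem_mtrees => /perm_uniq ->; exact: iota_uniq.
  rewrite sum_cnt // /tw meval_words // scaler_sumr; apply: eq_bigr => x _.
  by rewrite scalerA mulrCA sgnM_self ?mulr1.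
transitivity (\sum_(x <- mtrees) hat z x *: G x).
  rewrite /tsum /hat; under [RHS]eq_bigr => x _ do rewrite scaler_suml.
  rewrite [RHS]exchange_big big_seq [RHS]big_seq; apply: eq_bigr => m /twG ->.
  by rewrite scaler_sumr; apply: eq_bigr => x _; rewrite scalerA.
rewrite sum_mtrees; apply: eq_bigr => s _; rewrite scaler_suml big_seq [RHS]big_seq.
by apply: eq_bigr => t tS; rewrite /G leaves_shape.
Qed.

End AssociativeAlgebra.

(* The path algebra of the path 0 -> 1 -> ... -> 9 whose edges carry the letters of [w]. *)
Definition path_mx (w : seq nat) (i : nat) : 'M[rat]_10 :=
  delta_mx (inord (index i w)) (inord (index i w).+1).

(** The only edge leaving vertex k carries the letter of [w] at position k, so a nonzero product
    must spell a segment of [w]. *)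
Lemma path_mx_prod w u k : uniq w -> size w = 9%N -> {subset u <= w} -> (k + size u <= 9)%N ->
  (\prod_(i <- u) path_mx w i) (inord k) (inord (k + size u)) =
  (u == take (size u) (drop k w))%:R.
Proof.
move=> uw sw; elim: u k => [|i u IHu] k uS ku.
  by rewrite big_nil take0 eqxx addn0 mxE eqxx.
have k9 : (k < 9)%N by move: ku => /=; lia.
have iw : (index i w < 9)%N by rewrite -sw index_mem uS ?mem_head.
rewrite big_cons mxE (drop_nth 0%N) ?sw // take_cons.
rewrite (bigD1 (inord (index i w).+1)) //= [X in _ + X]big1 ?addr0 => [|j jk]; last first.
  by rewrite /path_mx mxE (negbTE jk) andbF mul0r.
rewrite /path_mx mxE eqxx andbT eqseq_cons.
have -> : (inord k == inord (index i w) :> 'I_10) = (i == nth 0%N w k).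
  rewrite -val_eqE /= !inordK; [|lia|lia]; apply/eqP/eqP => [-> | ->].
    by rewrite nth_index // uS ?mem_head.
  by rewrite index_uniq ?sw.
case: eqP => [ik | _]; last by rewrite mul0r.
rewrite mul1r -/(path_mx w) addnS -addSn -IHu => [||]; last by rewrite addSnnS.
  by rewrite ik index_uniq ?sw.
by move=> j ju; rewrite uS // inE ju orbT.
Qed.

Lemma path_mx_word w u : uniq w -> size w = 9%N -> perm_eq u w ->
  (\prod_(i <- u) path_mx w i) (inord 0) (inord 9) = (u == w)%:R.
Proof.
move=> uw sw puw; have su : size u = 9%N by rewrite (perm_size puw).
have := @path_mx_prod w u 0 uw sw; rewrite drop0 su take_oversize ?sw // => -> // i.
by rewrite (perm_mem puw).
Qed.

(** At the path matrices of one word, the entry from vertex 0 to vertex 9 isolates the coefficient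
    of that word. *)
Lemma vanishes_of_tsum z :
  (forall v, tsum (pats (@GRing.mul 'M[rat]_10) (@GRing.mul _)) v z = 0) -> vanishes z.
Proof.
move=> z0 s; have := z0 (path_mx (word_of_perm s)); rewrite tsum_words.
move/(congr1 (fun M : 'M_10 => M (inord 0) (inord 9))).
rewrite summxE (bigD1 s) //= [X in _ + X]big1 ?addr0 => [|t ts]; rewrite !mxE.
  rewrite path_mx_word ?size_word_of_perm ?uniq_word_of_perm // eqxx mulr1 => /eqP.
  by rewrite mulf_eq0 => /orP[/eqP // |]; rewrite /sgn uniq_word_of_perm signr_eq0.
have pw (r : 'S_9) : perm_eq (word_of_perm r) (iota 0 9) by apply/word_of_permP; exists r.
rewrite path_mx_word ?size_word_of_perm ?uniq_word_of_perm ?(perm_trans (pw t)) 1?perm_sym //.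
by rewrite (inj_eq (@word_of_perm_inj 9)) (negbTE ts) !mulr0.
Qed.

Lemma conseq_vanishes z : conseq z -> vanishes z.
Proof. by move=> cz; apply: vanishes_of_tsum => v; apply: cz (mul_ats _) v. Qed.

(** * Sibling leaves *)

(** Modulo consequences, [t] acts on [z] as the scalar [c]; the value -1 is needed for blocks of
    sizes (3, 3, 2, 1). *)
Definition cmod (c : rat) (t : 'S_9) (z : tmonomial -> rat) : Prop :=
  conseq (fun m => z (prelabel t m) - c * z m).

Lemma cmodM c d s t z : cmod c s z -> cmod d t z -> cmod (c * d) (s * t)%g z.
Proof.
move=> cs dt; apply: conseq_eq (conseqD (conseq_prelabel s dt) (conseqZ d cs)) => m mM /=.
by rewrite prelabelM -?mem_mtrees // mulrBr mulrA [d * c]mulrC addrA subrK.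
Qed.

Lemma conseq0 z : {in mtrees, forall m, z m = 0} -> conseq z.
Proof.
move=> z0 U mu N ats v; rewrite (eq_tsum mu v (z := fun=> 0 * 0)) => [|m /z0 ->].
  by rewrite tsumZ scale0r; apply: ats_0 ats.
by rewrite mulr0.
Qed.

Lemma cmod1 z : cmod 1 1%g z.
Proof.
apply: conseq0 => m mM; rewrite prelabel1 ?mul1r ?subrr //.
by rewrite -mem_mtrees.
Qed.

Lemma cmodM1 s t z : cmod 1 s z -> cmod 1 t z -> cmod 1 (s * t)%g z.
Proof. by move=> cs ct; have := cmodM cs ct; rewrite mul1r. Qed.

Lemma cmod_relabel c (s t : 'S_9) z : cmod c (t ^ s)%g z -> cmod c t (fun m => z (prelabel s m)).
Proof.
move=> ct; apply: conseq_eq (conseq_prelabel s ct) => m mM /=.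
by rewrite !prelabelM -?mem_mtrees ?prelabel_mtrees // conjgE !mulgA mulgV mul1g.
Qed.

(** Adjacent transpositions that generate the symmetric groups of consecutive blocks, of sizes 3, 2,
    2, 2 here and 3, 3, 2, 1 in [blocksB]. *)
Definition blocksA : seq (nat * nat) := [:: (0, 1); (1, 2); (3, 4); (5, 6); (7, 8)]%N.
Definition blocksB : seq (nat * nat) := [:: (0, 1); (1, 2); (3, 4); (4, 5); (6, 7)]%N.

Definition transp (s : 'S_9) (p : nat * nat) : 'S_9 := tperm (s (inord p.1)) (s (inord p.2)).

Lemma conseq_blocksA (s : 'S_9) z : vanishes z ->
  {in blocksA, forall p, cmod 1 (transp s p) z} -> conseq z.
Proof.
move=> vz cz; suff : conseq (fun m => z (prelabel s m)).
  by move/(conseq_prelabel s^-1%g); apply: conseq_eq => m mM; rewrite prelabelVK.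
apply: (conseq_of_stab conseq_vanishes (vanishes_prelabel s vz)) => h sh.
suff: cmod 1 h (fun m => z (prelabel s m)) by apply: conseq_eq => m _ /=; rewrite mul1r.
elim/stab_ind: h / sh => [|h i j ij hP].
  exact: cmod1.
apply: cmodM1 hP _; apply: cmod_relabel; rewrite tpermJ.
by have := cz _ ij; rewrite /transp /= !inord_val.
Qed.

Definition swapn (i j k : nat) : nat := if k == i then j else if k == j then i else k.

Lemma tperm_inord i j k : (i < 9)%N -> (j < 9)%N -> (k < 9)%N ->
  tperm (inord i) (inord j) (inord k) = inord (swapn i j k) :> 'I_9.
Proof.
move=> i9 j9 k9; have E a b : (a < 9)%N -> (b < 9)%N -> (inord a == inord b :> 'I_9) = (a == b).
  by move=> a9 b9; rewrite -val_eqE /= !inordK.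
by rewrite /swapn permE /= !E //; case: ifP => // _; case: ifP.
Qed.

Lemma transp_J (s : 'S_9) p q : all (fun i => i < 9)%N [:: p.1; p.2; q.1; q.2] ->
  (transp s p ^ transp s q)%g = transp s (swapn q.1 q.2 p.1, swapn q.1 q.2 p.2).
Proof.
move=> /and5P[p1 p2 q1 q2 _]; rewrite /transp tpermJ.
by rewrite -!(tpermJ (inord q.1) (inord q.2) s) !permJ !tperm_inord.
Qed.

Lemma transpM (s : 'S_9) i j p : all (fun i => i < 9)%N [:: i; j; p.1; p.2] ->
  transp (tperm (inord i) (inord j) * s)%g p = transp s (swapn i j p.1, swapn i j p.2).
Proof. by move=> /and5P[i9 j9 p1 p2 _]; rewrite /transp !permM !tperm_inord. Qed.

Lemma transpC (s : 'S_9) i j : transp s (i, j) = transp s (j, i).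
Proof. exact: tpermC. Qed.

(* The symmetrization of [z] over (5 8) has the class (5 8) in place of 5 and 8. *)
Lemma blocksB_skew (s : 'S_9) z : vanishes z ->
  {in [:: (0, 1); (1, 2); (3, 4); (6, 7)]%N, forall p, cmod 1 (transp s p) z} ->
  cmod (-1) (transp s (5, 8)%N) z.
Proof.
move=> vz cz; set t := transp s (5, 8)%N.
pose y m := z m + 1 * z (prelabel t m).
suff : conseq y by apply: conseq_eq => m _; rewrite mulN1r opprK /y mul1r addrC.
have ct p : all (fun i => i < 9)%N [:: p.1; p.2] -> (swapn 5 8 p.1, swapn 5 8 p.2) = p ->
    cmod 1 (transp s p) z -> cmod 1 (transp s p) y.
  move=> /and3P[p1 p2 _] pt cp.
  have cpt : cmod 1 (transp s p) (fun m => z (prelabel t m)).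
    by apply: cmod_relabel; rewrite transp_J /= ?p1 ?p2 // pt.
  by apply: conseq_eq (conseqD cp cpt) => m _; rewrite /y !mul1r opprD addrACA.
(* This relabelling carries the pairs (5, 6) and (7, 8) of [blocksA] to (5, 8) and (6, 7) and keeps
   the other three. *)
apply: (@conseq_blocksA (tperm (inord 6) (inord 8) * (tperm (inord 6) (inord 7) * s))%g).
  exact: vanishesD vz (vanishesZ 1 (vanishes_prelabel t vz)).
move=> p; rewrite !inE => /or4P[| | |/orP[]] /eqP ->; rewrite !transpM //=.
- by apply: ct => //; apply: cz.
- by apply: ct => //; apply: cz.
- by apply: ct => //; apply: cz.
- apply: conseq0 => m mM; rewrite -/t /y prelabelM -?mem_mtrees //.
  by rewrite tperm2 prelabel1 -?mem_mtrees // !mul1r [z m + _]addrC subrr.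
- by apply: ct => //; apply: cz.
Qed.

(** Both (5 8) and (3 8) act as -1, hence so does (3 5), the conjugate of one by the other. But 3
    and 5 lie in one block, so (3 5) also acts as 1, and 2 [z] is a consequence. *)
Lemma conseq_blocksB (s : 'S_9) z : vanishes z ->
  {in blocksB, forall p, cmod 1 (transp s p) z} -> conseq z.
Proof.
move=> vz cz.
have c58 : cmod (-1) (transp s (5, 8)%N) z.
  by apply: blocksB_skew => // p; rewrite !inE => /or4P[] /eqP ->; apply: cz.
have c38 : cmod (-1) (transp s (3, 8)%N) z.
  (* The same argument with 3 and 5 exchanged, which preserves the block {3, 4, 5}. *)
  have := @blocksB_skew (tperm (inord 3) (inord 5) * s)%g z vz; rewrite transpM //=; apply.
  by move=> p; rewrite !inE => /or4P[] /eqP ->; rewrite transpM //=; first [exact: cz | rewrite transpC; exact: cz].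
have tV p : (transp s p)^-1%g = transp s p by exact: tpermV.
have J p q c d : cmod c (transp s q) z -> cmod d (transp s p) z ->
    all (fun i => i < 9)%N [:: p.1; p.2; q.1; q.2] ->
    cmod (c * d * c) (transp s (swapn q.1 q.2 p.1, swapn q.1 q.2 p.2)) z.
  by move=> cq cp pq; rewrite -transp_J // conjgE tV mulgA; apply: cmodM (cmodM cq cp) cq.
have m35 := J (5, 8)%N (3, 8)%N _ _ c38 c58 isT.
have p35 := J (4, 5)%N (3, 4)%N _ _ (cz (3, 4)%N isT) (cz (4, 5)%N isT) isT.
move: m35 p35; rewrite /= /swapn /= transpC => m35 p35.
apply: conseq_eq (conseqZ (2%:R^-1) (conseqB m35 p35)) => m _ /=.
rewrite !mulN1r !mulr1 opprK !mul1r.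
by rewrite opprB addrC addrA subrK -mulr2n -[z m *+ 2]mulr_natl mulrA mulVf ?mul1r.
Qed.

Fixpoint sibling_groups (m : tmonomial) : seq (seq nat) :=
  match m with
  | TVar _ => [::]
  | TMul a b c =>
      pmap (fun t => if t is TVar i then Some i else None) [:: a; b; c] ::
      sibling_groups a ++ sibling_groups b ++ sibling_groups c
  end.

(** Larger groups come first, so that the pairs of positions in [blocksA] or [blocksB] fall inside
    the groups. *)
Definition block_word (m : tmonomial) : seq nat :=
  let w := flatten (sort (fun u v => size v <= size u)%N (sibling_groups m)) in
  w ++ [seq i <- iota 0 9 | i \notin w].

Definition planar_swap (t : tmonomial) (i j : nat) : bool :=
  if tcmp (canon (relabel (swapn i j) t)) (canon t) is Eq then true else false.

(** Groups of sizes (3, 2, 2, 2) fit [blocksA]; sizes (3, 3, 2, 1) and (3, 3, 3, 0) both fit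
    [blocksB], which uses only two leaves of a third triple. *)
Lemma shapes_blocks :
  all (fun t => let w := block_word t in perm_eq w (iota 0 9) &&
    has (all (fun p => planar_swap t (nth 0 w p.1) (nth 0 w p.2))) [:: blocksA; blocksB]) shapes.
Proof. by vm_compute. Qed.

Lemma canon_planarP x y : canon x = canon y -> x \in planar y.
Proof.
by move=> xy; rewrite -has_pred1 has_count -/(cnt x y) cnt_canon xy eqxx cnt_canon_gt0.
Qed.

Lemma nth_tperm (i j : 'I_9) k : (k < 9)%N -> nth 0%N (word_of_perm (tperm i j)) k = swapn i j k.
Proof.
move=> k9; rewrite -[k in LHS](inordK k9) nth_word_of_perm -[i]inord_val -[j]inord_val.
rewrite tperm_inord ?ltn_ord // !inordK ?ltn_ord // /swapn.
by case: ifP => _; [|case: ifP => _]; rewrite ?ltn_ord.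
Qed.

Lemma sum_delta (V : lmodType rat) (F : tmonomial -> V) m : m \in mtrees ->
  \sum_(x <- mtrees) (x == m)%:R *: F x = F m.
Proof.
move=> mM; rewrite (bigD1_seq m) ?uniq_mtrees //= eqxx scale1r big1 ?addr0 // => x xm.
by rewrite (negbTE xm) scale0r.
Qed.

(* Swapping sibling leaves only changes the planar embedding. *)
Lemma mtrees_blocks m : m \in mtrees -> exists s : 'S_9, exists2 bs, bs \in [:: blocksA; blocksB] &
  {in bs, forall p, prelabel (transp s p) m \in planar m}.
Proof.
case/allpairsP => -[s t] [_ /= tS ->].
have /andP[/word_of_permP[r wr] /hasP[bs bsAB /allP bsP]] := allP shapes_blocks t tS.
have lt : perm_eq (leaves t) (iota 0 9) by rewrite (shapes_leaves tS).
exists (r * s)%g, bs => // p pb.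
have /andP[p1 p2] : (p.1 < 9)%N && (p.2 < 9)%N.
  have /allP/(_ _ bsAB)/allP/(_ _ pb) // : all (all (fun p : nat * nat => (p.1 < 9)%N && (p.2 < 9)%N)) [:: blocksA; blocksB] by [].
rewrite prelabelM // /transp !permM -tpermJ conjgE !mulgA mulgV mul1g -prelabelM //.
rewrite planar_relabel map_f //; apply: canon_planarP.
have := bsP p pb; rewrite /planar_swap; case E: (tcmp _ _) => // _; rewrite -(tcmp_eq E).
congr canon; apply: eq_subst => i; rewrite (perm_mem lt) mem_iota /= => i9.
by rewrite nth_tperm // wr -!(nth_word_of_perm r) !inordK.
Qed.

Lemma vanishes_conseq z : vanishes z -> conseq z.
Proof.
have [k [kv kP kJ]] := equivariant_projection.
move=> vz; apply: (conseq_eq (y := fun x => \sum_(m <- mtrees) z m * k m x)) => [x xM|].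
  by rewrite -kP.
apply: conseq_sum => m mM; apply: conseqZ.
have [s [bs bsAB bsP]] := mtrees_blocks mM.
have ck : {in bs, forall p, cmod 1 (transp s p) (k m)}.
  move=> p /bsP; set t := transp s p; set m' := prelabel t m => mm'.
  have m'M : m' \in mtrees := planar_mtrees mM mm'.
  (* The coefficients of m' - m, a consequence by alternation alone. *)
  pose e x : rat := (x == m')%:R - (x == m)%:R.
  have ce : conseq e.
    move=> U mu N ats v; rewrite /tsum; under eq_bigr => x _ do rewrite scalerBl.
    by rewrite sumrB !sum_delta //; exact: (tw_planar ats v mm').
  apply: conseq_eq (ce) => x xM; rewrite mul1r (kP e (conseq_vanishes ce) x xM).
  have tt y : y \in mtrees -> prelabel t (prelabel t y) = y.
    by rewrite mem_mtrees => py; rewrite prelabelM // tperm2 prelabel1.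
  (* As [t] is an involution, equivariance turns [k m] at the relabelled monomial into [k m'] at
     [x]; the difference is the image of [e], which is [e] itself. *)
  rewrite -[X in _ = X - _](kJ t m) ?prelabel_mtrees // tt // -/m'.
  under eq_bigr => y _ do rewrite mulrBl.
  by rewrite sumrB; congr (_ - _); apply: (@sum_delta rat^o (fun y => k y x)).
by move: bsAB ck; rewrite !inE => /orP[/eqP -> | /eqP ->];
  [apply: conseq_blocksA | apply: conseq_blocksB]; apply: kv.
Qed.

(** * Splitting by the centre *)

Section Doubling.
Variable U : algType rat.
Local Notation mu := (pats (@GRing.mul U) (@GRing.mul U)).

(* Both products depend on the noncentral factor [n] only through [n.1 + n.2], so
   the first components of a value collect the monomials with prescribed centre. *)
Definition dbl_l (m n : U * U) : U * U := (m.1 * (n.1 + n.2), m.2 * (n.1 + n.2)).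
Definition dbl_r (m n : U * U) : U * U := ((m.1 + m.2) * n.1, (m.1 + m.2) * n.2).

Lemma dbl_dialgebra : is_dialgebra dbl_l dbl_r.
Proof.
split; rewrite /dbl_l /dbl_r.
- split=> [b k a a' | a k b b'] /=; apply: injective_projections => /=;
    rewrite ?mulrDl -?scalerAl //.
    by rewrite addrACA -scalerDr mulrDr -scalerAr.
  by rewrite addrACA -scalerDr mulrDr -scalerAr.
- split=> [b k a a' | a k b b'] /=; apply: injective_projections => /=;
    rewrite ?[LHS]mulrDr -?scalerAr //.
    by rewrite addrACA -scalerDr mulrDl -scalerAl.
  by rewrite addrACA -scalerDr mulrDl -scalerAl.
- by move=> a b c /=; rewrite -!mulrDl !mulrA.
- by move=> a b c /=; rewrite -!mulrDr !mulrA.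
- by move=> a b c /=; rewrite !mulrA.
- by move=> a b c /=; rewrite -!mulrDl -!mulrDr.
- by move=> a b c /=; rewrite -!mulrDl -!mulrDr.
Qed.

(** Adding the components maps both dialgebra products to the product of [U]. *)
Lemma dbl_sum u m : (meval (pats dbl_l dbl_r) u m).1 + (meval (pats dbl_l dbl_r) u m).2 =
  meval mu (fun i => (u i).1 + (u i).2) m.
Proof.
elim: m => //= a <- b <- c <-.
rewrite {1 2}/pats /dbl_l /dbl_r /= -!mulrDr.
set A := meval _ u a; set B := meval _ u b; set C := meval _ u c.
rewrite (trilD1 (pats_tri (mul_dialgebra U))) /pats.
by [].
Qed.

Lemma dbl_fst p q s : (pats dbl_l dbl_r p q s).1 = mu p.1 (q.1 + q.2) (s.1 + s.2).
Proof. by rewrite /pats /dbl_l /dbl_r /= -!mulrDr. Qed.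

Lemma dbl_centre u x m : (forall i, (u i).1 = if i == x then (u i).1 + (u i).2 else 0) ->
  (meval (pats dbl_l dbl_r) u m).1 =
  if head 0%N (leaves m) == x then meval mu (fun i => (u i).1 + (u i).2) m else 0.
Proof.
move=> ux; elim: m => [i|a IHa b _ c _]; first by rewrite /= -ux.
rewrite [leaves _]/=; have -> : head 0%N (leaves a ++ leaves b ++ leaves c) = head 0%N (leaves a).
  by have := size_leaves_gt0 a; case: (leaves a).
rewrite dbl_fst !dbl_sum IHa; case: ifP => // _.
by rewrite (tril01 (pats_tri (mul_dialgebra U))).
Qed.

End Doubling.

Lemma centre_vanishes (c : tmonomial -> rat) (x : nat) :
  (forall (D : lmodType rat) (l r : D -> D -> D) v, is_dialgebra l r ->
     \sum_(m <- mtrees) c m *: meval (pats l r) v m = 0) ->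
  vanishes (fun m => (head 0%N (leaves m) == x)%:R * (sgn (leaves m) * c m)).
Proof.
move=> c0; apply: vanishes_of_tsum => v.
(* Only [x] has a first component, and a first component of the value arises only from the
   centre. *)
pose u i : 'M[rat]_10 * 'M[rat]_10 := if i == x then (v i, 0) else (0, v i).
have us i : (u i).1 + (u i).2 = v i by rewrite /u; case: ifP; rewrite /= ?addr0 ?add0r.
have ux i : (u i).1 = if i == x then (u i).1 + (u i).2 else 0.
  by rewrite us /u; case: ifP.
rewrite -[RHS](congr1 fst (c0 _ _ _ u (dbl_dialgebra _))) raddf_sum /tsum big_seq [RHS]big_seq.
apply: eq_bigr => m; rewrite mem_mtrees => /perm_uniq um.
rewrite /tw [RHS]/= (dbl_centre m ux) scalerA.
under [in RHS]eq_meval => i _ do rewrite us.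
case: eqP => _; last by rewrite mul0r mul0r !scale0r scaler0.
by rewrite mul1r mulrAC sgnM_self ?mul1r // um iota_uniq.
Qed.

Section NullExtensionCentre.
Variables (A : lmodType rat) (mu : A -> A -> A -> A).
Hypothesis tri : is_trilinear mu.
Variables (u : nat -> A * A) (x : nat).
Hypothesis ux : forall i, (u i).2 = if i == x then (u i).1 else 0.

Lemma nullext_notin m : x \notin leaves m -> (meval (nullext mu) u m).2 = 0.
Proof.
elim: m => [i|a IHa b IHb c IHc] /=; first by rewrite inE eq_sym ux => /negbTE ->.
rewrite !mem_cat !negb_or => /and3P[/IHa -> /IHb -> /IHc ->].
by rewrite !(tril01 tri) subrr addr0.
Qed.

(** Only [x] has a nonzero second component, and it occurs in the first factor alone, so the other
    two terms of the second component of the product vanish. *)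
Lemma nullext_centre m : uniq (leaves m) -> head 0%N (leaves m) = x ->
  (meval (nullext mu) u m).2 = meval mu (fun i => (u i).1) m.
Proof.
elim: m => [i|a IHa b _ c _] /=; first by move=> _ ->; rewrite ux eqxx.
rewrite cat_uniq => /and3P[ua /hasPn nbc _].
have xa : head 0%N (leaves a ++ leaves b ++ leaves c) = x -> head 0%N (leaves a) = x /\ x \in leaves a.
  have := size_leaves_gt0 a; case: (leaves a) => //= y w _ ->; by rewrite mem_head.
move=> /xa[hx xa'].
have nb : x \notin leaves b by apply: contraL xa' => xb; apply: nbc; rewrite mem_cat xb.
have nc : x \notin leaves c by apply: contraL xa' => xc; apply: nbc; rewrite mem_cat xc orbT.
by rewrite (nullext_notin nb) (nullext_notin nc) !(tril01 tri) subr0 addr0 IHa // !meval_nullext1.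
Qed.

End NullExtensionCentre.

Lemma pats_identities_follow (A : lmodType rat) (mu : A -> A -> A -> A) (c : tmonomial -> rat) v :
  is_trilinear mu ->
  satisfies mu identP -> satisfies mu identQ -> satisfies mu identR -> satisfies mu identS ->
  (forall (D : lmodType rat) (l r : D -> D -> D) v, is_dialgebra l r ->
     \sum_(m <- mtrees) c m *: meval (pats l r) v m = 0) ->
  \sum_(m <- mtrees) c m *: meval mu v m = 0.
Proof.
move=> tri idP idQ idR idS c0.
have ct x : \sum_(m <- mtrees) (head 0%N (leaves m) == x)%:R *: (c m *: meval mu v m) = 0.
  (* With this valuation the second component returns the ordinary value of each monomial with
     centre [x]; the other monomials have coefficient zero. *)
  pose u i : A * A := (v i, if i == x then v i else 0).
  have [e0 _] := vanishes_conseq (centre_vanishes x c0) (nullext_ats tri idP idQ idR idS) u.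
  rewrite -[RHS]e0 /tsum raddf_sum big_seq [RHS]big_seq; apply: eq_bigr => m.
  rewrite mem_mtrees => /perm_uniq um; rewrite /tw /=.
  case: eqP => hx; last by rewrite mul0r !scale0r.
  have um' : uniq (leaves m) by rewrite um iota_uniq.
  rewrite (nullext_centre tri (u := u) (x := x)) // scale1r scalerA mul1r.
  by rewrite mulrAC sgnM_self // mul1r.
(* Each monomial has exactly one centre among the nine variables. *)
transitivity (\sum_(x <- iota 0 9) \sum_(m <- mtrees) (head 0%N (leaves m) == x)%:R *: (c m *: meval mu v m)).
  rewrite exchange_big big_seq [RHS]big_seq; apply: eq_bigr => m; rewrite mem_mtrees => pm.
  rewrite -scaler_suml -natr_sum; have -> : (\sum_(x <- iota 0 9) (head 0%N (leaves m) == x) = 1)%N.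
    have h9 : head 0%N (leaves m) \in iota 0 9.
      by rewrite -(perm_mem pm); have := size_leaves_gt0 m; case: (leaves m) => //= y w _; rewrite mem_head.
    have := count_uniq_mem (head 0%N (leaves m)) (iota_uniq 0 9).
    rewrite h9 -sum1_count big_mkcond; apply: etrans.
    by apply: eq_bigr => x _; rewrite /= eq_sym; case: eqP.
  by rewrite scale1r.
by rewrite big1 // => x _; apply: ct.
Qed.

(** * Degrees of P, Q, R and S, and arbitrary names of variables *)

Definition homogeneous n (f : tpoly) : Prop := forall m, tdegree m != n -> f@_m = 0.

Lemma homogeneousP n f : homogeneous n f -> of_degree n f.
Proof. by move=> hf m; rewrite -mcoeff_neq0; apply: contraNeq => /hf ->. Qed.

Lemma homogeneousD n f g : homogeneous n f -> homogeneous n g -> homogeneous n (f + g).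
Proof. by move=> hf hg m mn; rewrite mcoeffD hf ?hg ?addr0. Qed.

Lemma homogeneousZ n c f : homogeneous n f -> homogeneous n (c *: f).
Proof. by move=> hf m mn; rewrite mcoeffZ hf ?mulr0. Qed.

Lemma homogeneousVZ n k f : homogeneous n f -> homogeneous n (k%:R^-1 *: f).
Proof. exact: homogeneousZ. Qed.

Lemma homogeneousB n f g : homogeneous n f -> homogeneous n g -> homogeneous n (f - g).
Proof. by move=> hf hg m mn; rewrite mcoeffB hf ?hg ?subr0. Qed.

Lemma homogeneousU n m : tdegree m = n -> homogeneous n << m >>.
Proof. by move=> <- k; apply: contraNeq; rewrite mcoeffU; case: (m =P k) => [-> // | _]; rewrite eqxx. Qed.

Lemma homogeneous_alt_sum n k (F : 'S_k.+1 -> tmonomial) :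
  (forall s, tdegree (F s) = n) -> homogeneous n (alt_sum F).
Proof.
move=> Fn; rewrite /alt_sum; elim/big_rec: _ => [|s f _ hf]; first by move=> m _; rewrite mcoeff0.
by apply: homogeneousD hf; apply: homogeneousZ; apply: homogeneousU.
Qed.

Lemma lower_PQRS g : PQRS g -> lower_pats_identity 9 g.
Proof.
case=> ->.
- exists 3; split=> //; last by move=> D l r dialg; apply: pats_identP.
  by apply: homogeneousP; apply: homogeneousD; apply: homogeneousU.
- exists 5; split=> //; last by move=> D l r dialg; apply: pats_identQ.
  by apply: homogeneousP; apply: homogeneousD; apply: homogeneousU.
- exists 7; split=> //; last by move=> D l r dialg; apply: pats_identR.
  by apply: homogeneousP; apply: homogeneousB; apply: homogeneousVZ; apply: homogeneous_alt_sum.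
- exists 7; split=> //; last by move=> D l r dialg; apply: pats_identS.
  apply: homogeneousP; apply: homogeneousB; [apply: homogeneousB; [apply: homogeneousD;
    [apply: homogeneousD; [apply: homogeneousB|]|]|]|];
  by apply: homogeneousVZ; apply: homogeneous_alt_sum.
Qed.

Theorem mainTheorem5 (f : {malg rat[tmonomial]}) :
  multilinear 9 f -> pats_identity f ->
  ~ new_pats_identity 9 f /\ consequence PQRS f.
Proof.
case=> xs [uxs sxs fxs] idf.
suff cf : consequence PQRS f.
  split=> // -[_ _]; apply=> A mu tri low; apply: cf tri _ => g /lower_PQRS; exact: low.
(* The nine variables [xs] of [f] are renamed to 0, ..., 8, so that its monomials become members of
   [mtrees]. *)
pose to := relabel (nth 0%N xs); pose from := relabel (index^~ xs).
have toK : {in mtrees, cancel to from}.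
  move=> m; rewrite mem_mtrees => pm; rewrite /from /to relabel_comp; apply: relabel_id => i.
  by rewrite (perm_mem pm) mem_iota -sxs => /= ixs; rewrite index_uniq.
have fromK m : perm_eq (leaves m) xs -> to (from m) = m.
  move=> pm; rewrite /from /to relabel_comp; apply: relabel_id => i.
  by rewrite (perm_mem pm) => ixs; rewrite /= nth_index.
have fromM m : perm_eq (leaves m) xs -> from m \in mtrees.
  move=> pm; rewrite mem_mtrees leaves_relabel -sxs -(map_index_self uxs).
  exact: perm_map.
have eval (A : lmodType rat) (mu : A -> A -> A -> A) v :
    teval mu v f = \sum_(m <- mtrees) f@_(to m) *: meval mu (v \o nth 0%N xs) m.
  rewrite (teval_supp _ _ (S := map to mtrees)).
  - by rewrite big_map; apply: eq_bigr => m _; rewrite meval_relabel.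
  - by rewrite (map_inj_in_uniq (can_in_inj toK)) uniq_mtrees.
  - by move=> m /fxs pm; rewrite -(fromK m pm) map_f ?fromM.
move=> A mu tri sat v; rewrite eval.
apply: (pats_identities_follow _ tri (sat _ (Or41 _ _ _ erefl)) (sat _ (Or42 _ _ _ erefl))
  (sat _ (Or43 _ _ _ erefl)) (sat _ (Or44 _ _ _ erefl))).
move=> D l r w dialg.
have := idf D l r dialg (w \o index^~ xs); rewrite eval => {2}<-.
rewrite big_seq [RHS]big_seq; apply: eq_bigr => m; rewrite mem_mtrees => pm.
congr (_ *: _); apply: eq_meval => i; rewrite (perm_mem pm) mem_iota -sxs /= => ixs.
by rewrite index_uniq.
Qed.
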